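(* Let $G$ be a bipartite graph, let $k$ be a positive integer, let $m$ be a nonnegative integer, and let $f:V(G)\rightarrow \mathbb{Z}_k$ be a mapping compatible with $G$. If $G$ is $(2m+4k-4)$-edge-connected, then $G$ has an $m$-tree-connected factor $H$ such that $d_H(v)\equiv f(v) \pmod k$ for every vertex $v$, and for each vertex $v$, $$\left\lfloor \frac{d_G(v)}{2} \right\rfloor -(k-1) \le d_H(v) \le \left\lceil \frac{d_G(v)}{2}\right\rceil+(k-1)+m.$$
   Context: Graphs may have loops and multiple edges. A factor of $G$ is a spanning subgraph. A graph is $m$-tree-connected if it contains $m$ edge-disjoint spanning trees (every graph is $0$-tree-connected). For a set $A\subseteq V(G)$, $e_G(A)$ is the number of edges of $G$ with both ends in $A$. A mapping $f:V(G)\to\mathbb{Z}_k$ is compatible with $G$ with respect to a partition $X,Y$ of $V(G)$ if either $\sum_{v\in X} f(v)-2x\equiv \sum_{v\in Y}f(v) \pmod k$ for some integer $x$ with $0\le x\le e_G(X)$, or $\sum_{v\in X} f(v)\equiv \sum_{v\in Y}f(v)-2y \pmod k$ for some integer $y$ with $0\le y\le e_G(Y)$; $f$ is compatible with $G$ if it is compatible with $G$ with respect to every partition $X,Y$ of $V(G)$. *)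

(* Defs.v *)
From mathcomp Require Import all_boot all_order all_algebra.

Set Implicit Arguments.
Unset Strict Implicit.
Unset Printing Implicit Defensive.

(* Finite undirected multigraphs with loops: the order of the two ends of an
   edge is irrelevant, and an edge is a loop when its two ends are equal.
   A factor (spanning subgraph) of G is given by its edge set F : {set edge G};
   G itself is the factor [set: edge G]. *)
Record mgraph := MGraph {
  vert : finType;
  edge : finType;
  ends : edge -> vert * vert
}.

Section MGraph.
Variable G : mgraph.
Implicit Types (x y v : vert G) (e : edge G) (F T D : {set edge G}).
Implicit Types (X Y A : {set vert G}).

Definition joins e x y : bool := (ends e == (x, y)) || (ends e == (y, x)).

Definition adj F : rel (vert G) := [rel x y | [exists e in F, joins e x y]].

Definition connected F : Prop := forall x y, connect (adj F) x y.

(* A loop contributes 2 to the degree of its vertex. *)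
Definition deg F v : nat :=
  \sum_(e in F) (((ends e).1 == v) + ((ends e).2 == v)).

Definition edges_in A : nat :=
  #|[set e : edge G | ((ends e).1 \in A) && ((ends e).2 \in A)]|.

Definition bipartite : Prop :=
  exists A, forall e, ((ends e).1 \in A) != ((ends e).2 \in A).

Definition edge_connected (r : nat) : Prop :=
  forall D, #|D| < r -> connected (~: D).

(* A cycle v_0 e_0 v_1 e_1 ... v_(n-1) e_(n-1) v_0 with n > 0, distinct
   vertices and distinct edges, is listed as the pairs (v_i, e_i). A loop is a
   cycle with n = 1, and two parallel edges form a cycle with n = 2. *)
Definition is_cycle (s : seq (vert G * edge G)) : bool :=
  [&& s != [::], uniq (unzip1 s), uniq (unzip2 s)
    & cycle [rel p q | joins p.2 p.1 q.1] s].

Definition acyclic F : Prop :=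
  forall s, is_cycle s -> ~ {subset unzip2 s <= F}.

Definition spanning_tree T : Prop := connected T /\ acyclic T.

Definition tree_connected (m : nat) F : Prop :=
  exists T : 'I_m -> {set edge G},
    (forall i, T i \subset F /\ spanning_tree (T i)) /\
    (forall i j, i != j -> [disjoint T i & T j]).

(* Z_k is represented by 'I_k, which, unlike 'Z_k, is correct for k = 1. *)
Definition compatible_wrt (k : nat) (f : vert G -> 'I_k) X Y : Prop :=
  (exists x : nat, x <= edges_in X /\
     (\sum_(v in X) (f v)%:Z - 2%:Z * x%:Z = \sum_(v in Y) (f v)%:Z
        %[mod k%:Z])%Z%R) \/
  (exists y : nat, y <= edges_in Y /\
     (\sum_(v in X) (f v)%:Z = \sum_(v in Y) (f v)%:Z - 2%:Z * y%:Z
        %[mod k%:Z])%Z%R).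

(* A part of the partition may be empty. *)
Definition compatible (k : nat) (f : vert G -> 'I_k) : Prop :=
  forall X Y, X :|: Y = [set: vert G] -> X :&: Y = set0 ->
    compatible_wrt f X Y.

End MGraph.

Arguments bipartite : clear implicits.
Arguments edge_connected : clear implicits.

(* Main.v *)
Require Import Defs.
From mathcomp Require Import all_boot all_order all_algebra zify.
Set Implicit Arguments.
Unset Strict Implicit.
Unset Printing Implicit Defensive.
Import Order.TTheory GRing.Theory Num.Theory.

(** Let [N = m + 2k - 2] and fix a root [r].  Every edge cut has at least [2N]
    edges, so uncrossing tight sets yields an orientation in which every
    indegree is at least [floor (d / 2)] and every nonempty vertex set avoiding
    [r] is entered by at least [N] arcs.  Lovasz's argument then extracts [m]
    edge-disjoint spanning branchings; every set avoiding [r] is still entered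
    by [2k - 2] of the remaining arcs [F], and the union [U] of the branchings
    has indegrees at most [m].

    In a bipartite graph an orientation of [F] encodes a factor [H] of [F]: an
    edge belongs to [H] when it leaves the side [A].  Hence it suffices to
    re-orient [F] so that [out - in] has prescribed residues modulo [2k] (their
    sum vanishes by compatibility with respect to the two sides) and stays in a
    window of radius [2k - 2] around the original values.  Splitting off arcs at
    vertices of large indegree, deleting arcs at the root and contracting
    deficient sets reduces this to a theorem on orientations with boundary [b]
    modulo [2k], in the style of Lovasz, Thomassen, Wu and Zhang: it is enough
    that [cut S >= 2k - 2 + dist (b S, 2k Z)] for all proper [S].  There one
    contracts tight sets, lifts pairs of edges at vertices with [b = 0], and
    orients and deletes an edge from a vertex of positive to one of negative
    residue; if all residues have the same sign, one of them is flipped first. *)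

(** * Residues modulo 2k *)

(** The modulus is 2k because [out - in] at a vertex is, up to sign, twice a factor degree minus a
    fixed degree. This fixes the parity of every quantity: inequalities move in steps of two, a
    strict bound 2k sharpens to 2k - 2, and halving gives the k - 1 of the theorem. The boundary
    theorem only bounds [out - in] in absolute value, whereas closeness to the given orientation is
    wanted. The absolute bound suffices at [v] as soon as [in - out] is nonpositive or below the
    distance of [b v] to the multiples of 2k. Splitting off at the other vertices, and deleting arcs
    at the root, serve to reach this situation. When a tight set is contracted and the outer problem
    solved, the edges leaving the set are already oriented; the additional vertex carries them into
    the inner problem, and tightness is exactly the degree bound required of that vertex. A vertex
    being split off loses its own cut condition and no other, whence the exempt sets. The branching
    edges stay in the factor whatever their direction; at most [m] of them enter a vertex, which is
    the [m] in the upper bound. *)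

Section Norm.
Variable k : nat.
Definition cong2k (x y : int) := exists q : int, (x = y + q * (k + k)%:Z)%R.

Definition dist2k (z : int) : nat :=
  let r := `|(z %% (k + k)%:Z)%Z|%N in minn r (k + k - r).

Lemma cong2k_refl x : cong2k x x. Proof. by exists 0%R; lia. Qed.
Lemma cong2k_sym x y : cong2k x y -> cong2k y x.
Proof. by case=> q ->; exists (- q)%R; lia. Qed.
Lemma cong2k_trans y x z : cong2k x y -> cong2k y z -> cong2k x z.
Proof. by move=> [q ->] [q' ->]; exists (q + q')%R; lia. Qed.
Lemma cong2kD x y x' y' : cong2k x y -> cong2k x' y' -> cong2k (x + x')%R (y + y')%R.
Proof. by move=> [q ->] [q' ->]; exists (q + q')%R; lia. Qed.
Lemma cong2kN x y : cong2k x y -> cong2k (- x)%R (- y)%R.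
Proof. by move=> [q ->]; exists (- q)%R; lia. Qed.
Lemma cong2k_eq x y : x = y -> cong2k x y. Proof. by move=> ->; exact: cong2k_refl. Qed.

Hypothesis k_gt0 : 0 < k.

Lemma dist2k_ex z : exists t : int, [/\ cong2k z t, `|t|%N = dist2k z & (`|t|%N <= k)].
Proof.
have h := divz_eq z (k + k)%:Z.
have h1 : (0 <= (z %% (k + k)%:Z)%Z)%R by apply: modz_ge0; lia.
have h2 : ((z %% (k + k)%:Z)%Z < (k + k)%:Z)%R by apply: ltz_pmod; lia.
rewrite /dist2k.
move: h h1 h2; set r := (z %% _)%Z; set q := (z %/ _)%Z => h h1 h2.
have [hr|hr] := leqP `|r|%N k.
  by exists r; split; [exists q | |]; lia.
by exists (r - (k + k)%:Z)%R; split; [exists (q + 1)%R | |]; lia.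
Qed.

Lemma dist2k_le z w : cong2k z w -> dist2k z <= `|w|%N.
Proof.
move=> [s hs].
have h := divz_eq z (k + k)%:Z.
have h1 : (0 <= (z %% (k + k)%:Z)%Z)%R by apply: modz_ge0; lia.
have h2 : ((z %% (k + k)%:Z)%Z < (k + k)%:Z)%R by apply: ltz_pmod; lia.
rewrite /dist2k.
move: h h1 h2; set r := (z %% _)%Z; set q := (z %/ _)%Z => h h1 h2.
have hw : (w = r + (q - s) * (k + k)%:Z)%R by lia.
have [h0|h0] : ((0 <= q - s) \/ (q - s <= -1))%R by lia.
  have : (0 <= (q - s) * (k + k)%:Z)%R by nia.
  lia.
have : ((q - s) * (k + k)%:Z <= - (k + k)%:Z)%R by nia.
lia.
Qed.

Lemma dist2k_cg z w : cong2k z w -> dist2k z = dist2k w.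
Proof.
move=> zw; apply/eqP; rewrite eqn_leq; apply/andP; split.
  by have [t [wt <- _]] := dist2k_ex w; apply: dist2k_le; apply: cong2k_trans zw wt.
by have [t [wt <- _]] := dist2k_ex z; apply: dist2k_le; apply: cong2k_trans (cong2k_sym zw) wt.
Qed.

Lemma dist2kN (z : int) : dist2k (- z)%R = dist2k z.
Proof.
have le y : dist2k (- y)%R <= dist2k y.
  have [t [yt <- _]] := dist2k_ex y.
  have -> : `|t|%N = `|(- t)%R|%N by lia.
  by apply/dist2k_le/cong2kN.
by apply/eqP; rewrite eqn_leq le -{1}[z]opprK le.
Qed.

Lemma dist2kD (z w : int) : dist2k (z + w)%R <= dist2k z + `|w|%N.
Proof.
have [t [zt <- _]] := dist2k_ex z.
have h : dist2k (z + w)%R <= `|(t + w)%R|%N by apply/dist2k_le/cong2kD => //; exact: cong2k_refl.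
lia.
Qed.

Lemma dist2k_lek z : dist2k z <= k.
Proof. by have [t [_ <-]] := dist2k_ex z. Qed.

Lemma dist2k_add (z w : int) : dist2k (z + w)%R <= dist2k z + dist2k w.
Proof.
have [t [wt <- _]] := dist2k_ex w.
rewrite (@dist2k_cg (z + w)%R (z + t)%R) ?dist2kD //.
by apply: cong2kD => //; exact: cong2k_refl.
Qed.

(** As 2k is even, a residue modulo 2k has a parity, and its distance to 0 has the same one. This is
    what allows cut inequalities to be sharpened from one to two. *)
Lemma dist2k_par z : exists q : int, (z + (dist2k z)%:Z = 2 * q)%R.
Proof.
have [t [[q ->] <- _]] := dist2k_ex z.
have [h|h] := leP 0%R t; first by exists (t + q * k%:Z)%R; lia.
by exists (q * k%:Z)%R; lia.
Qed.

Lemma dist2k_lt t : `|t|%N <= k + k -> dist2k t + `|t|%N <= k + k.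
Proof.
move=> ht; have [h|h] := leP 0%R t.
  have : dist2k t <= `|(t - (k + k)%:Z)%R|%N by apply: dist2k_le; exists 1%R; lia.
  lia.
have : dist2k t <= `|(t + (k + k)%:Z)%R|%N by apply: dist2k_le; exists (-1)%R; lia.
lia.
Qed.

Lemma dist2k0P z : dist2k z = 0 -> cong2k z 0%R.
Proof. by move=> h; have [t [zt ht _]] := dist2k_ex z; have -> : 0%R = t by lia. Qed.

Lemma dist2k_small z : `|z|%N <= k -> dist2k z = `|z|%N.
Proof.
move=> hz; apply/eqP; rewrite eqn_leq dist2k_le /=; last exact: cong2k_refl.
have [t [[q hq] <- ht]] := dist2k_ex z.
have [h|[h|h]] : ((q = 0) \/ (1 <= q) \/ (q <= -1))%R by lia.
- by move: hq; rewrite h; lia.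
- have : ((k + k)%:Z <= q * (k + k)%:Z)%R by nia.
  lia.
have : (q * (k + k)%:Z <= - (k + k)%:Z)%R by nia.
lia.
Qed.

End Norm.

(** * Orientations with boundary modulo 2k *)

Section Weights.
Variable I : finType.
Implicit Types (V A B X : {set I}) (m p : I -> I -> nat) (o i : I -> nat).
Implicit Types (b : I -> int) (x y u v w : I).

Definition arcs o A : nat := \sum_(u in A) o u.
Definition bsum b A : int := (\sum_(u in A) b u)%R.
Definition cutm V m A : nat := \sum_(u in A) \sum_(w in V :\: A) m u w.
(** The sum runs over ordered pairs: an edge of a symmetric [m] is counted twice, an arc of an
    orientation once. Only its decrease matters, as an induction measure. *)
Definition mass V m : nat := \sum_(u in V) \sum_(w in V) m u w.
Definition cut V m o i A : nat := arcs o A + arcs i A + cutm V m A.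
Definition net V p v : int := (\sum_(w in V) ((p v w)%:Z - (p w v)%:Z))%R.
(** The multiplicity function of a single undirected edge. Deletions are stated additively, as
    [m = m' + eps x y], to keep truncated subtraction out of the cut computations. *)
Definition eps x y u w : nat := ((u == x) && (w == y)) + ((u == y) && (w == x)).
Definition addp p x y u w : nat := p u w + ((u == x) && (w == y)).

Lemma sum_ind A x : \sum_(u in A) (u == x : nat) = (x \in A).
Proof.
case: (boolP (x \in A)) => xA.
  rewrite (bigD1 x) //= eqxx big1 // => u /andP[_ /negPf ->] //.
by rewrite big1 // => u uA; case: eqP => // ux; rewrite -ux uA in xA.
Qed.

Lemma sum_ind2 A B x y :
  \sum_(u in A) \sum_(w in B) ((u == x) && (w == y) : nat) = (x \in A) && (y \in B).
Proof.
have -> : \sum_(u in A) \sum_(w in B) ((u == x) && (w == y) : nat) =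
          \sum_(u in A) (u == x : nat) * (y \in B).
  apply: eq_bigr => u _; rewrite -sum_ind big_distrr /=.
  by apply: eq_bigr => w _; rewrite mulnb.
by rewrite -big_distrl /= sum_ind mulnb.
Qed.

Lemma arcsD o o' x c A : (forall u, o u = o' u + (u == x) * c) ->
  arcs o A = arcs o' A + (x \in A) * c.
Proof.
move=> h; rewrite /arcs -sum_ind big_distrl -big_split /=.
by apply: eq_bigr => u _; rewrite h.
Qed.

Lemma bsumD b b' x (c : int) A : (forall u, b u = (b' u + (u == x)%:Z * c)%R) ->
  (bsum b A = bsum b' A + (x \in A)%:Z * c)%R.
Proof.
move=> h; rewrite /bsum -sum_ind (eq_bigr (fun u => (b' u + (u == x)%:Z * c)%R)) //.
rewrite big_split /= -big_distrl /=; congr (_ + _ * _)%R.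
by elim/big_rec2: _ => // u y1 y2 _ ->; rewrite PoszD.
Qed.

Lemma cutmD V m m1 m2 A : (forall u w, m u w = m1 u w + m2 u w) ->
  cutm V m A = cutm V m1 A + cutm V m2 A.
Proof.
move=> h; rewrite /cutm -big_split /=; apply: eq_bigr => u _.
by rewrite -big_split /=; apply: eq_bigr => w _.
Qed.

Lemma cutm_eps V x y A : x \in V -> y \in V -> A \subset V ->
  cutm V (eps x y) A = ((x \in A) != (y \in A)).
Proof.
move=> xV yV AV; rewrite /cutm /eps.
under eq_bigr do rewrite big_split /=.
rewrite big_split /= !sum_ind2 !inE xV yV.
by case: (x \in A); case: (y \in A).
Qed.

Lemma massD V m m1 m2 : (forall u w, m u w = m1 u w + m2 u w) ->
  mass V m = mass V m1 + mass V m2.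
Proof.
move=> h; rewrite /mass -big_split /=; apply: eq_bigr => u _.
by rewrite -big_split /=; apply: eq_bigr => w _.
Qed.

Lemma mass_eps V x y : x \in V -> y \in V -> mass V (eps x y) = 2.
Proof.
move=> xV yV; rewrite /mass /eps.
under eq_bigr do rewrite big_split /=.
by rewrite big_split /= !sum_ind2 xV yV.
Qed.

Lemma epsC x y u w : eps x y u w = eps x y w u.
Proof. by rewrite /eps addnC [(u == y) && _]andbC [(u == x) && _]andbC. Qed.

Lemma eps_le m x y : x != y -> (forall u w, m u w = m w u) -> 0 < m x y ->
  forall u w, m u w = (m u w - eps x y u w) + eps x y u w.
Proof.
move=> xy sm mxy u w; rewrite subnK // /eps.
case: (eqVneq u x) => [->|ux]; case: (eqVneq w y) => [->|wy] //=;
  rewrite ?(negPf xy) ?[y == x]eq_sym ?(negPf xy) ?andbF ?addn0 //.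
by case: eqP => //= ->; case: eqP => //= ->; rewrite sm.
Qed.

Lemma addpE p x y u w : x != y -> u != w ->
  addp p x y u w + addp p x y w u = p u w + p w u + eps x y u w.
Proof. by move=> xy uw; rewrite /addp /eps [(w == x) && _]andbC; lia. Qed.

Lemma net_addp V p x y v : x \in V -> y \in V ->
  (net V (addp p x y) v = net V p v + (v == x)%:Z - (v == y)%:Z)%R.
Proof.
move=> xV yV; rewrite /net /addp.
rewrite (eq_bigr (fun w => ((p v w)%:Z - (p w v)%:Z) +
  (((v == x) && (w == y))%:Z - ((w == x) && (v == y))%:Z))%R); last by move=> w _; lia.
rewrite big_split /= -addrA; congr (_ + _)%R.
rewrite sumrB; congr (_ - _)%R.
  have -> : ((v == x)%:Z = (\sum_(w in V) ((v == x) && (w == y) : nat))%N%:Z)%R.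
    by congr Posz; case: (v == x); rewrite /= ?sum_ind ?yV // big1.
  by elim/big_rec2: _ => // u y1 y2 _ ->; rewrite PoszD.
have -> : ((v == y)%:Z = (\sum_(w in V) ((w == x) && (v == y) : nat))%N%:Z)%R.
  congr Posz; case: (v == y); rewrite /=; last by rewrite big1 // => w _; rewrite andbF.
  by under eq_bigr do rewrite andbT; rewrite sum_ind xV.
by elim/big_rec2: _ => // u y1 y2 _ ->; rewrite PoszD.
Qed.

Lemma subp p x y : 0 < p x y -> exists p0, forall u w, p u w = addp p0 x y u w.
Proof.
move=> h; exists (fun u w => p u w - ((u == x) && (w == y))) => u w.
rewrite /addp subnK //; case: eqP => [->|] //=; case: eqP => [->|] //=.
Qed.

Lemma net_ext V p p' v : (forall u w, p u w = p' u w) -> net V p v = net V p' v.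
Proof. by move=> h; rewrite /net; apply: eq_bigr => w _; rewrite !h. Qed.

End Weights.

Section Signs.
Variable k : nat.
Hypothesis k_gt0 : 0 < k.

(** The representative k is allowed, so a residue k is positive and its opposite is positive as
    well: such a vertex can play either sign. *)
Definition pos_residue (z : int) := exists2 t : int, cong2k k z t & (0 < t <= k%:Z)%R.

Lemma pos_dist2k z : pos_residue z -> dist2k k (z - 1)%R + 1 = dist2k k z.
Proof.
move=> [t zt ht].
rewrite (dist2k_cg k_gt0 zt) (@dist2k_cg k k_gt0 (z - 1)%R (t - 1)%R).
  by rewrite !dist2k_small; lia.
by apply: cong2kD => //; exact: cong2k_refl.
Qed.

(** The value [t + 1] could only leave the range by reaching 2k, which would force [z] to be 0
    modulo 2k. *)
Lemma pos_bound z t : pos_residue z -> cong2k k t (z - 1)%R -> `|t| < k + k -> `|(t + 1)%R| < k + k.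
Proof.
move=> [s [q hq] hs] [q' hq'] ht.
case: (leqP `|(t + 1)%R| (k + k - 1)) => h; first by lia.
have tE : (t = (k + k)%:Z - 1)%R by lia.
have : (s = (1 - q - q') * (k + k)%:Z)%R by lia.
have [?|?] : ((1 - q - q' <= 0) \/ (1 <= 1 - q - q'))%R by lia.
  have : ((1 - q - q') * (k + k)%:Z <= 0)%R by nia.
  lia.
have : ((k + k)%:Z <= (1 - q - q') * (k + k)%:Z)%R by nia.
lia.
Qed.

End Signs.

(** An orientation [p] of the multigraph [m]. The diagonal is left free because it cancels in [net]
    and never crosses a cut. *)
Definition pairs (I : finType) (V : {set I}) (p m : I -> I -> nat) :=
  forall u w, u \in V -> w \in V -> u != w -> p u w + p w u = m u w.

(** The arc on the lifted edge [uw] is replaced by the path through [v] in the same direction, which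
    is balanced at [v]. The two directions are interchanged by reversing the names of [u] and
    [w]. *)
Lemma lift_pairs (I : finType) (V : {set I}) (p m m0 : I -> I -> nat) (u v w : I) :
  u \in V -> v \in V -> w \in V -> u != v -> v != w -> u != w ->
  (forall a c, m a c = m0 a c + eps u v a c + eps v w a c) ->
  pairs V p (fun a c => m0 a c + eps u w a c) ->
  exists p', pairs V p' m /\ forall a, net V p' a = net V p a.
Proof.
move=> uV vV wV uv vw uw hm h1.
have e1 : p u w + p w u = m0 u w + 1.
  rewrite h1 // /eps !eqxx /= [w == u]eq_sym (negPf uw) andbF //.
wlog huw : u w uV wV uv vw uw hm h1 e1 / 0 < p u w.
  move=> W; have [h|h] : 0 < p u w \/ 0 < p w u by lia.
    exact: (W u w).
  have ep (a c a' c' : I) : eps a c a' c' = eps c a a' c' by rewrite /eps addnC.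
  have swu : m0 u w = m0 w u.
    have := h1 w u wV uV; rewrite eq_sym uw => /(_ isT).
    by rewrite addnC e1 /eps !eqxx /= [w == u]eq_sym (negPf uw) /=; lia.
  apply: (W w u) => //; rewrite 1?eq_sym //.
  - by move=> a c; rewrite hm (ep u v) (ep v w) addnAC.
  - by move=> a c aV cV ac; rewrite h1 // (ep w u).
  by rewrite addnC e1 swu.
have [p0 hp0] := subp huw.
exists (addp (addp p0 u v) v w); split.
  move=> a c aV cV ac; rewrite addpE // addpE // hm.
  have := h1 a c aV cV ac; rewrite !hp0 addpE //; lia.
by move=> a; rewrite !net_addp // (net_ext _ _ hp0) net_addp //; lia.
Qed.

Lemma double_pairs (I : finType) (V : {set I}) (p m m' : I -> I -> nat) (u v : I) :
  u \in V -> v \in V -> u != v ->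
  (forall a c, m a c = m' a c + eps u v a c + eps u v a c) -> pairs V p m' ->
  exists p', pairs V p' m /\ forall a, net V p' a = net V p a.
Proof.
move=> uV vV uv hm h1; exists (addp (addp p u v) v u); split.
  move=> a c aV cV ac; rewrite !addpE ?h1 ?hm //; last by rewrite eq_sym.
  by rewrite [eps v u a c]addnC.
by move=> a; rewrite !net_addp //; lia.
Qed.

(** * Boundary instances: reversal, tight cuts and transport of solutions *)

Section Instances.
Variables (I : finType) (k : nat).
Hypothesis k_gt0 : 0 < k.
Implicit Types (V A B X ex : {set I}) (m p : I -> I -> nat) (o i : I -> nat).
Implicit Types (b : I -> int) (x y u v w : I).

(* [m u w] is the multiplicity of the edge [uw].  The arcs counted by [o] and
   [i] are already oriented: they come from, respectively go to, an additional
   vertex outside [V].  [ex] is empty or a single vertex of residue 0 that is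
   exempt from the cut condition. *)
Record boundary_inst V m o i b ex : Prop := Inst {
  inst_sym : forall u w, m u w = m w u;
  inst_par : forall A, A \subset V ->
    exists q : int, ((cut V m o i A)%:Z + bsum b A = 2 * q)%R;
  inst_tot : cong2k k (bsum b V + (arcs o V)%:Z)%R (arcs i V)%:Z;
  inst_ii : arcs o V + arcs i V + 2 <= k + k + dist2k k (bsum b V);
  inst_iii : forall A, A \subset V -> A != set0 -> A != V -> A != ex ->
    k + k + dist2k k (bsum b A) <= cut V m o i A + 2;
  inst_ex : forall x, x \in ex -> [/\ ex = [set x], x \in V & dist2k k (b x) = 0]
}.

(** This is [out - in] with the pre-oriented arcs included: those counted by [i] leave [v], those
    counted by [o] enter it. *)
Definition excess_at V p o i v : int := (net V p v + (i v)%:Z - (o v)%:Z)%R.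

Definition boundary_sol V m o i b := exists p,
  pairs V p m /\
  (forall v, v \in V -> cong2k k (excess_at V p o i v) (b v) /\ `|excess_at V p o i v|%N < k + k).

(** The cut condition with slack two, for non-singletons only. One reduction step lowers a cut and
    raises a distance by at most two in total, so this slack pays for it; singletons are handled by
    an exact count in each step. *)
Definition loose_cuts V m o i b := forall A, A \subset V -> 1 < #|A| -> A != V ->
  k + k + dist2k k (bsum b A) <= cut V m o i A.

Definition solves_fewer_vertices V := forall V' m o i b ex, #|V'| < #|V| -> V' != set0 ->
  boundary_inst V' m o i b ex -> boundary_sol V' m o i b.
Definition solves_fewer_edges V m0 := forall m o i b ex, mass V m < mass V m0 ->
  boundary_inst V m o i b ex -> boundary_sol V m o i b.
Definition solves_fewer_arcs V m a := forall o i b ex, arcs o V + arcs i V < a ->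
  boundary_inst V m o i b ex -> boundary_sol V m o i b.

Lemma set_cases A : A != set0 -> (exists z, A = [set z]) \/ 1 < #|A|.
Proof.
rewrite -card_gt0 => h; have [|h1] := leqP #|A| 1; last by right.
by move=> h2; left; apply/cards1P; rewrite eqn_leq h2.
Qed.

Lemma bsum1 b x : bsum b [set x] = b x.
Proof. by rewrite /bsum big_set1. Qed.

Lemma arcs1 o x : arcs o [set x] = o x.
Proof. by rewrite /arcs big_set1. Qed.

Lemma bsumC b V A : A \subset V -> (bsum b V = bsum b A + bsum b (V :\: A))%R.
Proof. by move=> AV; rewrite /bsum (big_setID A) (setIidPr AV). Qed.

Lemma arcsC o V A : A \subset V -> arcs o V = arcs o A + arcs o (V :\: A).
Proof. by move=> AV; rewrite /arcs (big_setID A) (setIidPr AV). Qed.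

Lemma inst_weaken V m o i b x : boundary_inst V m o i b set0 -> x \in V -> dist2k k (b x) = 0 ->
  boundary_inst V m o i b [set x].
Proof.
case=> h1 h2 h3 h4 h5 h6 xV bx; split => //.
  by move=> A AV A0 AV' _; apply: h5.
by move=> y; rewrite inE => /eqP ->.
Qed.

Lemma bsum_opp b A : bsum (fun u => - b u)%R A = (- bsum b A)%R.
Proof. by rewrite /bsum sumrN. Qed.

Lemma cut_swap V m o i A : cut V m i o A = cut V m o i A.
Proof. by rewrite /cut (addnC (arcs i A)). Qed.

(** Reversing all arcs negates the boundary and exchanges [o] and [i]; it halves the case analyses
    on signs. *)
Lemma inst_opp V m o i b ex : boundary_inst V m o i b ex ->
  boundary_inst V m i o (fun u => - b u)%R ex.
Proof.
case=> h1 h2 h3 h4 h5 h6; split => //.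
- move=> A AV; rewrite bsum_opp cut_swap; have [q hq] := h2 A AV.
  by exists ((cut V m o i A)%:Z - q)%R; lia.
- by rewrite bsum_opp; case: h3 => q hq; exists (- q)%R; lia.
- by rewrite bsum_opp dist2kN; lia.
- by move=> A; rewrite bsum_opp cut_swap dist2kN //; apply: h5.
by move=> x /h6; rewrite dist2kN.
Qed.

Lemma sol_opp V m o i b : boundary_sol V m i o (fun u => - b u)%R -> boundary_sol V m o i b.
Proof.
case=> p [h1 h2]; exists (fun u w => p w u); split.
  by move=> u w uV wV uw; rewrite addnC; apply: h1.
move=> v vV; have [h3 h4] := h2 v vV.
have -> : (excess_at V (fun u w => p w u) o i v = - excess_at V p i o v)%R.
  rewrite /excess_at /net; set s1 := (\sum_(w in V) _)%R; set s2 := (\sum_(w in V) _)%R.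
  have -> : (s1 = - s2)%R by rewrite /s1 /s2 -sumrN; apply: eq_bigr => w _; lia.
  lia.
by split; [rewrite -[b v]opprK; exact: cong2kN | lia].
Qed.

Lemma loose_cuts_opp V m o i b : loose_cuts V m o i b ->
  loose_cuts V m i o (fun u => - b u)%R.
Proof. by move=> h A AV A1 A2; rewrite bsum_opp cut_swap dist2kN //; apply: h. Qed.

(** By parity a cut exceeds its lower bound by 0 or by at least 2, so a set that is not loose
    attains the bound. *)
Lemma tightP V m o i b ex : boundary_inst V m o i b ex ->
  loose_cuts V m o i b \/
  exists A, [/\ A \subset V, 1 < #|A|, A != V & cut V m o i A + 2 <= k + k + dist2k k (bsum b A)].
Proof.
move=> H.
pose T := [exists A : {set I}, [&& A \subset V, 1 < #|A|, A != V &
             cut V m o i A + 2 <= k + k + dist2k k (bsum b A)]].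
case: (boolP T) => [/existsP[A /and4P[h1 h2 h3 h4]]|]; first by right; exists A.
rewrite negb_exists => /forallP h; left => A AV A1 A2.
have := h A; rewrite AV A1 A2 /= -ltnNge => h3.
have [q hq] := inst_par H AV; have [q' hq'] := dist2k_par k_gt0 (bsum b A).
lia.
Qed.

(** The orientation [p] is kept; only the pre-oriented arcs and the prescribed boundary change, and
    the excess shifts accordingly. *)
Lemma sol_arc V m o i b o' i' b' : boundary_sol V m o' i' b' ->
  (forall v, v \in V -> cong2k k (b' v - (i' v)%:Z + (o' v)%:Z) (b v - (i v)%:Z + (o v)%:Z))%R ->
  (forall v t, v \in V -> cong2k k t (b' v) -> `|t| < k + k ->
     `|(t - (i' v)%:Z + (o' v)%:Z + (i v)%:Z - (o v)%:Z)%R| < k + k) ->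
  boundary_sol V m o i b.
Proof.
move=> [p [h1 h2]] hb ht; exists p; split => // v vV.
have [h3 h4] := h2 v vV.
have e : (excess_at V p o i v = excess_at V p o' i' v - (i' v)%:Z + (o' v)%:Z + (i v)%:Z - (o v)%:Z)%R.
  by rewrite /excess_at; lia.
split; last by rewrite e; apply: ht.
have := hb v vV; case=> q hq; case: h3 => q' hq'.
by exists (q' + q)%R; rewrite e hq'; lia.
Qed.

Lemma sol_del V m m' o i b b' x y : x \in V -> y \in V -> x != y ->
  (forall u w, m u w = m' u w + eps x y u w) ->
  (forall u, b' u = b u - (u == x)%:Z + (u == y)%:Z)%R ->
  (forall t, cong2k k t (b x - 1)%R -> `|t| < k + k -> `|(t + 1)%R| < k + k) ->
  (forall t, cong2k k t (b y + 1)%R -> `|t| < k + k -> `|(t - 1)%R| < k + k) ->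
  boundary_sol V m' o i b' -> boundary_sol V m o i b.
Proof.
move=> xV yV xy hm hb tx ty [p [h1 h2]]; exists (addp p x y); split.
  by move=> u w uV wV uw; rewrite addpE // h1 // hm.
move=> v vV; have [h3 h4] := h2 v vV.
have e : (excess_at V (addp p x y) o i v = excess_at V p o i v + (v == x)%:Z - (v == y)%:Z)%R.
  by rewrite /excess_at net_addp //; lia.
rewrite e; move: h3 h4; rewrite hb.
case: (eqVneq v x) => [->|vx].
  rewrite (negPf xy) /= => h3 h4; split.
    by case: h3 => q hq; exists q; lia.
  have -> : (excess_at V p o i x + 1 - 0 = excess_at V p o i x + 1)%R by lia.
  by apply: tx => //; case: h3 => q hq; exists q; lia.
case: (eqVneq v y) => [->|vy] /= h3 h4.
  split; first by case: h3 => q hq; exists q; lia.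
  have -> : (excess_at V p o i y + 0 - 1 = excess_at V p o i y - 1)%R by lia.
  by apply: ty => //; case: h3 => q hq; exists q; lia.
by split; [case: h3 => q hq; exists q; lia | lia].
Qed.

Lemma sol_lift V m m0 o i b u v w : u \in V -> v \in V -> w \in V ->
  u != v -> v != w -> u != w ->
  (forall a c, m a c = m0 a c + eps u v a c + eps v w a c) ->
  boundary_sol V (fun a c => m0 a c + eps u w a c) o i b -> boundary_sol V m o i b.
Proof.
move=> uV vV wV uv vw uw hm [p [h1 h2]].
have [p' [h3 h4]] := lift_pairs uV vV wV uv vw uw hm h1.
by exists p'; split => // a aV; rewrite /excess_at h4; exact: h2.
Qed.

Lemma sol_liftz V m m' o o0 i b u v : u \in V -> v \in V -> u != v ->
  (forall a c, m a c = m' a c + eps v u a c) ->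
  (forall a, o a = o0 a + (a == v)) ->
  boundary_sol V m' (fun a => o0 a + (a == u)) i b -> boundary_sol V m o i b.
Proof.
move=> uV vV uv hm ho [p [h1 h2]]; exists (addp p v u); split.
  by move=> a c aV cV ac; rewrite addpE ?h1 ?hm // eq_sym.
move=> a aV; have [h3 h4] := h2 a aV.
have <- : excess_at V p (fun a => o0 a + (a == u)) i a = excess_at V (addp p v u) o i a.
  by rewrite /excess_at net_addp // ho; lia.
by [].
Qed.

Lemma sol_pair V m m' o i b u v : u \in V -> v \in V -> u != v ->
  (forall a c, m a c = m' a c + eps u v a c + eps u v a c) ->
  boundary_sol V m' o i b -> boundary_sol V m o i b.
Proof.
move=> uV vV uv hm [p [h1 h2]].
have [p' [h3 h4]] := double_pairs uV vV uv hm h1.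
by exists p'; split => // a aV; rewrite /excess_at h4; exact: h2.
Qed.

End Instances.

(** * Contraction of a vertex set and recomposition of orientations *)

Section Contraction.
Variable I : finType.
Implicit Types (V A B X : {set I}) (m p : I -> I -> nat) (o i : I -> nat).
Implicit Types (b : I -> int) (x y u v w a : I) (h : I -> I).

Lemma sumZ (P : pred I) (F : I -> nat) :
  ((\sum_(x | P x) F x)%N%:Z = \sum_(x | P x) (F x)%:Z)%R.
Proof. exact: (big_morph Posz PoszD erefl). Qed.

Lemma distribute A (c : I -> nat) n : n <= \sum_(u in A) c u ->
  exists2 q : I -> nat, (forall u, q u <= c u) & \sum_(u in A) q u = n.
Proof.
elim: n => [|n IHn] h; first by exists (fun=> 0) => //; rewrite big1.
have [|q qc qn] := IHn _; first exact: ltnW.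
have [u uA qu] : exists2 u, u \in A & q u < c u.
  case: (boolP [exists u in A, q u < c u]) => [/exists_inP[u]|]; first by exists u.
  rewrite negb_exists_in => /forall_inP hq; move: h; rewrite ltnNge -qn leq_sum //.
  by move=> u /hq; rewrite -leqNgt.
exists (fun w => q w + (w == u)); last by rewrite big_split /= sum_ind uA qn addn1.
by move=> w; case: (eqVneq w u) => [->|_]; rewrite ?addn0 // addn1.
Qed.

(** A contraction is a map [h] of the vertex type to itself, each class being named by one of its
    members. Sets of the contracted graph are handled through preimages, and cuts, arcs and
    boundaries are preserved under [expand]. *)
Definition expand h V X : {set I} := [set x in V | h x \in X].
Definition cmat h V m u w : nat :=
  \sum_(x in expand h V [set u]) \sum_(y in expand h V [set w]) m x y.
Definition carc h V o u : nat := arcs o (expand h V [set u]).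
Definition cb h V b u : int := bsum b (expand h V [set u]).

Lemma big_expand (R : Type) (idx : R) (op : Monoid.com_law idx) h V X (F : I -> R) :
  \big[op/idx]_(u in X) \big[op/idx]_(x in expand h V [set u]) F x =
  \big[op/idx]_(x in expand h V X) F x.
Proof.
rewrite (partition_big (P := mem (expand h V X)) h (mem X)) /=.
  apply: eq_bigr => u uX; apply: eq_bigl => x; rewrite !inE.
  by case: eqP => [->|]; rewrite ?uX ?andbF ?andbT.
by move=> x; rewrite inE => /andP[].
Qed.

Lemma expand_sub h V X : expand h V X \subset V.
Proof. by apply/subsetP => x; rewrite inE => /andP[]. Qed.

Lemma expand_img h V : expand h V (h @: V) = V.
Proof. by apply/setP => x; rewrite inE; case: (boolP (x \in V)) => //= xV; rewrite imset_f. Qed.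

Lemma expandD h V X : expand h V (h @: V :\: X) = V :\: expand h V X.
Proof.
by apply/setP => x; rewrite !inE; case: (boolP (x \in V)) => xV; rewrite ?andbF //= imset_f // andbT.
Qed.

Lemma expand_inj h V X (Y : {set I}) : X \subset h @: V -> Y \subset h @: V ->
  expand h V X = expand h V Y -> X = Y.
Proof.
move=> XV YV e; apply/setP => u; apply/idP/idP => uX.
  have /imsetP[x xV ux] := subsetP XV u uX.
  have : x \in expand h V X by rewrite inE xV -ux.
  by rewrite e inE -ux => /andP[].
have /imsetP[x xV ux] := subsetP YV u uX.
have : x \in expand h V Y by rewrite inE xV -ux.
by rewrite -e inE -ux => /andP[].
Qed.

Lemma arcs_carc h V o X : arcs (carc h V o) X = arcs o (expand h V X).
Proof. by rewrite /arcs /carc big_expand. Qed.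

Lemma bsum_cb h V b X : bsum (cb h V b) X = bsum b (expand h V X).
Proof. by rewrite /bsum /cb big_expand. Qed.

Lemma cutm_cmat h V m X : cutm (h @: V) (cmat h V m) X = cutm V m (expand h V X).
Proof.
rewrite /cutm /cmat -expandD.
rewrite -[RHS]big_expand /=; apply: eq_bigr => u uX.
rewrite exchange_big /=; apply: eq_bigr => x _.
by rewrite big_expand.
Qed.

Lemma cut_cmat h V m o i X :
  cut (h @: V) (cmat h V m) (carc h V o) (carc h V i) X = cut V m o i (expand h V X).
Proof. by rewrite /cut !arcs_carc cutm_cmat. Qed.

Lemma cmat_sym h V m : (forall u w, m u w = m w u) ->
  forall u w, cmat h V m u w = cmat h V m w u.
Proof.
move=> sm u w; rewrite /cmat exchange_big /=.
by apply: eq_bigr => x _; apply: eq_bigr => y _.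
Qed.

(** Every cut of the contracted graph is a cut of the original one. An exempt vertex stays exempt
    when it forms a class of its own; otherwise the contracted instance has none. *)
Lemma inst_contract k (k_gt0 : 0 < k) h V m o i b ex : boundary_inst k V m o i b ex ->
  boundary_inst k (h @: V) (cmat h V m) (carc h V o) (carc h V i) (cb h V b)
       [set u in h @: V | expand h V [set u] == ex].
Proof.
case=> h1 h2 h3 h4 h5 h6; split.
- exact: cmat_sym.
- move=> X XV; rewrite cut_cmat bsum_cb; apply: h2; exact: expand_sub.
- by rewrite bsum_cb !arcs_carc expand_img.
- by rewrite bsum_cb !arcs_carc expand_img.
- move=> X XV X0 XV' Xex; rewrite cut_cmat bsum_cb; apply: h5.
  + exact: expand_sub.
  + apply: contraNneq X0 => e; apply/eqP; apply: (@expand_inj h V) => //; first exact: sub0set.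
    by rewrite e; apply/setP => x; rewrite !inE andbF.
  + apply: contraNneq XV' => e; apply/eqP; apply: (@expand_inj h V) => //.
    by rewrite e expand_img.
  apply: contraNneq Xex => e; apply/eqP/setP => u; rewrite inE.
  apply/idP/andP => [uX|[uV /eqP eu]].
    have uV := subsetP XV u uX; split => //.
    have /imsetP[x xV ux] := uV.
    have xex : x \in ex by rewrite -e inE xV -ux uX.
    have [exE _ _] := h6 x xex.
    rewrite eqEsubset; apply/andP; split.
      by apply/subsetP => y; rewrite !inE -e inE => /andP[-> /eqP ->].
    by rewrite exE sub1set !inE xV -ux eqxx.
  have /imsetP[x xV ux] := uV.
  have : x \in expand h V [set u] by rewrite !inE xV ux eqxx.
  by rewrite eu -e inE -ux => /andP[].
move=> u; rewrite inE => /andP[uV /eqP eu].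
have /imsetP[x xV ux] := uV.
have xe : x \in ex by rewrite -eu !inE xV ux eqxx.
have [exE _ bx] := h6 x xe.
split => //; last by rewrite /cb eu exE bsum1.
apply/setP => w; rewrite !inE; apply/andP/eqP => [[wV /eqP ew]|->]; last by rewrite eu.
have : x \in expand h V [set w] by rewrite ew.
by rewrite !inE xV -ux => /eqP ->.
Qed.

Section Glue.
Variables (V A : {set I}) (a : I) (m : I -> I -> nat).
Hypotheses (AV : A \subset V) (aA : a \in A) (sm : forall u w, m u w = m w u).

Definition crep x := if x \in A then a else x.

Lemma crep_img : crep @: V = a |: (V :\: A).
Proof.
apply/setP => x; rewrite !inE; apply/imsetP/orP => [[y yV ->]|].
  by rewrite /crep; case: (boolP (y \in A)) => yA; [left | right; rewrite yA].
case=> [/eqP ->|/andP[xA xV]]; first by exists a; rewrite ?(subsetP AV) // /crep aA.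
by exists x => //; rewrite /crep (negPf xA).
Qed.

Lemma expand_a : expand crep V [set a] = A.
Proof.
apply/setP => x; rewrite !inE /crep; case: (boolP (x \in A)) => xA.
  by rewrite eqxx (subsetP AV).
by case: eqP => [xa|]; rewrite ?andbF // -?xa in xA *; rewrite xa aA in xA.
Qed.

Lemma expand_out w : w \in V :\: A -> expand crep V [set w] = [set w].
Proof.
rewrite inE => /andP[wA wV]; apply/setP => x; rewrite !inE /crep.
case: (boolP (x \in A)) => xA.
  case: eqP => [aw|_]; first by rewrite -aw aA in wA.
  by rewrite andbF; apply/esym/eqP => xw; rewrite -xw xA in wA.
by case: eqP => [->|]; rewrite ?wV ?andbF.
Qed.

Lemma cmat_a w : w \in V :\: A -> cmat crep V m a w = \sum_(u in A) m u w.
Proof.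
move=> wV; rewrite /cmat expand_a expand_out //.
by apply: eq_bigr => u _; rewrite big_set1.
Qed.

Lemma cmat_out u w : u \in V :\: A -> w \in V :\: A -> cmat crep V m u w = m u w.
Proof. by move=> uV wV; rewrite /cmat !expand_out // !big_set1. Qed.

Lemma card_crep : 1 < #|A| -> #|crep @: V| < #|V|.
Proof.
move=> A1; rewrite crep_img cardsU1 !inE aA /= -(cardsID A V) (setIidPr AV).
by rewrite add1n; lia.
Qed.

Lemma crep_out v : v \in V :\: A -> v != a.
Proof. by rewrite inE => /andP[vA _]; apply: contraNneq vA => ->. Qed.

Lemma net_crep p v : (net (crep @: V) p v =
  ((p v a)%:Z - (p a v)%:Z) + net (V :\: A) p v)%R.
Proof.
rewrite /net crep_img big_setU1 //= !inE aA //.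
Qed.

(* The arcs of [p1] at the contracted vertex are distributed over [A]. *)
Lemma split_contraction p1 :
  (forall u w, u \in crep @: V -> w \in crep @: V -> u != w ->
     p1 u w + p1 w u = cmat crep V m u w) ->
  exists o2 i2 : I -> nat,
  [/\ forall v, o2 v + i2 v = \sum_(w in V :\: A) m v w,
      ((arcs i2 A)%:Z - (arcs o2 A)%:Z = net (crep @: V) p1 a)%R &
      forall p2, (forall u w, u \in A -> w \in A -> u != w -> p2 u w + p2 w u = m u w) ->
      exists p, [/\ forall u w, u \in V -> w \in V -> u != w -> p u w + p w u = m u w,
        forall v, v \in A -> (net V p v = net A p2 v + (i2 v)%:Z - (o2 v)%:Z)%R &
        forall v, v \in V :\: A -> net V p v = net (crep @: V) p1 v]].
Proof.
move=> hp1.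
have memo w : w \in V :\: A -> w \in crep @: V by move=> wV; rewrite crep_img !inE; move: wV; rewrite inE => ->; rewrite orbT.
have mema : a \in crep @: V by rewrite crep_img !inE eqxx.
have p1a w : w \in V :\: A -> p1 a w + p1 w a = \sum_(u in A) m u w.
  by move=> wV; rewrite -cmat_a //; apply: hp1 => //; [exact: memo | rewrite eq_sym crep_out].
(* [g w u] counts the edges [uw] that are directed from [u] in [A] to the outer vertex [w]; over [u]
   in [A] they add up to the arcs that [p1] sends from the contracted vertex to [w]. *)
have /fin_all_exists[g hg] w : exists q : I -> nat,
    (forall u, q u <= m u w) /\ (w \in V :\: A -> \sum_(u in A) q u = p1 a w).
  case: (boolP (w \in V :\: A)) => wV; last by exists (fun=> 0).
  have [|q q1 q2] := @distribute A (fun u => m u w) (p1 a w); last by exists q.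
  by rewrite -p1a // leq_addr.
have g1 w u : g w u <= m u w by have [] := hg w.
have g2 w : w \in V :\: A -> \sum_(u in A) g w u = p1 a w by have [] := hg w.
exists (fun v => \sum_(w in V :\: A) (m v w - g w v)), (fun v => \sum_(w in V :\: A) g w v).
split.
- move=> v; rewrite -big_split /=; apply: eq_bigr => w _; rewrite subnK //.
- rewrite /arcs exchange_big /= [X in (_ - X%:Z)%R]exchange_big /= !sumZ -sumrB.
  rewrite net_crep subrr add0r /net; apply: eq_bigr => w wV.
  rewrite g2 //; congr (_ - Posz _)%R.
  have : \sum_(u in A) (m u w - g w u) + \sum_(u in A) g w u = \sum_(u in A) m u w.
    by rewrite -big_split /=; apply: eq_bigr => u _; rewrite subnK.
  by rewrite g2 // -p1a //; lia.
move=> p2 hp2.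
exists (fun u w => if u \in A then (if w \in A then p2 u w else g w u)
                   else (if w \in A then m w u - g u w else p1 u w)); split.
- move=> u w uV wV uw.
  case: (boolP (u \in A)) => uA; case: (boolP (w \in A)) => wA.
  + exact: hp2.
  + by rewrite addnC subnK.
  + by rewrite subnK // sm.
  by rewrite hp1 ?memo ?cmat_out // inE ?uA ?wA.
- move=> v vA; rewrite /net (big_setID A) (setIidPr AV) /= vA -addrA; congr (_ + _)%R.
    by apply: eq_bigr => w wA; rewrite wA.
  rewrite !sumZ -sumrB; apply: eq_bigr => w; rewrite inE => /andP[/negPf -> _] //.
move=> v vV; rewrite net_crep /net (big_setID A) (setIidPr AV) /=.
have vA : (v \in A) = false by move: vV; rewrite inE => /andP[/negPf].
rewrite vA; congr (_ + _)%R; last first.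
  by apply: eq_bigr => w; rewrite inE => /andP[/negPf -> _].
rewrite (eq_bigr (fun w => (m w v - g v w)%N%:Z - (g v w)%:Z)%R); last by move=> w ->.
rewrite sumrB -!sumZ g2 //; congr (Posz _ - _)%R.
have : \sum_(u in A) (m u v - g v u) + \sum_(u in A) g v u = \sum_(u in A) m u v.
  by rewrite -big_split /=; apply: eq_bigr => u _; rewrite subnK.
by rewrite g2 // -p1a //; lia.
Qed.

(** Edges from [B] to the outside of [A] have become arcs of the additional vertex, so they are
    still counted, in another summand. *)
Lemma cut_inner o i o2 i2 B : B \subset A ->
  (forall v, o2 v + i2 v = \sum_(w in V :\: A) m v w) ->
  cut A m (fun v => o v + o2 v) (fun v => i v + i2 v) B = cut V m o i B.
Proof.
clear a aA sm; move=> BA h; rewrite /cut /arcs !big_split /=.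
have e : cutm V m B = cutm A m B + \sum_(u in B) (o2 u + i2 u).
  rewrite /cutm -big_split /=; apply: eq_bigr => u uB; rewrite h.
  rewrite (big_setID A) /=; congr (_ + _); apply: eq_bigl => w; rewrite !inE.
    by case: (boolP (w \in A)) => wA; rewrite ?andbF //= (subsetP AV) ?andbT.
  by case: (boolP (w \in A)) => wA //=; rewrite (contraNN (subsetP BA w) wA).
rewrite e big_split /=; lia.
Qed.

End Glue.

(** The outer solution orients all edges leaving [A]; merged with the arcs already present they form
    the additional vertex of an instance on [A]. Cuts inside [A] keep their size, and both instances
    have fewer vertices. *)
Lemma contract_step k (k_gt0 : 0 < k) V m o i b ex A :
  boundary_inst k V m o i b ex -> solves_fewer_vertices k V ->
  A \subset V -> 1 < #|A| -> A != V -> cut V m o i A + 2 <= k + k + dist2k k (bsum b A) ->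
  boundary_sol k V m o i b.
Proof.
move=> H IH AV A1 A2 tA.
have [a aA] : exists a, a \in A by apply/set0Pn; rewrite -card_gt0; lia.
pose h := crep A a; have sm := inst_sym H.
have V1a : a \in h @: V by rewrite (crep_img AV aA) !inE eqxx.
have [p1 [p1m p1t]] : boundary_sol k (h @: V) (cmat h V m) (carc h V o) (carc h V i) (cb h V b).
  apply: (IH _ _ _ _ _ _ _ _ (inst_contract k_gt0 h H)).
    exact: card_crep.
  by apply/set0Pn; exists a.
have [o2 [i2 [h1 h2 h3]]] := split_contraction AV aA sm p1m.
have [p2 [p2m p2t]] : boundary_sol k A m (fun v => o v + o2 v) (fun v => i v + i2 v) b.
  apply: (IH _ _ _ _ _ (ex :&: A)).
  - by rewrite proper_card // properEneq A2.
  - by apply/set0Pn; exists a.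
  split => //.
  - move=> B BA; rewrite (cut_inner AV _ _ BA h1) //; apply: (inst_par H).
    exact: subset_trans BA AV.
  - have [c1 _] := p1t a V1a; move: c1.
    rewrite /excess_at -h2 /carc /cb (expand_a AV aA) /arcs !big_split /= -!/(arcs _ _).
    by case=> q hq; exists (- q)%R; lia.
  (* All arcs at the new additional vertex form the cut of [A], so [inst_ii] of the inner instance
     is the tightness of [A]. *)
  - have <- : cut A m (fun v => o v + o2 v) (fun v => i v + i2 v) A =
            arcs (fun v => o v + o2 v) A + arcs (fun v => i v + i2 v) A.
      by rewrite /cut /cutm setDv big1 ?addn0 // => u _; rewrite big_set0.
    by rewrite (cut_inner AV _ _ (subxx A) h1).
  - move=> B BA B0 BA' Bex; rewrite (cut_inner AV _ _ BA h1) //; apply: (inst_iii H) => //.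
    + exact: subset_trans BA AV.
    + by apply: contraNneq A2 => e; rewrite eqEsubset AV -e.
    by apply: contraNneq Bex => e; rewrite -e; apply/eqP/esym/setIidPl.
  move=> x; rewrite inE => /andP[xe xA]; have [e1 e2 e3] := inst_ex H xe.
  by split => //; rewrite e1; apply/setIidPl; rewrite sub1set.
have [p [pm pA pV]] := h3 p2 p2m.
exists p; split => // v vV; case: (boolP (v \in A)) => vA.
  have [c1 c2] := p2t v vA; rewrite /excess_at pA //.
  have <- : (excess_at A p2 (fun v => o v + o2 v) (fun v => i v + i2 v) v =
     net A p2 v + (i2 v)%:Z - (o2 v)%:Z + (i v)%:Z - (o v)%:Z)%R by rewrite /excess_at; lia.
  by [].
have vVA : v \in V :\: A by rewrite inE vA.
have v1 : v \in h @: V by rewrite (crep_img AV aA) !inE vA vV orbT.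
have := p1t v v1.
by rewrite /excess_at /carc /cb !(expand_out aA vVA) !arcs1 bsum1 pV.
Qed.

End Contraction.

(** * Reductions: deleting an edge or an arc, lifting at a vertex of residue 0 *)

Section Steps.
Variables (I : finType) (k : nat).
Implicit Types (V A B X ex : {set I}) (m p : I -> I -> nat) (o i : I -> nat).
Implicit Types (b : I -> int) (x y u v w : I).

Lemma cut1 V m o i v :
  cut V m o i [set v] = o v + i v + \sum_(w in V :\ v) m v w.
Proof. by rewrite /cut !arcs1 /cutm big_set1. Qed.

Lemma eps_split m x y : (forall u w, m u w = m w u) -> x != y -> 0 < m x y ->
  exists2 m', forall u w, m' u w = m' w u & forall u w, m u w = m' u w + eps x y u w.
Proof.
move=> sm xy h; exists (fun u w => m u w - eps x y u w); last exact: eps_le.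
by move=> u w; rewrite sm epsC.
Qed.

Lemma bsum_move b b' x y A : (forall u, b' u = b u - (u == x)%:Z + (u == y)%:Z)%R ->
  (bsum b' A = bsum b A + ((y \in A)%:Z - (x \in A)%:Z))%R.
Proof.
move=> h.
have e1 := @bsumD _ (fun u => b u - (u == x)%:Z)%R b x (-1)%R A.
have e2 := @bsumD _ b' (fun u => b u - (u == x)%:Z)%R y 1%R A.
by rewrite e2 ?e1; [lia | move=> u; lia | move=> u; rewrite h; lia].
Qed.

Lemma cut_del V m m' o i x y A : x \in V -> y \in V -> A \subset V ->
  (forall u w, m u w = m' u w + eps x y u w) ->
  cut V m o i A = cut V m' o i A + ((x \in A) != (y \in A)).
Proof. by move=> xV yV AV hm; rewrite /cut (cutmD _ _ hm) cutm_eps //; lia. Qed.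

Lemma mass_del V m m' x y : x \in V -> y \in V ->
  (forall u w, m u w = m' u w + eps x y u w) -> mass V m = mass V m' + 2.
Proof. by move=> xV yV hm; rewrite (massD _ hm) mass_eps. Qed.

Hypothesis k_gt0 : 0 < k.

Lemma neg_dist2k (z : int) : pos_residue k (- z)%R -> dist2k k (z + 1)%R + 1 = dist2k k z.
Proof.
move=> h; rewrite -(dist2kN k_gt0 z) -(pos_dist2k k_gt0 h) -(dist2kN k_gt0 (z + 1)%R).
by congr (dist2k k _ + 1); lia.
Qed.

Lemma neg_bound (z t : int) : pos_residue k (- z)%R -> cong2k k t (z + 1)%R -> `|t| < k + k ->
  `|(t - 1)%R| < k + k.
Proof.
move=> hz ht h.
have : `|(- t + 1)%R| < k + k.
  apply: (pos_bound k_gt0 hz); last by lia.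
  by have := cong2kN ht; congr cong2k; lia.
by lia.
Qed.

(** Directing the edge from [x] to [y] brings both residues one closer to 0, so at the two ends
    distance and degree drop together. For larger sets the cut drops and the distance rises by at
    most one each, which the slack of [loose_cuts] absorbs. *)
Lemma del_step V m o i b x y : boundary_inst k V m o i b set0 -> loose_cuts k V m o i b ->
  solves_fewer_edges k V m -> x \in V -> y \in V -> x != y -> 0 < m x y ->
  pos_residue k (b x) -> pos_residue k (- b y)%R -> boundary_sol k V m o i b.
Proof.
move=> H nt IH xV yV xy mxy px py.
have [m' sm' hm] := eps_split (inst_sym H) xy mxy.
pose b' u := (b u - (u == x)%:Z + (u == y)%:Z)%R.
have cE A : A \subset V -> cut V m o i A = cut V m' o i A + ((x \in A) != (y \in A)).
  by move=> AV; apply: cut_del.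
have bE A : (bsum b' A = bsum b A + ((y \in A)%:Z - (x \in A)%:Z))%R by apply: bsum_move.
have bV : bsum b' V = bsum b V by rewrite bE xV yV; lia.
apply: (sol_del k_gt0 (m' := m') (b' := b') xV yV xy) => //.
- by move=> t; exact: (pos_bound k_gt0 px).
- by move=> t; exact: (neg_bound py).
apply: (IH _ _ _ _ set0); first by rewrite (mass_del xV yV hm); lia.
split => //.
- move=> A AV; have [q hq] := inst_par H AV; rewrite bE; move: hq; rewrite cE //.
  case: (x \in A); case: (y \in A) => /= hq; [exists q|exists (q - 1)%R|exists q|exists q]; lia.
- by rewrite bV; exact: (inst_tot H).
- by rewrite bV; exact: (inst_ii H).
- move=> A AV A0 AV' _; case: (set_cases A0) => [[z zA]|A1].
    have := inst_iii H AV A0 AV' A0; rewrite cE // zA !bsum1 !inE /b'.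
    rewrite ![_ == z]eq_sym.
    case: (eqVneq z x) => [->|zx].
      rewrite (negPf xy) /=; have := pos_dist2k k_gt0 px.
      have -> : (b x - 1%Z + 0%Z = b x - 1)%R by lia.
      lia.
    case: (eqVneq z y) => [->|zy] /=.
      rewrite -(neg_dist2k py); have -> : (b y - 0%Z + 1%Z = b y + 1)%R by lia.
      lia.
    have -> : (b z - 0%Z + 0%Z = b z)%R by lia.
    lia.
  have := nt A AV A1 AV'; rewrite cE // bE.
  have := dist2kD k_gt0 (bsum b A) ((y \in A)%:Z - (x \in A)%:Z)%R.
  by case: (x \in A); case: (y \in A) => /=; clear; lia.
by move=> z; rewrite inE.
Qed.

(** An arc entering [x] already contributes -1. Removing it moves the negative residue at [x]
    towards 0, and in [inst_ii] the arc count drops by one while the distance drops by at most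
    one. *)
Lemma arc_step V m o i b x : boundary_inst k V m o i b set0 -> loose_cuts k V m o i b ->
  solves_fewer_arcs k V m (arcs o V + arcs i V) -> x \in V -> 0 < o x ->
  pos_residue k (- b x)%R -> boundary_sol k V m o i b.
Proof.
move=> H nt IH xV ox px.
pose o' u := o u - (u == x).
have ho u : o u = o' u + (u == x) * 1.
  by rewrite /o' muln1 subnK //; case: eqP => [->|].
pose b' u := (b u + (u == x)%:Z * 1)%R.
have oE A : arcs o A = arcs o' A + (x \in A) * 1 by apply: arcsD.
have bE A : (bsum b' A = bsum b A + (x \in A)%:Z * 1)%R by apply: bsumD.
have cE A : cut V m o i A = cut V m o' i A + (x \in A) by rewrite /cut oE; lia.
have oV := oE V; have bV := bE V; rewrite xV in oV bV.
apply: (sol_arc k_gt0 (o' := o') (i' := i) (b' := b')).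
- apply: (IH _ _ _ set0); first by lia.
  split => //; first exact: (inst_sym H).
  + move=> A AV; have [q hq] := inst_par H AV; rewrite bE; move: hq; rewrite cE //.
    by case: (x \in A) => /= hq; exists q; lia.
  + by have [q hq] := inst_tot H; exists q; lia.
  + have := inst_ii H; have := dist2kD k_gt0 (bsum b' V) (-1)%R.
    have -> : (bsum b' V + -1 = bsum b V)%R by lia.
    lia.
  + move=> A AV A0 AV' _; case: (set_cases A0) => [[z zA]|A1].
      have := inst_iii H AV A0 AV' A0; rewrite cE // zA !bsum1 !inE /b'.
      rewrite ![_ == z]eq_sym.
      case: (eqVneq z x) => [->|zx] /=.
        by have := neg_dist2k px; rewrite mul1r; lia.
      by rewrite mul0r addr0; lia.
    have := nt A AV A1 AV'; rewrite cE // bE.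
    have := dist2kD k_gt0 (bsum b A) ((x \in A)%:Z * 1)%R.
    by case: (x \in A) => /=; lia.
  by move=> z; rewrite inE.
- by move=> v vV; apply: cong2k_eq; rewrite /b' ho; lia.
move=> v t vV; rewrite /b' ho.
case: (eqVneq v x) => [->|vx] /= h1 h2.
  have := neg_bound px h1 h2; lia.
lia.
Qed.

(** If [t] had absolute value at least 2k, then shifting by 2k would bound its distance by that
    value minus 2k, against the second hypothesis. *)
Lemma loose_bound (t : int) (n : nat) : `|t| <= n -> n + 2 <= k + k + dist2k k t -> `|t| < k + k.
Proof.
move=> h1 h2; have [//|h3] := ltnP `|t| (k + k).
have [h|h] := leP 0%R t.
  have : dist2k k t <= `|(t - (k + k)%:Z)%R| by apply: dist2k_le => //; exists 1%R; lia.
  lia.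
have : dist2k k t <= `|(t + (k + k)%:Z)%R| by apply: dist2k_le => //; exists (-1)%R; lia.
lia.
Qed.

Lemma boundary_net V m o i b ex : boundary_inst k V m o i b ex ->
  let t := ((arcs i V)%:Z - (arcs o V)%:Z)%R in cong2k k t (bsum b V) /\ `|t| < k + k.
Proof.
move=> H t; have c : cong2k k t (bsum b V).
  by rewrite /t; have [q hq] := inst_tot H; exists (- q)%R; lia.
split => //; apply: (@loose_bound t (arcs o V + arcs i V)); first by rewrite /t; lia.
by rewrite (dist2k_cg k_gt0 c); exact: (inst_ii H).
Qed.

Lemma single_step V m o i b ex v : V = [set v] -> boundary_inst k V m o i b ex -> boundary_sol k V m o i b.
Proof.
move=> Vv H; have [h1 h2] := boundary_net H; exists m; split.
  by move=> u w; rewrite Vv !inE => /eqP -> /eqP ->; rewrite eqxx.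
move=> u; rewrite Vv inE => /eqP ->; move: h1 h2; rewrite Vv bsum1 !arcs1.
have -> : excess_at [set v] m o i v = ((i v)%:Z - (o v)%:Z)%R.
  by rewrite /excess_at /net big_set1; lia.
by [].
Qed.

(** Lifting at [v] preserves the degree of every vertex except the exempt [v], and reduces any other
    cut by at most two. *)
Lemma lift_step V m o i b u v w : boundary_inst k V m o i b [set v] -> loose_cuts k V m o i b ->
  solves_fewer_edges k V m -> u \in V -> v \in V -> w \in V -> u != v -> v != w -> u != w ->
  0 < m v u -> 0 < m v w -> boundary_sol k V m o i b.
Proof.
move=> H nt IH uV vV wV uv vw uw mvu mvw.
have sm := inst_sym H; have vu : v != u by rewrite eq_sym.
have [m1 sm1 hm1] := eps_split sm uv (eq_ind_r (fun z => 0 < z) mvu (sm u v)).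
have m1vw : 0 < m1 v w.
  by move: mvw; rewrite hm1 /eps (negPf vu) [w == u]eq_sym (negPf uw) /= andbF addn0.
have [m0 sm0 hm0] := eps_split sm1 vw m1vw.
have hm a c : m a c = m0 a c + eps u v a c + eps v w a c by rewrite hm1 hm0 addnAC.
apply: (sol_lift (m0 := m0) uV vV wV uv vw uw hm).
have hm2 (a c : I) : m0 a c + eps u w a c = m0 a c + eps u w a c by [].
have cE A : A \subset V -> cut V m o i A + ((u \in A) != (w \in A)) =
   cut V (fun a c => m0 a c + eps u w a c) o i A
   + ((u \in A) != (v \in A)) + ((v \in A) != (w \in A)).
  move=> AV; rewrite (cut_del _ _ uV vV AV hm1) (cut_del _ _ vV wV AV hm0).
  by rewrite (cut_del _ _ uV wV AV hm2); clear; lia.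
apply: (IH _ _ _ _ [set v]).
  rewrite (mass_del uV vV hm1) (mass_del vV wV hm0) (mass_del uV wV hm2); clear; lia.
split => //.
- by move=> a c; rewrite sm0 epsC.
- move=> A AV; have [q hq] := inst_par H AV; have := cE A AV; move: hq.
  case: (u \in A); case: (v \in A); case: (w \in A) => /= hq hc;
    move: hq hc; clear; move=> hq hc;
    first [by exists q; lia | by exists (q - 1)%R; lia].
- exact: (inst_tot H).
- exact: (inst_ii H).
- move=> A AV A0 AV' Av; have := cE A AV; case: (set_cases A0) => [[z zA]|A1].
    have := inst_iii H AV A0 AV' Av; rewrite zA !inE.
    have vz : (v == z) = false by apply: contraNF Av => /eqP ->; rewrite zA.
    rewrite vz; case: (eqVneq u z) => [uz|uz]; case: (eqVneq w z) => [wz|wz] /=.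
    - by rewrite uz wz eqxx in uw.
    - by clear; lia.
    - by clear; lia.
    by clear; lia.
  have := nt A AV A1 AV'.
  case: (u \in A); case: (v \in A); case: (w \in A) => /=; clear; lia.
exact: (inst_ex H).
Qed.

(** The lifting in which one of the two edges is an arc from the additional vertex: the arc is
    redirected from [v] to [u]. The number of arcs stays the same, and with it [inst_ii]. *)
Lemma liftz_step V m o i b u v : boundary_inst k V m o i b [set v] -> loose_cuts k V m o i b ->
  solves_fewer_edges k V m -> u \in V -> v \in V -> u != v -> 0 < m v u -> 0 < o v ->
  boundary_sol k V m o i b.
Proof.
move=> H nt IH uV vV uv mvu ov.
have vu : v != u by rewrite eq_sym.
have [m' sm' hm] := eps_split (inst_sym H) vu mvu.
pose o0 a := o a - (a == v).
have ho a : o a = o0 a + (a == v).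
  by rewrite /o0 subnK //; case: eqP => [->|].
apply: (sol_liftz k_gt0 (m' := m') uV vV uv hm ho).
have oE A : arcs o A + (u \in A) = arcs (fun a => o0 a + (a == u)) A + (v \in A).
  have e1 : arcs o A = arcs o0 A + (v \in A) * 1 by apply: arcsD => a; rewrite ho muln1.
  have e2 : arcs (fun a => o0 a + (a == u)) A = arcs o0 A + (u \in A) * 1.
    by apply: arcsD => a; rewrite muln1.
  by rewrite e1 e2; lia.
have cE A : A \subset V -> cut V m o i A + (u \in A) =
   cut V m' (fun a => o0 a + (a == u)) i A + (v \in A) + ((v \in A) != (u \in A)).
  by move=> AV; have := oE A; rewrite (cut_del _ _ vV uV AV hm) /cut; clear; lia.
have oV : arcs (fun a => o0 a + (a == u)) V = arcs o V by have := oE V; rewrite uV vV; clear; lia.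
apply: (IH _ _ _ _ [set v]); first by rewrite (mass_del vV uV hm); lia.
split => //.
- move=> A AV; have [q hq] := inst_par H AV; have := cE A AV; move: hq.
  case: (u \in A); case: (v \in A) => /= hq hc;
    move: hq hc; clear; move=> hq hc;
    first [by exists q; lia | by exists (q - 1)%R; lia].
- by rewrite oV; exact: (inst_tot H).
- by rewrite oV; exact: (inst_ii H).
- move=> A AV A0 AV' Av; have := cE A AV; case: (set_cases A0) => [[z zA]|A1].
    have := inst_iii H AV A0 AV' Av; rewrite zA !inE.
    have vz : (v == z) = false by apply: contraNF Av => /eqP ->; rewrite zA.
    by rewrite vz; case: (eqVneq u z) => [uz|uz] /=; clear; lia.
  have := nt A AV A1 AV'.
  case: (u \in A); case: (v \in A) => /=; clear; lia.
exact: (inst_ex H).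
Qed.

Lemma bsum_zero b V v : v \in V -> dist2k k (b v) = 0 -> cong2k k (bsum b V) (bsum b (V :\ v)).
Proof.
move=> vV bv; have [q hq] := dist2k0P k_gt0 bv; exists q.
by rewrite /bsum (big_setD1 v) //= hq add0r addrC.
Qed.

Lemma drop_step V m o i b v : boundary_inst k V m o i b [set v] -> solves_fewer_vertices k V -> 1 < #|V| ->
  v \in V -> (forall w, w \in V -> w != v -> m v w = 0) -> o v = 0 -> i v = 0 ->
  boundary_sol k V m o i b.
Proof.
move=> H IH V1 vV mv ov iv.
have sm := inst_sym H; have [_ _ bv] := inst_ex H (set11 v).
have bV := bsum_zero vV bv.
have aE o1 : o1 v = 0 -> arcs o1 V = arcs o1 (V :\ v).
  by move=> h; rewrite /arcs (big_setD1 v) //= h.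
have cE A : A \subset V :\ v -> cut V m o i A = cut (V :\ v) m o i A.
  move=> AV; rewrite /cut; congr (_ + _); rewrite /cutm; apply: eq_bigr => u uA.
  have := subsetP AV u uA; rewrite !inE => /andP[uv uV].
  have vA : v \in V :\: A.
    by rewrite inE vV andbT; apply/negP => /(subsetP AV); rewrite !inE eqxx.
  rewrite (big_setD1 v) //= sm mv // add0n; apply: eq_bigl => w; rewrite !inE.
  by case: (w == v); rewrite ?andbF ?andbT.
have [p [pm pt]] : boundary_sol k (V :\ v) m o i b.
  apply: (IH _ _ _ _ _ set0).
  - by rewrite [X in _ < X](cardsD1 v) vV.
  - by rewrite -card_gt0; move: V1; rewrite (cardsD1 v) vV.
  split => //.
  - move=> A AV; rewrite -cE //; apply: (inst_par H).
    exact: subset_trans AV (subD1set _ _).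
  - rewrite -!aE //; apply: cong2k_trans (inst_tot H); apply: cong2kD (cong2k_refl _ _).
    exact: cong2k_sym.
  - by rewrite -!aE // -(dist2k_cg k_gt0 bV); exact: (inst_ii H).
  - move=> A AV A0 AV' _; rewrite -cE //; apply: (inst_iii H) => //.
    + exact: subset_trans AV (subD1set _ _).
    + apply/eqP => e; have : v \in A by rewrite e.
      by move/(subsetP AV); rewrite !inE eqxx.
    apply/eqP => e; have : v \in A by rewrite e inE.
    by move/(subsetP AV); rewrite !inE eqxx.
  by move=> z; rewrite inE.
exists (fun u w => if (u == v) || (w == v) then 0 else p u w); split.
  move=> u w uV wV uw; rewrite orbC; case: (eqVneq w v) => [wv|wv] /=.
    by rewrite wv sm mv // -wv.
  case: (eqVneq u v) => [->|uv] /=; first by rewrite mv.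
  by rewrite pm // !inE ?uv ?wv.
move=> u uV; rewrite /excess_at /net (big_setD1 v) //= !eqxx !orbT subrr add0r.
case: (eqVneq u v) => [->|uv] /=.
  rewrite big1 ?add0r; last by move=> w _; rewrite orbT.
  rewrite ov iv; split; last by lia.
  exact/cong2k_sym/(dist2k0P k_gt0 bv).
have := pt u; rewrite !inE uv => /(_ uV); rewrite /excess_at /net.
rewrite [X in _ -> cong2k k (X + _ - _)%R _ /\ _](eq_bigr (fun w => (p u w)%:Z - (p w u)%:Z)%R) //; last first.
  by move=> w; rewrite !inE => /andP[/negPf ->].
rewrite [X in _ -> _ /\ `|(X + _ - _)%R| < _](eq_bigr (fun w => (p u w)%:Z - (p w u)%:Z)%R) //.
by move=> w; rewrite !inE => /andP[/negPf ->].
Qed.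

(** When [u] is the only neighbour of [v], lifting would create a loop at [u]; two parallel edges
    are discarded instead and later given opposite directions. *)
Lemma pair_step V m o i b u v : boundary_inst k V m o i b [set v] -> loose_cuts k V m o i b ->
  solves_fewer_edges k V m -> u \in V -> v \in V -> u != v -> 0 < m v u ->
  (forall w, w \in V -> w != v -> w != u -> m v w = 0) -> o v = 0 -> i v = 0 ->
  boundary_sol k V m o i b.
Proof.
move=> H nt IH uV vV uv mvu mv ov iv.
have sm := inst_sym H; have [_ _ bv] := inst_ex H (set11 v).
have c1 : cut V m o i [set v] = m v u.
  rewrite cut1 ov iv !add0n (big_setD1 u) ?inE ?uv //= big1 ?addn0 // => w.
  by rewrite !inE => /and3P[wu wv wV]; rewrite mv.
(* The cut of [v] consists of the edges to [u], and its parity is that of [b v], which is even. *)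
have ev : exists n, m v u = n + n.
  have := inst_par H; move=> /(_ [set v]); rewrite sub1set => /(_ vV)[q].
  have [s hs] := dist2k0P k_gt0 bv.
  rewrite c1 bsum1 hs => hq; exists `|(q - s * k%:Z)%R|; lia.
have [n hn] := ev.
(* On two vertices the pair is not a proper set, so no slack is available. The solution is explicit:
   half of the edges in each direction, the excess at [u] being that of the whole instance. *)
have [Vuv|Vuv] := eqVneq V [set u; v].
  have [t1 t2] := boundary_net H; have uv' : u \notin [set v] by rewrite inE.
  exists (fun _ _ => n); split.
    move=> a c; rewrite Vuv !inE => /orP[]/eqP -> /orP[]/eqP ->; rewrite ?eqxx //.
      by rewrite sm.
  move=> a aV; have -> : excess_at V (fun _ _ => n) o i a = ((i a)%:Z - (o a)%:Z)%R.
    by rewrite /excess_at /net big1 ?add0r // => w _; rewrite subrr.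
  move: t1 t2; rewrite Vuv /arcs /bsum !big_setU1 //= !big_set1 ov iv !addn0 => t1 t2.
  move: aV; rewrite Vuv !inE => /orP[]/eqP ->; last first.
    rewrite ov iv; split; last by lia.
    exact/cong2k_sym/(dist2k0P k_gt0 bv).
  split => //; apply: cong2k_trans t1 _; have [s hs] := dist2k0P k_gt0 bv.
  by exists s; lia.
have muv : 0 < m u v by rewrite sm.
have [m1 sm1 hm1] := eps_split sm uv muv.
have m1uv : 0 < m1 u v.
  have := hm1 u v; rewrite sm hn /eps !eqxx [v == u]eq_sym (negPf uv) /=; lia.
have [m0 sm0 hm0] := eps_split sm1 uv m1uv.
have hm a c : m a c = m0 a c + eps u v a c + eps u v a c by rewrite hm1 hm0.
apply: (sol_pair uV vV uv hm).
have cE A : A \subset V -> cut V m o i A = cut V m0 o i A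
   + ((u \in A) != (v \in A)) + ((u \in A) != (v \in A)).
  by move=> AV; rewrite (cut_del _ _ uV vV AV hm1) (cut_del _ _ uV vV AV hm0).
apply: (IH _ _ _ _ [set v]); first by rewrite (mass_del uV vV hm1) (mass_del uV vV hm0); clear; lia.
split => //.
- move=> A AV; have [q hq] := inst_par H AV; have := cE A AV; move: hq.
  case: (u \in A); case: (v \in A) => /= hq hc;
    move: hq hc; clear; move=> hq hc;
    first [by exists q; lia | by exists (q - 1)%R; lia].
- exact: (inst_tot H).
- exact: (inst_ii H).
- move=> A AV A0 AV' Av; have := cE A AV; case: (set_cases A0) => [[z zA]|A1].
    have := inst_iii H AV A0 AV' Av; rewrite zA !inE.
    have vz : (v == z) = false by apply: contraNF Av => /eqP ->; rewrite zA.
    rewrite vz; case: (eqVneq u z) => [<-|uz] /=; last by clear; lia.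
    (* The singleton [u] loses two edges. Its cut exceeds that of the pair by [m v u], and the pair
       is loose with the same distance since [b v] is 0 modulo 2k. *)
    have sV : [set u; v] \subset V by apply/subsetP => a; rewrite !inE => /orP[]/eqP ->.
    have := nt _ sV; rewrite cards2 uv eq_sym => /(_ isT Vuv).
    have -> : dist2k k (bsum b [set u; v]) = dist2k k (bsum b [set u]).
      have vin : v \in [set u; v] by rewrite !inE eqxx orbT.
      rewrite (dist2k_cg k_gt0 (bsum_zero vin bv)); congr (dist2k k (bsum b _)).
      by apply/setP => a; rewrite !inE; case: (eqVneq a v) => [->|]; rewrite ?orbF // eq_sym (negPf uv).
    have -> : cut V m o i [set u] = cut V m o i [set u; v] + m v u.
      have uv' : u \notin [set v] by rewrite inE.
      rewrite cut1 (big_setD1 v) ?inE 1?eq_sym ?uv //=.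
      rewrite /cut /arcs /cutm !big_setU1 //= !big_set1 ov iv !addn0.
      rewrite [X in _ = _ + (_ + X) + _]big1 ?addn0; last first.
        by move=> w; rewrite !inE negb_or => /andP[/andP[wu wv] wV]; rewrite mv.
      rewrite (sm v u) [m u v + _]addnC addnA; congr (_ + _ + _).
      by apply: eq_bigl => w; rewrite !inE negb_or; case: (w == u); case: (w == v).
    lia.
  have := nt A AV A1 AV'.
  case: (u \in A); case: (v \in A) => /=; clear; lia.
exact: (inst_ex H).
Qed.

(** Vertex [v] is dissolved: edges are lifted against an arc of the additional vertex or against an
    edge to another neighbour, or removed in parallel pairs, and an isolated [v] is dropped. *)
Lemma zero_step V m o i b v : boundary_inst k V m o i b [set v] -> loose_cuts k V m o i b ->
  solves_fewer_vertices k V -> solves_fewer_edges k V m -> 1 < #|V| -> boundary_sol k V m o i b.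
Proof.
move=> H nt IV IM V1; have [_ vV bv] := inst_ex H (set11 v).
have sm := inst_sym H.
case: (boolP [exists u in V :\ v, 0 < m v u]) => [/exists_inP[u]|].
  rewrite !inE => /andP[uv uV] mu.
  case: (posnP (o v)) => [ov|ov]; last exact: (liftz_step H nt IM uV vV uv mu ov).
  case: (posnP (i v)) => [iv|iv]; last first.
    apply: (sol_opp k_gt0); apply: (liftz_step (inst_opp k_gt0 H) (loose_cuts_opp k_gt0 nt) IM uV vV uv mu iv).
  case: (boolP [exists w in V :\ v, (w != u) && (0 < m v w)]) => [/exists_inP[w]|].
    rewrite !inE => /andP[wv wV] /andP[wu mw].
    by apply: (lift_step H nt IM uV vV wV uv _ _ mu mw); rewrite eq_sym.
  rewrite negb_exists_in => /forall_inP hw.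
  apply: (pair_step H nt IM uV vV uv mu) => // w wV wv wu.
  have := hw w; rewrite !inE wv wV => /(_ isT); rewrite wu /= lt0n negbK => /eqP //.
rewrite negb_exists_in => /forall_inP hw.
have mv w : w \in V -> w != v -> m v w = 0.
  by move=> wV wv; have := hw w; rewrite !inE wv wV => /(_ isT); rewrite lt0n negbK => /eqP.
(* Without edges at [v], the cut of the remaining vertices consists of their arcs alone. Its lower
   bound equals the upper bound [inst_ii] for all arcs, so none is left at [v]. *)
have [ov iv] : o v = 0 /\ i v = 0.
  have VV : V :\ v \subset V by exact: subD1set.
  have V0 : V :\ v != set0 by rewrite -card_gt0; move: V1; rewrite (cardsD1 v) vV.
  have VN : V :\ v != V by apply/eqP => e; have := setD11 v V; rewrite e vV.
  have Vv : V :\ v != [set v].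
    by apply/eqP => e; have := setD11 v V; rewrite e set11.
  have := inst_iii H VV V0 VN Vv; have := inst_ii H.
  rewrite (dist2k_cg k_gt0 (bsum_zero vV bv)) /cut.
  have -> : cutm V m (V :\ v) = 0.
    rewrite /cutm big1 // => u; rewrite !inE => /andP[uv uV].
    rewrite big1 // => w; rewrite !inE => /andP[h wV].
    by move: h; rewrite wV andbT negbK => /eqP ->; rewrite sm mv.
  by rewrite /arcs !(big_setD1 v vV) /=; lia.
exact: (drop_step H IV V1 vV mv ov iv).
Qed.

End Steps.

(** * The orientation theorem with boundary modulo 2k *)

Section Orient.
Variables (I : finType) (k : nat).
Hypothesis k_gt0 : 0 < k.
Implicit Types (V A B X ex : {set I}) (m p : I -> I -> nat) (o i : I -> nat).
Implicit Types (b : I -> int) (x y u v w : I).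

Lemma card_complement V v : 1 < #|V| -> v \in V ->
  [/\ V :\ v \subset V, V :\ v != set0, V :\ v != V & [set v] != V].
Proof.
move=> V1 vV; split; first exact: subD1set.
- by rewrite -card_gt0; move: V1; rewrite (cardsD1 v) vV.
- by apply/eqP => e; have := setD11 v V; rewrite e vV.
by apply: contraTneq V1 => <-; rewrite cards1.
Qed.

(** This yields [inst_ii] after the flip, where [n] arcs leave the additional vertex beforehand and
    the total boundary becomes [c + 1 - n]. *)
Lemma flip_dist2k (n c : nat) : c < k -> n < k + k ->
  n + c + 1 <= k + k + dist2k k (c%:Z + 1 - n%:Z)%R.
Proof.
move=> ck nk; have [h|h] := leqP n (k + c + 1).
  by rewrite dist2k_small //; lia.
have -> : dist2k k (c%:Z + 1 - n%:Z)%R = dist2k k ((k + k)%:Z + (c%:Z + 1 - n%:Z))%R.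
  by apply: dist2k_cg => //; exists (-1)%R; lia.
by rewrite dist2k_small //; lia.
Qed.

(* Replacing an arc into [x] by [k - tau x] arcs out of [x] turns the only
   positive-sign situation into one with a vertex of negative sign. *)
Lemma flip_step V m o i b (tau : I -> int) :
  boundary_inst k V m o i b set0 -> loose_cuts k V m o i b -> solves_fewer_vertices k V -> solves_fewer_edges k V m ->
  1 < #|V| -> (forall x, x \in V -> cong2k k (b x) (tau x) /\ (0 < tau x < k%:Z)%R) ->
  (forall x, x \in V -> i x = 0) -> boundary_sol k V m o i b.
Proof.
move=> H nt IV IM V1 ht i0.
have iA A : A \subset V -> arcs i A = 0.
  by move=> AV; rewrite /arcs big1 // => x /(subsetP AV) /i0.
have iV := iA V (subxx V).
(* [e] tells whether there is an arc to remove at [x]. With [e = 0] the additional vertex has no arc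
   at all and [c + 1] arcs are added instead of [c]; the boundary shift is [c + 1] in both cases. *)
have [x [e [xV e1 eo e0]]] : exists x (e : nat), [/\ x \in V, e <= 1, e <= o x &
    (e = 0 -> arcs o V = 0)].
  case: (boolP [exists x in V, 0 < o x]) => [/exists_inP[x xV ox]|].
    by exists x, 1; split => //.
  rewrite negb_exists_in => /forall_inP h.
  have [x xV] : exists x, x \in V by apply/set0Pn; rewrite -card_gt0; lia.
  exists x, 0; split => // _; rewrite /arcs big1 // => y /h.
  by rewrite lt0n negbK => /eqP.
have [bx tx] := ht x xV.
have [VV V0 VN Vx] := card_complement V1 xV.
have k2 : 1 < k by lia.
have nrmx : ((dist2k k (b x))%:Z = tau x)%R by rewrite (dist2k_cg k_gt0 bx) dist2k_small; lia.
pose c := `|(k%:Z - tau x)%R|.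
have hc : (c%:Z = k%:Z - tau x)%R by rewrite /c; lia.
pose o' u := o u - (u == x) * e.
pose i' u := i u + (u == x) * (c + 1 - e).
pose b' u := (b u + (u == x)%:Z * (c%:Z + 1))%R.
have ho u : o u = o' u + (u == x) * e.
  by rewrite /o'; case: eqP => [->|]; rewrite ?mul0n ?subn0 ?addn0 // mul1n subnK.
have oE A : arcs o A = arcs o' A + (x \in A) * e by apply: arcsD.
have iE A : arcs i' A = arcs i A + (x \in A) * (c + 1 - e) by apply: arcsD.
have bE A : (bsum b' A = bsum b A + (x \in A)%:Z * (c%:Z + 1))%R by apply: bsumD.
have cE A : cut V m o' i' A + (x \in A) * e = cut V m o i A + (x \in A) * (c + 1 - e).
  by rewrite /cut oE iE; lia.
(* The new residue at [x] is k + 1, that is -(k - 1): its sign has changed. The distance grows by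
   [c - 1], the degree by at least as much. *)
have b'x : cong2k k (b' x) (k%:Z + 1)%R.
  by case: bx => q hq; exists q; rewrite /b' eqxx hq; lia.
have oV := oE V; have i'V := iE V; have bV := bE V; rewrite xV iV in oV i'V bV.
have Ok : arcs o V < k + k by have [_] := boundary_net k_gt0 H; rewrite iV; lia.
have H' : boundary_inst k V m o' i' b' set0.
  split; first exact: (inst_sym H).
  - move=> A AV; have [q hq] := inst_par H AV; have := cE A; rewrite bE.
    case: (x \in A) => /= h; last by exists q; lia.
    by exists (q + c%:Z + 1 - e%:Z)%R; lia.
  - have [q hq] := inst_tot H; exists q; rewrite bV i'V; lia.
  - have bVo : cong2k k (bsum b' V) (c%:Z + 1 - (arcs o V)%:Z)%R.
      by have [q hq] := inst_tot H; exists q; rewrite bV; lia.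
    rewrite (dist2k_cg k_gt0 bVo).
    have := @flip_dist2k (arcs o V) c; rewrite i'V; have := e0; lia.
  - move=> A AV A0 AV' _; have := cE A; rewrite bE; case: (boolP (x \in A)) => xA /= hcut; last first.
      have := inst_iii H AV A0 AV' A0; rewrite mul0r addr0; lia.
    case: (set_cases A0) => [[z zA]|A1].
      have zx : z = x by apply/eqP; rewrite eq_sym; move: xA; rewrite zA inE.
      have := inst_iii H AV A0 AV' A0.
      have -> : dist2k k (bsum b A + 1%Z * (c%:Z + 1))%R = dist2k k (k%:Z - 1)%R.
        rewrite -(dist2kN k_gt0 (k%:Z - 1)%R); apply: (dist2k_cg k_gt0).
        rewrite zA zx bsum1; case: bx => q hq; exists (q + 1)%R; lia.
      rewrite [dist2k k (_ - 1)%R](dist2k_small k_gt0); last by lia.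
      rewrite zA zx bsum1 in hcut *; lia.
    have := nt A AV A1 AV'.
    have := dist2kD k_gt0 (bsum b A) (1%Z * (c%:Z + 1))%R; lia.
  by move=> z; rewrite inE.
(* If [x] had no neighbour, the bounds for [x] and for its complement would add up to more arcs than
   [inst_ii] permits, because k > 1. *)
have [y yV [yx mxy]] : exists2 y, y \in V & y != x /\ 0 < m y x.
  case: (boolP [exists y in V :\ x, 0 < m y x]) => [/exists_inP[y]|].
    by rewrite !inE => /andP[yx yV] h; exists y.
  rewrite negb_exists_in => /forall_inP h.
  have mx y : y \in V :\ x -> m x y = 0.
    by move/h; rewrite (inst_sym H) lt0n negbK => /eqP.
  have sx : [set x] \subset V by rewrite sub1set.
  have x0 : [set x] != set0 by apply/set0Pn; exists x; rewrite inE.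
  have := inst_iii H sx x0 Vx x0; have := inst_iii H VV V0 VN V0; have := inst_ii H.
  rewrite cut1 bsum1 (i0 x) // big1 // /cut (iA _ VV) iV.
  have -> : cutm V m (V :\ x) = 0.
    rewrite /cutm big1 // => u uV; rewrite big1 // => w; rewrite !inE => /andP[h1 wV].
    move: h1; rewrite wV andbT negbK => /eqP ->; by rewrite (inst_sym H) mx.
  have -> : bsum b V = (bsum b (V :\ x) + b x)%R by rewrite /bsum (big_setD1 x) //= addrC.
  have := dist2k_add k_gt0 (bsum b (V :\ x)) (b x).
  have -> : arcs o V = o x + arcs o (V :\ x) by rewrite /arcs (big_setD1 x).
  lia.
(* The flip has used the slack and increased the number of arcs, so it must be followed at once by a
   contraction or by the deletion of the edge [yx], both of which decrease an earlier induction
   parameter. *)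
have S' : boundary_sol k V m o' i' b'.
  case: (tightP k_gt0 H') => [nt'|[A [A1 A2 A3 A4]]].
    apply: (del_step k_gt0 H' nt' IM yV xV yx mxy).
      have [by1 by2] := ht y yV; exists (tau y); last by lia.
      by rewrite /b' (negPf yx) /= mul0r addr0.
    exists (k%:Z - 1)%R; last by lia.
    by case: b'x => q hq; exists (- q - 1)%R; rewrite hq; lia.
  exact: (contract_step k_gt0 H' IV A1 A2 A3 A4).
apply: (sol_arc k_gt0 S').
  move=> v vV; apply: cong2k_eq; rewrite /b' /i' ho; case: (eqVneq v x) => /= _; lia.
move=> v t vV ct tk; rewrite /i' ho; case: (eqVneq v x) => [vx|vx] /=; last by lia.
(* The excess at [x] is k + 1 or 1 - k in the flipped instance; subtracting [c + 1], with [c < k],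
   keeps it within the range. *)
rewrite vx in ct *; have [q hq] := cong2k_trans ct b'x.
have [h|[h|h]] : ((q = 0) \/ (q = -1) \/ (1 <= q) \/ (q <= -2))%R by lia.
- by move: hq; rewrite h; lia.
- by move: hq; rewrite h; lia.
case: h => h.
  have : ((k + k)%:Z <= q * (k + k)%:Z)%R by nia.
  lia.
have : (q * (k + k)%:Z <= -2 * (k + k)%:Z)%R by nia.
lia.
Qed.

(** A usable edge joins opposite signs, a usable arc enters a negative or leaves a positive vertex.
    If there is neither, the two sign classes are not joined and the cut bounds leave only one sign,
    which is the case of [flip_step]. *)
Lemma signed_step V m o i b :
  boundary_inst k V m o i b set0 -> loose_cuts k V m o i b -> solves_fewer_vertices k V -> solves_fewer_edges k V m ->
  solves_fewer_arcs k V m (arcs o V + arcs i V) ->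
  1 < #|V| -> (forall x, x \in V -> dist2k k (b x) != 0) -> boundary_sol k V m o i b.
Proof.
move=> H nt IV IM IA V1 nz; have sm := inst_sym H.
have arco x : x \in V -> 0 < o x -> pos_residue k (- b x)%R -> boundary_sol k V m o i b.
  by move=> xV ox px; apply: (arc_step k_gt0 H nt IA xV).
have arci x : x \in V -> 0 < i x -> pos_residue k (b x) -> boundary_sol k V m o i b.
  move=> xV ix px; apply: (sol_opp k_gt0).
  apply: (arc_step k_gt0 (inst_opp k_gt0 H) (loose_cuts_opp k_gt0 nt) _ xV ix); last by rewrite opprK.
  by rewrite addnC.
have del x y : x \in V -> y \in V -> x != y -> 0 < m x y -> pos_residue k (b x) -> pos_residue k (- b y)%R ->
    boundary_sol k V m o i b by move=> *; apply: (@del_step _ _ k_gt0 V m o i b x y).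
have /fin_all_exists[tau htau] x : exists t, [/\ cong2k k (b x) t, `|t| = dist2k k (b x) & `|t| <= k].
  exact: dist2k_ex.
have tc x : cong2k k (b x) (tau x) by have [] := htau x.
have tn x : `|tau x| = dist2k k (b x) by have [] := htau x.
have tk x : `|tau x| <= k by have [] := htau x.
have t0 x : x \in V -> tau x != 0%R.
  by move=> /nz; rewrite -tn; apply: contraNneq => ->.
have tp x : (0 < tau x)%R -> pos_residue k (b x) by move=> h; exists (tau x) => //; have := tk x; lia.
have tm x : (tau x < 0)%R -> pos_residue k (- b x)%R.
  by move=> h; exists (- tau x)%R; [exact: cong2kN | have := tk x; lia].
have tpm x : x \in V -> (0 < tau x)%R \/ (tau x < 0)%R by move/t0 => h; lia.
(* A vertex of residue k counts for both signs, so any edge or arc at it is usable, and its cut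
   bound provides one. *)
case: (boolP [exists x in V, `|tau x| == k]) => [/exists_inP[x xV /eqP xk]|].
  have [px mx] : pos_residue k (b x) /\ pos_residue k (- b x)%R.
    have [q hq] := tc x; have [h|h] := tpm x xV.
      split; first exact: tp.
      by exists (Posz k); [exists (- q - 1)%R; rewrite hq; lia | lia].
    split; last exact: tm.
    by exists (Posz k); [exists (q - 1)%R; rewrite hq; lia | lia].
  case: (posnP (o x)) => [ox|ox]; last exact: (arco x).
  case: (posnP (i x)) => [ix|ix]; last exact: (arci x).
  have [_ _ _ Vx] := card_complement V1 xV.
  have sx : [set x] \subset V by rewrite sub1set.
  have x0 : [set x] != set0 by apply/set0Pn; exists x; rewrite inE.
  have := inst_iii H sx x0 Vx x0; rewrite cut1 bsum1 ox ix -tn xk.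
  case: (boolP [exists y in V :\ x, 0 < m x y]) => [/exists_inP[y]|].
    rewrite !inE => /andP[yx yV] h _; have [hy|hy] := tpm y yV.
      by apply: (del y x) => //; [rewrite sm | exact: tp].
    by apply: (del x y) => //; [rewrite eq_sym | exact: tm].
  rewrite negb_exists_in => /forall_inP h; rewrite big1; first by lia.
  by move=> y /h; rewrite lt0n negbK => /eqP.
rewrite negb_exists_in => /forall_inP tk'.
have tlt x : x \in V -> `|tau x| < k.
  by move=> xV; rewrite ltn_neqAle tk' // tk.
case: (boolP [exists x in V, (0 < tau x)%R && (0 < i x)]) => [/exists_inP[x xV /andP[h1 h2]]|].
  by apply: (arci x) => //; apply: tp.
rewrite negb_exists_in => /forall_inP hi.
case: (boolP [exists x in V, (tau x < 0)%R && (0 < o x)]) => [/exists_inP[x xV /andP[h1 h2]]|].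
  by apply: (arco x) => //; apply: tm.
rewrite negb_exists_in => /forall_inP ho.
case: (boolP [exists x in V, [exists y in V, [&& (0 < tau x)%R, (tau y < 0)%R & 0 < m x y]]])
  => [/exists_inP[x xV /exists_inP[y yV /and3P[h1 h2 h3]]]|].
  apply: (del x y) => //; [|exact: tp|exact: tm].
  by apply: contraTneq h1 => ->; lia.
rewrite negb_exists_in => /forall_inP hm.
have i0 x : x \in V -> (0 < tau x)%R -> i x = 0.
  by move=> xV h; have := hi x xV; rewrite h /= lt0n negbK => /eqP.
have o0 x : x \in V -> (tau x < 0)%R -> o x = 0.
  by move=> xV h; have := ho x xV; rewrite h /= lt0n negbK => /eqP.
have m0 x y : x \in V -> y \in V -> (0 < tau x)%R -> (tau y < 0)%R -> m x y = 0.
  move=> xV yV h1 h2; have := hm x xV; rewrite negb_exists_in => /forall_inP/(_ y yV).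
  by rewrite h1 h2 /= lt0n negbK => /eqP.
pose P := [set x in V | (0 < tau x)%R].
have PV : P \subset V by apply/subsetP => x; rewrite inE => /andP[].
have [P0|P0] := eqVneq P set0.
  have allneg x : x \in V -> (tau x < 0)%R.
    move=> xV; case: (tpm x xV) => // h; have : x \in P by rewrite inE xV.
    by rewrite P0 inE.
  apply: (sol_opp k_gt0).
  apply: (@flip_step _ _ _ _ _ (fun x => - tau x)%R (inst_opp k_gt0 H) (loose_cuts_opp k_gt0 nt)) => //.
    move=> x xV; split; first exact: cong2kN.
    by have := allneg x xV; have := tlt x xV; lia.
  by move=> x xV; apply: o0 => //; apply: allneg.
have [PE|PN] := eqVneq P V.
  have allpos x : x \in V -> (0 < tau x)%R by rewrite -PE inE => /andP[].
  apply: (@flip_step _ _ _ _ _ tau H nt) => //.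
    move=> x xV; split => //.
    by have := allpos x xV; have := tlt x xV; lia.
  by move=> x xV; apply: i0 => //; apply: allpos.
have QV : V :\: P \subset V by exact: subsetDl.
have Q0 : V :\: P != set0.
  by apply: contraNneq PN => e; rewrite eqEsubset PV /= -setD_eq0 e.
have QN : V :\: P != V.
  apply: contraNneq P0 => e; apply/eqP/setP => x; rewrite in_set0; apply/negP => xP.
  by have := subsetP PV x xP; rewrite -e inE xP.
have inQ x : x \in V :\: P -> x \in V /\ (tau x < 0)%R.
  rewrite inE => /andP[xP xV]; split => //; case: (tpm x xV) => // h.
  by rewrite inE xV h in xP.
have inP' x : x \in P -> x \in V /\ (0 < tau x)%R by rewrite inE => /andP[].
have k2 : 1 < k.
  case/set0Pn: P0 => x /inP'[xV h]; have := tlt x xV; lia.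
(* Both classes are nonempty. Their cuts consist of arcs only, and the two lower bounds add up to 4k
   - 4 plus the distances, exceeding [inst_ii] for k > 1. *)
have := inst_iii H PV P0 PN P0; have := inst_iii H QV Q0 QN Q0; have := inst_ii H.
have := dist2k_add k_gt0 (bsum b P) (bsum b (V :\: P)); rewrite -bsumC //.
rewrite !(arcsC _ PV) /cut.
have -> : cutm V m P = 0.
  rewrite /cutm big1 // => u /inP'[uV hu]; rewrite big1 // => w /inQ[wV hw].
  exact: m0.
have -> : cutm V m (V :\: P) = 0.
  rewrite /cutm big1 // => u /inQ[uV hu]; rewrite big1 // => w wD.
  have wP : w \in P.
    by move: wD; rewrite !inE => /andP[]; case: (w \in V) => //=; rewrite andbT negbK.
  by rewrite sm; have [wV hw] := inP' w wP; apply: m0.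
have -> : arcs i P = 0 by rewrite /arcs big1 // => u /inP'[uV hu]; exact: i0.
have -> : arcs o (V :\: P) = 0 by rewrite /arcs big1 // => u /inQ[uV hu]; exact: o0.
lia.
Qed.

(** Lexicographic induction on vertices, edges, arcs. The arcs come last because contraction and
    flipping may increase their number. *)
Theorem boundary_orientation V m o i b ex : V != set0 -> boundary_inst k V m o i b ex -> boundary_sol k V m o i b.
Proof.
suff L n : forall V, #|V| < n -> V != set0 -> forall M m, mass V m < M ->
    forall a o i b ex, arcs o V + arcs i V < a -> boundary_inst k V m o i b ex -> boundary_sol k V m o i b.
  by move=> V0 H; apply: (L _ V (ltnSn _) V0 _ m (ltnSn _) _ o i b ex (ltnSn _) H).
elim: n => // n IHn {}V Vn V0; elim=> // M IHM0 {}m Mm; elim => // a IHA0 {}o {}i {}b {}ex ha H.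
have IV : solves_fewer_vertices k V.
  move=> V' m' o' i' b' ex' hV' V'0 H'.
  by apply: (IHn V' _ V'0 _ m' (ltnSn _) _ o' i' b' ex' (ltnSn _) H'); lia.
have IM : solves_fewer_edges k V m.
  move=> m' o' i' b' ex' hm' H'.
  by apply: (IHM0 m' _ _ o' i' b' ex' (ltnSn _) H'); lia.
have IA : solves_fewer_arcs k V m (arcs o V + arcs i V).
  by move=> o' i' b' ex' ha' H'; apply: (IHA0 o' i' b' ex' _ H'); lia.
case: (set_cases V0) => [[v Vv]|V1]; first exact: (single_step k_gt0 Vv H).
case: (tightP k_gt0 H) => [nt|[A [A1 A2 A3 A4]]]; last exact: (contract_step k_gt0 H IV A1 A2 A3 A4).
case: (set_0Vmem ex) => [e|[v vex]]; last first.
  have [e _ _] := inst_ex H vex; rewrite e in H.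
  exact: (zero_step k_gt0 H nt IV IM V1).
rewrite e in H.
case: (boolP [exists v in V, dist2k k (b v) == 0]) => [/exists_inP[v vV /eqP bv]|].
  exact: (zero_step k_gt0 (inst_weaken H vV bv) nt IV IM V1).
rewrite negb_exists_in => /forall_inP nz.
exact: signed_step.
Qed.

End Orient.

(** * Re-orienting a rooted digraph *)

Section Digraph.
Variable I : finType.
Implicit Types (V A B S X : {set I}) (D c : I -> I -> nat) (r u v w x y : I).

(** Indegrees and outdegrees of sets are sums over arcs with 0/1 weights, so each cut inequality
    below reduces to one about the weights of a single arc. *)
Definition wsum V D c : nat := \sum_(u in V) \sum_(w in V) D u w * c u w.
Definition din V D S := wsum V D (fun u w => (u \notin S) && (w \in S)).
Definition dout V D S := wsum V D (fun u w => (u \in S) && (w \notin S)).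
Definition unit_arc x y u w : nat := (u == x) && (w == y).

Lemma wsumD V D c c' : wsum V D c + wsum V D c' = wsum V D (fun u w => c u w + c' u w).
Proof.
rewrite /wsum -big_split /=; apply: eq_bigr => u _; rewrite -big_split /=.
by apply: eq_bigr => w _; rewrite mulnDr.
Qed.

Lemma wsum_le V D c c' :
  (forall u w, u \in V -> w \in V -> D u w * c u w <= D u w * c' u w) ->
  wsum V D c <= wsum V D c'.
Proof. by move=> h; apply: leq_sum => u uV; apply: leq_sum => w wV; apply: h. Qed.

Lemma wsum_arc V D x y : x \in V -> y \in V -> wsum V D (unit_arc x y) = D x y.
Proof.
move=> xV yV; rewrite /wsum (bigD1 x) //= (bigD1 y) //= /unit_arc !eqxx muln1.
rewrite big1 ?addn0; last by move=> w /andP[_ /negPf ->]; rewrite andbF muln0.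
rewrite big1 ?addn0 // => u /andP[_ /negPf ->].
by rewrite big1 // => w _; rewrite muln0.
Qed.

Lemma wsum_addD V D D1 D2 c : (forall u w, D u w = D1 u w + D2 u w) ->
  wsum V D c = wsum V D1 c + wsum V D2 c.
Proof.
move=> h; rewrite /wsum -big_split /=; apply: eq_bigr => u _; rewrite -big_split /=.
by apply: eq_bigr => w _; rewrite h mulnDl.
Qed.

Lemma wsum_unit V x y c : x \in V -> y \in V -> wsum V (unit_arc x y) c = c x y.
Proof.
move=> xV yV; rewrite -(wsum_arc c xV yV) /wsum.
by apply: eq_bigr => u _; apply: eq_bigr => w _; rewrite mulnC.
Qed.

Ltac mem_cases := repeat match goal with |- context [?x \in ?A] => case: (x \in A) end.

Lemma din_submod V D A B : din V D (A :&: B) + din V D (A :|: B) <= din V D A + din V D B.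
Proof. by rewrite /din !wsumD; apply: wsum_le => u w _ _; apply: leq_mul => //; rewrite !inE; mem_cases. Qed.

Lemma din_submod_arc V D A B x y : x \in V -> y \in V ->
  x \in B -> x \notin A -> y \in A -> y \notin B ->
  din V D (A :&: B) + din V D (A :|: B) + D x y <= din V D A + din V D B.
Proof.
move=> xV yV xB xA yA yB; rewrite -(wsum_arc D xV yV) /din !wsumD; apply: wsum_le => u w _ _.
rewrite /unit_arc; apply: leq_mul => //; rewrite !inE.
case: (eqVneq u x) => [->|_] /=; last by mem_cases.
case: (eqVneq w y) => [->|_] /=; last by mem_cases.
by rewrite xB (negPf xA) yA (negPf yB).
Qed.

(** It replaces submodularity when two sets meet exactly in [v]: their intersection is then the
    exempt set, for which no lower bound is available. *)
Lemma din_crossing V D A B v y : v \in V -> y \in V -> A :&: B = [set v] ->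
  y \notin A -> y \notin B ->
  din V D (A :\ v) + din V D (B :\ v) + din V D [set v] + D v y <=
  din V D A + din V D B + dout V D [set v].
Proof.
move=> vV yV AB yA yB; rewrite -(wsum_arc D vV yV) /din /dout !wsumD.
have vA : v \in A by have := set11 v; rewrite -AB inE => /andP[].
have vB : v \in B by have := set11 v; rewrite -AB inE => /andP[].
apply: wsum_le => u w _ _; rewrite /unit_arc; apply: leq_mul => //; rewrite !inE.
have e x : (x \in A) && (x \in B) = (x == v) by rewrite -in_setI AB inE.
have := e u; have := e w.
case: (eqVneq u v) => [->|_] /=; rewrite ?vA ?vB;
case: (eqVneq w v) => [->|wv] /=; rewrite ?vA ?vB //=.
- by rewrite (_ : v == y = false) //; apply: contraNF yA => /eqP <-.
- by case: (eqVneq w y) => [->|_] /=; rewrite ?(negPf yA) ?(negPf yB) //; case: (w \in A); case: (w \in B).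
- by case: (u \in A); case: (u \in B).
by case: (u \in A); case: (u \in B); case: (w \in A); case: (w \in B).
Qed.

Lemma din_add_vertex V D A v y : v \in V -> y \in V -> v \notin A -> y \in A ->
  (forall u, u \in V -> u \notin A -> u != v -> D u v = 0) ->
  din V D (v |: A) + D v y <= din V D A.
Proof.
move=> vV yV vA yA h; rewrite -(wsum_arc D vV yV) /din !wsumD.
apply: wsum_le => u w uV wV; rewrite /unit_arc !inE.
case: (eqVneq w v) => [->|wv] /=.
  case: (boolP (u \in A)) => uA /=; rewrite ?orbT /= ?andbF.
    by rewrite (_ : v == y = false) ?andbF //; apply: contraNF vA => /eqP ->.
  case: (eqVneq u v) => [->|uv] /=; last by rewrite h.
  by have /negPf -> /= : v != y; rewrite ?muln0 //; apply: contraNneq vA => ->.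
apply: leq_mul => //; case: (eqVneq u v) => [->|uv] /=; last by case: (u \in A); case: (w \in A).
by rewrite vA /=; case: (eqVneq w y) => [->|_]; rewrite ?yA //; case: (w \in A).
Qed.

Lemma din_del_vertex V D A v y : v \in V -> y \in V -> v \in A -> y \notin A ->
  (forall u, u \in V -> u \in A -> u != v -> D u v = 0) ->
  din V D (A :\ v) + din V D [set v] + D v y <= din V D A + dout V D [set v].
Proof.
move=> vV yV vA yA h; rewrite -(wsum_arc D vV yV) /din /dout !wsumD.
apply: wsum_le => u w uV wV; rewrite /unit_arc !inE.
case: (eqVneq w v) => [->|wv] /=.
  rewrite vA /=; case: (eqVneq u v) => [->|uv] /=.
    by rewrite (_ : v == y = false) ?vA //; apply: contraNF yA => /eqP <-.
  by case: (boolP (u \in A)) => uA //=; rewrite h.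
apply: leq_mul => //; case: (eqVneq u v) => [->|uv] /=.
  by rewrite vA /=; case: (eqVneq w y) => [->|_]; rewrite ?(negPf yA) //; case: (w \in A).
by case: (u \in A); case: (w \in A).
Qed.

(** Splitting-off in the manner of Lovasz and Mader. Replacing the path [u v y] by an arc [uy] costs
    a set one entering arc exactly when it separates [v] from both [u] and [y]; the two indicators
    say that such a set has an arc to spare. [u = y] is allowed. *)
Lemma one_lift V D r v y l : v \in V -> y \in V -> v != r -> y != v -> 0 < D v y ->
  dout V D [set v] <= din V D [set v] ->
  (forall S, S \subset V -> S != set0 -> r \notin S -> S != [set v] -> l <= din V D S) ->
  exists u, [/\ u \in V, u != v, 0 < D u v &
    forall S, S \subset V -> S != set0 -> r \notin S -> S != [set v] ->
    l + [&& v \in S, u \notin S & y \notin S] + [&& v \notin S, u \in S & y \in S] <= din V D S].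
Proof.
move=> vV yV vr yv Dvy dv dS.
(* Tight sets containing [v] but not [y] must contain [u]; tight sets containing [y] but not [v]
   must avoid it. *)
pose Y := [pred S : {set I} | [&& S \subset V, r \notin S, S != [set v], v \in S, y \notin S & din V D S <= l]].
pose X := [pred S : {set I} | [&& S \subset V, r \notin S, v \notin S, y \in S & din V D S <= l]].
suff [u [uV uv Duv uY uX]] : exists u, [/\ u \in V, u != v, 0 < D u v,
    forall S, Y S -> u \in S & forall S, X S -> u \notin S].
  exists u; split => // S SV S0 rS Sv; have := dS S SV S0 rS Sv.
  have := uY S; have := uX S; rewrite /= SV rS Sv /=.
  case: (boolP (v \in S)) => vS; case: (boolP (u \in S)) => uS; case: (boolP (y \in S)) => yS /=;
    rewrite ?addn0 ?addn1 // => h1 h2 h3.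
    by rewrite ltnNge; apply/negP => h4; have := h2 h4.
  by rewrite ltnNge; apply/negP => h4; have := h1 h4.
(* The arc [vy] runs from [B] to [A] and strengthens submodularity by [D v y], which two tight sets
   cannot afford. *)
have XY A B : X A -> Y B -> A :&: B = set0.
  move=> /and5P[AV rA vA yA tA] /and5P[BV rB Bv vB /andP[yB tB]].
  apply/eqP; apply: contraT => AB.
  have := din_submod_arc D vV yV vB vA yA yB.
  have h1 : l <= din V D (A :&: B).
    apply: dS => //; first by apply: subset_trans AV; exact: subsetIl.
      by rewrite inE (negPf rA).
    by apply/eqP => e; have := set11 v; rewrite -e inE (negPf vA).
  have h2 : l <= din V D (A :|: B).
    apply: dS; first by rewrite subUset AV.
    - by apply/set0Pn; exists y; rewrite inE yA.
    - by rewrite inE negb_or rA.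
    apply/eqP => e; have : y \in [set v] by rewrite -e inE yA.
    by rewrite inE (negPf yv).
  by move: Dvy tA tB h1 h2; clear; lia.
case: (boolP [exists S, Y S]) => [/existsP[Y1 hY1]|noY].
  (* The least set of type [Y] lies in all of them, hence any tail [u] in it serves, and it avoids
     all sets of type [X]. If no arc came from it to [v], removing [v] from it would leave too small
     an indegree, as [out <= in] at [v]. *)
  have [Y0 /minsetP[hY0 minY] _] := minset_exists hY1.
  have /and5P[YV rY Yv vY /andP[yY tY]] := hY0.
  have sub B : Y B -> Y0 \subset B.
    move=> hB; have /and5P[BV rB Bv vB /andP[yB tB]] := hB.
    apply/setIidPl; apply: minY; last exact: subsetIl.
    have h2 : l <= din V D (Y0 :|: B).
      apply: dS; first by rewrite subUset YV.
      - by apply/set0Pn; exists v; rewrite inE vY.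
      - by rewrite inE negb_or rY.
      apply: contra_neq Yv => e; apply/eqP; rewrite eqEsubset sub1set vY andbT.
      by rewrite -e subsetUl.
    have IV : Y0 :&: B \subset V by apply: subset_trans YV; exact: subsetIl.
    have [e|ne] := eqVneq (Y0 :&: B) [set v]; last first.
      rewrite /= IV !inE (negPf rY) ne vY vB (negPf yY) /=.
      by move: (din_submod V D Y0 B) tY tB h2; clear; lia.
    have := din_crossing D vV yV e yY yB.
    have dP A : A \subset V -> r \notin A -> v \in A -> A != [set v] -> l <= din V D (A :\ v).
      move=> AV rA vA Av; apply: dS.
      - by apply: subset_trans AV; exact: subD1set.
      - apply: contraNneq Av => e0; rewrite -(setD1K vA) e0 setU0 //.
      - by rewrite !inE (negPf rA) andbF.
      by apply/eqP => e0; have := setD11 v A; rewrite e0 set11.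
    move: (dP Y0 YV rY vY Yv) (dP B BV rB vB Bv) dv tY tB Dvy; clear; lia.
  have [u uV [uY uv Duv]] : exists2 u, u \in V & [/\ u \in Y0, u != v & 0 < D u v].
    case: (boolP [exists u in V, [&& u \in Y0, u != v & 0 < D u v]]) => [/exists_inP[u uV /and3P[]]|].
      by exists u.
    rewrite negb_exists_in => /forall_inP h.
    have := @din_del_vertex V D Y0 v y vV yV vY yY.
    have h0 : forall u, u \in V -> u \in Y0 -> u != v -> D u v = 0.
      by move=> u uV uY uv; have := h u uV; rewrite uY uv /= lt0n negbK => /eqP.
    move=> /(_ h0).
    have : l <= din V D (Y0 :\ v).
      apply: dS.
      - by apply: subset_trans YV; exact: subD1set.
      - apply: contraNneq Yv => e0; rewrite -(setD1K vY) e0 setU0 //.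
      - by rewrite !inE (negPf rY) andbF.
      by apply/eqP => e0; have := setD11 v Y0; rewrite e0 set11.
    by move: tY Dvy dv; clear; lia.
  exists u; split => // S hS; first by apply: (subsetP (sub S hS)).
  apply/negP => uS; have : u \in S :&: Y0 by rewrite inE uS.
  by rewrite XY // inE.
have nY S : Y S -> False by move=> hS; case/negP: noY; apply/existsP; exists S.
case: (boolP [exists S, X S]) => [/existsP[X1 hX1]|noX].
  (* Dually, the greatest set of type [X] contains all others. Some arc enters [v] from outside it,
     since otherwise adding [v] would lower the indegree by [D v y]. *)
  have [X0 /maxsetP[hX0 maxX] _] := maxset_exists hX1.
  have /and5P[XV rX vX yX tX] := hX0.
  have sub B : X B -> B \subset X0.
    move=> hB; have /and5P[BV rB vB yB tB] := hB.
    apply/setUidPl; apply: maxX; last exact: subsetUl.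
    rewrite /= subUset XV BV !inE !negb_or rX rB vX vB yX /=.
    have : l <= din V D (X0 :&: B).
      apply: dS; first by apply: subset_trans XV; exact: subsetIl.
      - by apply/set0Pn; exists y; rewrite inE yX.
      - by rewrite inE (negPf rX).
      by apply/eqP => e; have := set11 v; rewrite -e inE (negPf vX).
    by move: (din_submod V D X0 B) tX tB; clear; lia.
  have [u uV [uX uv Duv]] : exists2 u, u \in V & [/\ u \notin X0, u != v & 0 < D u v].
    case: (boolP [exists u in V, [&& u \notin X0, u != v & 0 < D u v]]) => [/exists_inP[u uV /and3P[]]|].
      by exists u.
    rewrite negb_exists_in => /forall_inP h.
    have h0 : forall u, u \in V -> u \notin X0 -> u != v -> D u v = 0.
      by move=> u uV uX uv; have := h u uV; rewrite uX uv /= lt0n negbK => /eqP.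
    have := din_add_vertex vV yV vX yX h0.
    have : l <= din V D (v |: X0).
      apply: dS; first by rewrite subUset sub1set vV.
      - by apply/set0Pn; exists v; rewrite !inE eqxx.
      - by rewrite !inE negb_or eq_sym vr.
      apply/eqP => e; have : y \in [set v] by rewrite -e !inE yX orbT.
      by rewrite inE (negPf yv).
    by move: tX Dvy; clear; lia.
  exists u; split => // S hS; first by case: (nY S).
  by apply/negP => /(subsetP (sub S hS)); exact/negP.
have [u uV [uv Duv]] : exists2 u, u \in V & u != v /\ 0 < D u v.
  case: (boolP [exists u in V, (u != v) && (0 < D u v)]) => [/exists_inP[u uV /andP[]]|].
    by exists u.
  rewrite negb_exists_in => /forall_inP h.
  have d0 : din V D [set v] <= 0.
    rewrite /din /wsum leqn0; apply/eqP; rewrite big1 // => u uV; rewrite big1 // => w _.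
    rewrite !inE; case: (eqVneq w v) => [->|]; last by rewrite andbF muln0.
    by have := h u uV; case: (u != v) => //=; rewrite ?muln0 // lt0n negbK => /eqP ->.
  have : D v y <= dout V D [set v].
    rewrite -(wsum_arc D vV yV); apply: wsum_le => u w _ _; apply: leq_mul => //.
    by rewrite /unit_arc !inE; case: (u == v) => //=; case: eqP => [->|]; rewrite ?yv.
  by move: Dvy d0 dv; clear; lia.
exists u; split => // S hS; first by case: (nY S).
by case/negP: noX; apply/existsP; exists S.
Qed.

End Digraph.

Section DigraphNet.
Variable I : finType.
Implicit Types (V A B S X : {set I}) (D c : I -> I -> nat) (r u v w x y : I).

Lemma sum_sub V S (F : I -> nat) : S \subset V ->
  \sum_(u in V) F u * (u \in S) = \sum_(u in S) F u.
Proof.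
move=> SV; rewrite (big_setID S) (setIidPr SV) /= [X in _ + X]big1 ?addn0.
  by apply: eq_bigr => u ->; rewrite muln1.
by move=> u; rewrite inE => /andP[/negPf -> _]; rewrite muln0.
Qed.

Lemma dout_cutm V D S : S \subset V -> dout V D S = cutm V D S.
Proof.
move=> SV; rewrite /dout /wsum /cutm -(sum_sub _ SV); apply: eq_bigr => u uV.
rewrite -(sum_sub _ (subsetDl V S)) big_distrl /=; apply: eq_bigr => w wV.
by rewrite inE wV andbT -mulnA mulnb andbC.
Qed.

Lemma din_cutm V D S : S \subset V -> din V D S = cutm V (fun u w => D w u) S.
Proof.
move=> SV; rewrite -dout_cutm // /dout /din /wsum exchange_big /=.
by apply: eq_bigr => u _; apply: eq_bigr => w _; rewrite andbC.
Qed.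

Lemma cutm_sym V D S : S \subset V ->
  cutm V (fun u w => D u w + D w u) S = dout V D S + din V D S.
Proof.
by move=> SV; rewrite dout_cutm // din_cutm //; apply: cutmD.
Qed.

Lemma bsum_net V D S : S \subset V ->
  (bsum (net V D) S = (dout V D S)%:Z - (din V D S)%:Z)%R.
Proof.
move=> SV.
have -> : (bsum (net V D) S = (\sum_(u in S) \sum_(w in V) D u w)%N%:Z
            - (\sum_(u in S) \sum_(w in V) D w u)%N%:Z)%R.
  rewrite /bsum !sumZ -sumrB; apply: eq_bigr => u _; rewrite /net !sumZ -sumrB.
  by [].
have -> : \sum_(u in S) \sum_(w in V) D u w = dout V D S + \sum_(u in S) \sum_(w in S) D u w.
  rewrite dout_cutm // /cutm -big_split /=; apply: eq_bigr => u _.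
  by rewrite (big_setID S) (setIidPr SV) addnC.
have -> : \sum_(u in S) \sum_(w in V) D w u = din V D S + \sum_(u in S) \sum_(w in S) D w u.
  rewrite din_cutm // /cutm -big_split /=; apply: eq_bigr => u _.
  by rewrite (big_setID S) (setIidPr SV) addnC.
rewrite [X in (_ - (_ + X)%N%:Z)%R]exchange_big /=; lia.
Qed.

Lemma net_deg V D v : v \in V -> (net V D v = (dout V D [set v])%:Z - (din V D [set v])%:Z)%R.
Proof. by move=> vV; rewrite -bsum_net ?sub1set // bsum1. Qed.


Lemma dout_cmat (h : I -> I) V D X : X \subset h @: V ->
  dout (h @: V) (cmat h V D) X = dout V D (expand h V X).
Proof. by move=> XV; rewrite !dout_cutm ?cutm_cmat // expand_sub. Qed.

Lemma eq_cutm V m m' S : (forall u w, m u w = m' u w) -> cutm V m S = cutm V m' S.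
Proof. by move=> e; apply: eq_bigr => u _; apply: eq_bigr => w _. Qed.

Lemma cmat_tr (h : I -> I) V D u w : cmat h V (fun u w => D w u) u w = cmat h V D w u.
Proof. by rewrite /cmat exchange_big. Qed.

Lemma din_cmat (h : I -> I) V D X : X \subset h @: V ->
  din (h @: V) (cmat h V D) X = din V D (expand h V X).
Proof.
move=> XV; rewrite !din_cutm ?expand_sub // -cutm_cmat.
by apply: eq_cutm => u w; rewrite cmat_tr.
Qed.

Lemma net_cmat (h : I -> I) V D u : u \in h @: V ->
  net (h @: V) (cmat h V D) u = bsum (net V D) (expand h V [set u]).
Proof.
move=> uV; rewrite net_deg // dout_cmat ?sub1set // din_cmat ?sub1set //.
by rewrite bsum_net // expand_sub.
Qed.

Lemma mass_addp V D x y : x \in V -> y \in V -> mass V (addp D x y) = mass V D + 1.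
Proof.
move=> xV yV; rewrite (@massD _ V _ D (unit_arc x y)) //; congr (_ + _).
by rewrite /mass /unit_arc sum_ind2 xV yV.
Qed.

Lemma din_addp V D x y S : x \in V -> y \in V ->
  din V (addp D x y) S = din V D S + ((x \notin S) && (y \in S)).
Proof.
move=> xV yV; rewrite /din (@wsum_addD _ V _ D (unit_arc x y)) //.
by rewrite wsum_unit.
Qed.

Lemma eq_wsum V D D' c : (forall u w, D u w = D' u w) -> wsum V D c = wsum V D' c.
Proof. by move=> e; apply: eq_bigr => u _; apply: eq_bigr => w _; rewrite e. Qed.

Lemma eq_mass V D D' : (forall u w, D u w = D' u w) -> mass V D = mass V D'.
Proof. by move=> e; apply: eq_bigr => u _; apply: eq_bigr => w _; rewrite e. Qed.

Lemma addp_sym D x y u w : addp D x y u w + addp D x y w u = D u w + D w u + eps x y u w.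
Proof. by rewrite /addp /eps [(w == x) && _]andbC; lia. Qed.

End DigraphNet.

(** * Windows for residues *)

Section Window.
Variable k : nat.
Definition even_diff (x y : int) := exists q : int, (x = y + 2 * q)%R.

Lemma cong2k_even x y : cong2k k x y -> even_diff x y.
Proof. by case=> q ->; exists (q * k%:Z)%R; lia. Qed.

Hypothesis k_gt0 : 0 < k.

(** The intervals from [- d] to [d] and from [lam] to [eta] meet. The shortest representative lies
    in the first; it is shifted towards the second by the largest multiple of 2k that does not pass
    [lam] or [eta]. The remainder is even, hence at most 2k - 2. *)
Lemma window (d b lam eta : int) :
  ((dist2k k b)%:Z <= d)%R -> even_diff b d -> even_diff lam d -> even_diff eta d ->
  (lam <= d)%R -> (- d <= eta)%R -> (lam <= eta)%R ->
  exists t : int, [/\ cong2k k t b, (- d <= t <= d)%R, (lam <= t + (k + k)%:Z - 2)%R &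
    (t <= eta + (k + k)%:Z - 2)%R].
Proof.
move=> hb [q1 h1] [q2 h2] [q3 h3] hl he hle.
have [t [bt tn tk]] := dist2k_ex k_gt0 b.
have [q4 h4] := cong2k_even bt.
have [hl'|hl'] := leP lam (t + (k + k)%:Z - 2)%R; last first.
  have e := divz_eq (lam - t)%R (k + k)%:Z.
  have e1 : (0 <= ((lam - t)%R %% (k + k)%:Z)%Z)%R by apply: modz_ge0; lia.
  have e2 : (((lam - t)%R %% (k + k)%:Z)%Z < (k + k)%:Z)%R by apply: ltz_pmod; lia.
  move: e e1 e2; set Q := (_ %/ _)%Z; set M := (_ %% _)%Z => e e1 e2.
  have Q0 : (0 <= Q * (k + k)%:Z)%R.
    have [//|] := leP 0%R Q; first by move=> *; nia.
    move=> Qn; have : (Q * (k + k)%:Z <= - (k + k)%:Z)%R by nia.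
    lia.
  exists (t + Q * (k + k)%:Z)%R; split; try lia.
  by case: bt => q hq; exists (Q - q)%R; lia.
have [he'|he'] := leP t (eta + (k + k)%:Z - 2)%R.
  by exists t; split => //; [exact: cong2k_sym | lia].
have e := divz_eq (t - eta)%R (k + k)%:Z.
have e1 : (0 <= ((t - eta)%R %% (k + k)%:Z)%Z)%R by apply: modz_ge0; lia.
have e2 : (((t - eta)%R %% (k + k)%:Z)%Z < (k + k)%:Z)%R by apply: ltz_pmod; lia.
move: e e1 e2; set Q := (_ %/ _)%Z; set M := (_ %% _)%Z => e e1 e2.
have Q0 : (0 <= Q * (k + k)%:Z)%R.
  have [//|] := leP 0%R Q; first by move=> *; nia.
  move=> Qn; have : (Q * (k + k)%:Z <= - (k + k)%:Z)%R by nia.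
  lia.
exists (t - Q * (k + k)%:Z)%R; split; try lia.
by case: bt => q hq; exists (- Q - q)%R; lia.
Qed.

(* With [d = -net], a value reached by [boundary_orientation] already lies in the window. *)
Lemma small_window (t d b : int) : cong2k k t b -> (`|t| < k + k) -> even_diff b d ->
  ((d < (dist2k k b)%:Z)%R \/ (d <= 0)%R) -> (`|t|%N%:Z + d <= (k + k)%:Z - 2)%R.
Proof.
move=> tb tk [q hq] head; have := dist2k_lt k_gt0 (ltnW tk); rewrite (dist2k_cg k_gt0 tb) => h.
have [q' hq'] := cong2k_even tb.
case: head => head; lia.
Qed.

End Window.

(** * Reductions for rooted digraphs: splitting off and arcs at the root *)

Section Reorient.
Variables (I : finType) (k : nat).
Hypothesis k_gt0 : 0 < k.
Implicit Types (V A B S X ex : {set I}) (D p : I -> I -> nat) (r u v w x y : I).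
Implicit Types (b lam eta : I -> int).

(* [net V D] is [out - in] for the given orientation [D], so [lam] and [eta] are
   twice the lower and upper bounds of the outdegree, minus the degree.  [ex] is
   empty or a single vertex that is exempt from the cut condition because it is
   being split off.  The diagonal of [D] plays no role. *)
Record rooted_inst V r D b lam eta ex : Prop := XInst {
  xi_r : r \in V;
  xi_par : forall v, v \in V -> [/\ even_diff (b v) (net V D v),
    even_diff (lam v) (net V D v) & even_diff (eta v) (net V D v)];
  xi_tot : cong2k k (bsum b V) 0%R;
  xi_cut : forall S, S \subset V -> S != set0 -> r \notin S -> S != ex ->
    k + k <= din V D S + 2;
  xi_bnd : forall v, v \in V ->
    [/\ lam v <= - net V D v, net V D v <= eta v & lam v <= eta v]%R;
  xi_ex : forall x, x \in ex ->
    [/\ ex = [set x], x \in V, x != r & (dist2k k (b x))%:Z <= - net V D x]%R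
}.

Definition rooted_sol V D b lam eta := exists p,
  pairs V p (fun u w => D u w + D w u) /\
  forall v, v \in V -> [/\ cong2k k (net V p v) (b v),
    lam v <= net V p v + (k + k)%:Z - 2 & net V p v <= eta v + (k + k)%:Z - 2]%R.

Definition reorients_fewer_vertices V := forall V' r D b lam eta ex, #|V'| < #|V| ->
  rooted_inst V' r D b lam eta ex -> rooted_sol V' D b lam eta.
Definition reorients_fewer_arcs V D0 := forall r D b lam eta ex, mass V D < mass V D0 ->
  rooted_inst V r D b lam eta ex -> rooted_sol V D b lam eta.

Lemma din_ext V D D' S : (forall u w, D u w = D' u w) -> din V D S = din V D' S.
Proof. exact: eq_wsum. Qed.

(** The hypothesis on the exempt vertex gives [out <= in] there, as [one_lift] requires; the net
    values, and thus all bounds, are unchanged by the lifting. *)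
Lemma xlift_step V r D b lam eta v y : rooted_inst V r D b lam eta [set v] -> reorients_fewer_arcs V D ->
  y \in V -> y != v -> 0 < D v y -> rooted_sol V D b lam eta.
Proof.
move=> H IH yV yv Dvy.
have [_ vV vr hv] := xi_ex H (set11 v).
have [u [uV uv Duv hS]] : exists u, [/\ u \in V, u != v, 0 < D u v &
    forall S, S \subset V -> S != set0 -> r \notin S -> S != [set v] ->
    (k + k - 2) + [&& v \in S, u \notin S & y \notin S] +
      [&& v \notin S, u \in S & y \in S] <= din V D S].
  apply: one_lift => //.
    by move: hv; rewrite net_deg //; clear; lia.
  by move=> S SV S0 rS Sv; have := xi_cut H SV S0 rS Sv; clear; lia.
have [D1 hD1] := subp Dvy.
have [D0 hD0] : exists D0, forall a c, D1 a c = addp D0 u v a c.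
  by apply: subp; move: Duv; rewrite hD1 /addp (negPf uv) addn0.
have hD a c : D a c = addp (addp D0 u v) v y a c.
  by rewrite hD1 /addp hD0.
have netD a : net V (addp D0 u y) a = net V D a.
  by rewrite (net_ext _ _ hD) !net_addp //; clear; lia.
have dinD S : din V D S + ((u \notin S) && (y \in S)) =
    din V (addp D0 u y) S + ((u \notin S) && (v \in S)) + ((v \notin S) && (y \in S)).
  by rewrite (din_ext _ _ hD) !din_addp //; clear; lia.
have [p [hp hpt]] : rooted_sol V (addp D0 u y) b lam eta.
  apply: (IH r _ _ _ _ [set v]).
    by rewrite (eq_mass _ hD) !mass_addp //; clear; lia.
  split.
  - exact: (xi_r H).
  - by move=> a; rewrite netD; exact: (xi_par H).
  - exact: (xi_tot H).
  - move=> S SV S0 rS Sv; have := hS S SV S0 rS Sv; have := dinD S.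
    by case: (u \in S); case: (v \in S); case: (y \in S) => /=; move: k_gt0; clear; lia.
  - by move=> a; rewrite netD; exact: (xi_bnd H).
  by move=> a; rewrite netD; exact: (xi_ex H).
suff [p' [h1 h2]] : exists p', pairs V p' (fun a c => D a c + D c a) /\
    forall a, net V p' a = net V p a.
  by exists p'; split => // a aV; rewrite h2; exact: hpt.
have vu : v != u by rewrite eq_sym.
have hm a c : D a c + D c a = (D0 a c + D0 c a) + eps u v a c + eps v y a c.
  by rewrite !hD addp_sym addp_sym.
have [uy|uy] := eqVneq u y.
  apply: (double_pairs (u := u) (v := v) uV vV uv (m' := fun a c => D0 a c + D0 c a)).
    by move=> a c; rewrite hm -uy [eps v u a c]addnC.
  move=> a c aV cV ac; rewrite hp // addp_sym -uy /eps.
  case: (eqVneq a u) => [au|_]; last by rewrite addn0.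
  by rewrite -au eq_sym (negPf ac) !addn0.
apply: (lift_pairs uV vV yV uv _ uy hm); first by rewrite eq_sym.
by move=> a c aV cV ac; rewrite hp // addp_sym.
Qed.

Lemma net_D1 V p v u : v \in V ->
  (net V p u = (p u v)%:Z - (p v u)%:Z + net (V :\ v) p u)%R.
Proof. by move=> vV; rewrite /net (big_setD1 v). Qed.

(** With no outgoing arc, [v] has indegree [- net V D v] and its edges can realise every value of
    the right parity up to that size; [xi_bnd] and [xi_ex] are the hypotheses of [window]. Deleting
    [v] removes no arc entering a set that avoids it. *)
Lemma xdel_step V r D b lam eta v : rooted_inst V r D b lam eta [set v] -> reorients_fewer_vertices V ->
  (forall y, y \in V -> y != v -> D v y = 0) -> rooted_sol V D b lam eta.
Proof.
move=> H IH Dv.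
have [_ vV vr hv] := xi_ex H (set11 v).
have netv : (net V D v = - (\sum_(u in V :\ v) D u v)%N%:Z)%R.
  rewrite (net_D1 _ _ vV) subrr add0r /net !sumZ -sumrN; apply: eq_bigr => u.
  by rewrite !inE => /andP[uv uV]; rewrite Dv // sub0r.
have [bp lp ep] := xi_par H vV; have [lb eb leb] := xi_bnd H vV.
set d := \sum_(u in V :\ v) D u v in netv.
have [t [tb td tail te]] : exists t : int, [/\ cong2k k t (b v), (- d%:Z <= t <= d%:Z)%R,
    (lam v <= t + (k + k)%:Z - 2)%R & (t <= eta v + (k + k)%:Z - 2)%R].
  have ed (z : int) : even_diff z (net V D v) -> even_diff z d%:Z.
    by rewrite netv => [[q ->]]; exists (q - d%:Z)%R; clear; lia.
  move: hv lb eb; rewrite netv opprK => hv lb eb.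
  by apply: window => //; apply: ed.
have [Y hY] : exists Y : nat, (t = 2 * Y%:Z - d%:Z)%R.
  case: (cong2k_even tb) => q1 h1; case: bp => q2 h2; rewrite netv in h2.
  exists `|(q2 + q1)%R|; move: td h1 h2; clear; lia.
have [yy yD yY] : exists2 q : I -> nat, (forall u, q u <= D u v) & \sum_(u in V :\ v) q u = Y.
  by apply: distribute; rewrite -/d; move: td hY; clear; lia.
(* With [yy u] of the edges directed from [v] to [u], [sh u] is their net contribution at [u]. It is
   at most [D u v] in absolute value, the amount by which [net] drops at [u], so [xi_bnd]
   survives. *)
pose sh u := ((D u v)%:Z - 2 * (yy u)%:Z)%R.
pose b' u := (b u - sh u)%R; pose lam' u := (lam u - sh u)%R; pose eta' u := (eta u - sh u)%R.
have netD u : u \in V -> u != v -> (net (V :\ v) D u = net V D u - (D u v)%:Z)%R.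
  by move=> uV uv; rewrite (net_D1 D u vV) Dv //; clear; lia.
have [p [hp hpt]] : rooted_sol (V :\ v) D b' lam' eta'.
  apply: (IH _ r _ _ _ _ set0); first by rewrite [X in _ < X](cardsD1 v) vV.
  split.
  - by rewrite !inE eq_sym vr (xi_r H).
  - move=> u; rewrite !inE => /andP[uv uV]; have [[q1 h1] [q2 h2] [q3 h3]] := xi_par H uV.
    rewrite netD // /b' /lam' /eta' /sh; split; [exists (q1 + (yy u)%:Z)%R|exists (q2 + (yy u)%:Z)%R|exists (q3 + (yy u)%:Z)%R]; move: h1 h2 h3; clear; lia.
  - have := xi_tot H.
    have -> : bsum b V = (b v + bsum b (V :\ v))%R by rewrite /bsum (big_setD1 v).
    have -> : bsum b' (V :\ v) = (bsum b (V :\ v) - (d%:Z - 2 * Y%:Z))%R.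
      rewrite /b' /bsum sumrB; congr (_ - _)%R; rewrite /sh sumrB /d -yY !sumZ; congr (_ - _)%R.
      by rewrite big_distrr.
    by case: tb => q1 h1 [q2 h2]; exists (q1 + q2)%R; move: hY h1 h2; clear; lia.
  - move=> S SV S0 rS _.
    have SV' : S \subset V by apply: subset_trans SV (subD1set _ _).
    have vS : v \notin S by apply/negP => /(subsetP SV); rewrite !inE eqxx.
    have -> : din (V :\ v) D S = din V D S.
      rewrite !din_cutm // /cutm; apply: eq_bigr => u uS.
      have := subsetP SV u uS; rewrite !inE => /andP[uv uV].
      rewrite [RHS](big_setD1 v) ?inE ?vS //= Dv // add0n; apply: eq_bigl => w.
      by rewrite !inE; case: (w == v); rewrite ?andbF.
    apply: (xi_cut H) => //; apply: contraNneq vS => ->; exact: set11.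
  - move=> u; rewrite !inE => /andP[uv uV]; have [h1 h2 h3] := xi_bnd H uV.
    by rewrite netD // /lam' /eta' /sh; split; move: h1 h2 h3 (yD u); clear; lia.
  by move=> x; rewrite inE.
pose P u w := if u == v then (if w == v then 0 else yy w)
              else (if w == v then D u v - yy u else p u w).
have netP u : u \in V -> u != v -> (net V P u = net (V :\ v) p u + sh u)%R.
  move=> uV uv; rewrite (net_D1 P u vV) addrC; congr (_ + _)%R.
    rewrite /net; apply: eq_bigr => w; rewrite !inE /P => /andP[/negPf -> _].
    by rewrite (negPf uv).
  by rewrite /P /sh eqxx (negPf uv); move: (yD u); clear; lia.
have netPv : net V P v = t.
  rewrite (net_D1 P v vV) subrr add0r /net hY.
  rewrite (eq_bigr (fun w => 2 * (yy w)%:Z - (D w v)%:Z)%R); last first.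
    by move=> w; rewrite !inE /P eqxx => /andP[/negPf -> _]; move: (yD w); clear; lia.
  by rewrite sumrB /d -yY !sumZ big_distrr.
exists P; split.
  move=> u w uV wV uw; rewrite /P.
  case: (eqVneq u v) => [uv|uv]; case: (eqVneq w v) => [wv|wv].
  - by rewrite uv wv eqxx in uw.
  - by rewrite uv Dv // add0n subnKC.
  - by rewrite wv Dv // addn0 subnK.
  by rewrite hp // !inE ?uv ?wv.
move=> u uV; case: (eqVneq u v) => [->|uv]; first by rewrite netPv.
rewrite netP //; have := hpt u; rewrite !inE uv => /(_ uV)[[q h1] h2 h3].
rewrite /b' /lam' /eta' in h1 h2 h3; split; [exists q | |]; move: h1 h2 h3; clear; lia.
Qed.

(** An arc into the root enters no set avoiding the root, so it can be deleted freely. It is finally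
    directed from [s] to [t], whichever way the root still has room for in its bounds. *)
Lemma root_arc V r D b lam eta a s t : rooted_inst V r D b lam eta set0 -> reorients_fewer_arcs V D ->
  a \in V -> a != r -> 0 < D a r ->
  ([/\ s = a, t = r & lam r + 2 <= - net V D r]%R \/
   [/\ s = r, t = a & net V D r + 2 <= eta r]%R) ->
  rooted_sol V D b lam eta.
Proof.
move=> H IH aV ar Dar hst; have rV := xi_r H.
have [D0 hD] := subp Dar.
have netD u : (net V D0 u = net V D u - (u == a)%:Z + (u == r)%:Z)%R.
  by rewrite (net_ext _ _ hD) net_addp //; clear; lia.
pose sh u := ((u == s)%:Z - (u == t)%:Z)%R.
have st : (s \in V) && (t \in V) && (s != t).
  by case: hst => [[-> -> _]|[-> -> _]]; rewrite aV rV // eq_sym.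
have [sV tV stn] : [/\ s \in V, t \in V & s != t] by case/andP: st => /andP[].
have shE u : (sh u = (u == a)%:Z - (u == r)%:Z \/ sh u = (u == r)%:Z - (u == a)%:Z)%R.
  by rewrite /sh; case: hst => [[-> -> _]|[-> -> _]]; [left | right].
have shr : ((sh r = -1 /\ lam r + 2 <= - net V D r) \/ (sh r = 1 /\ net V D r + 2 <= eta r))%R.
  by rewrite /sh; case: hst => [[-> -> h]|[-> -> h]]; [left | right]; rewrite eqxx eq_sym (negPf ar).
pose b' u := (b u - sh u)%R; pose lam' u := (lam u - sh u)%R; pose eta' u := (eta u - sh u)%R.
have [p [hp hpt]] : rooted_sol V D0 b' lam' eta'.
  apply: (IH r _ _ _ _ set0); first by rewrite (eq_mass _ hD) mass_addp //; clear; lia.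
  split => //.
  - move=> u uV; have [[q1 h1] [q2 h2] [q3 h3]] := xi_par H uV.
    rewrite netD /b' /lam' /eta'; move: h1 h2 h3 (shE u).
    case: (eqVneq u a); case: (eqVneq u r) => _ _ h1 h2 h3 /= hs; clear -h1 h2 h3 hs;
      case: hs => ->; split;
      first [by exists q1; lia | by exists q2; lia | by exists q3; lia
            |by exists (q1 + 1)%R; lia | by exists (q2 + 1)%R; lia | by exists (q3 + 1)%R; lia
            |by exists (q1 - 1)%R; lia | by exists (q2 - 1)%R; lia | by exists (q3 - 1)%R; lia].
  - suff -> : bsum b' V = bsum b V by exact: (xi_tot H).
    rewrite (@bsum_move _ b b' s t V) ?sV ?tV; last by move=> u; rewrite /b' /sh; clear; lia.
    by clear; lia.
  - move=> S SV S0 rS Se; have := xi_cut H SV S0 rS Se.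
    by rewrite (din_ext _ _ hD) din_addp // (negPf rS) andbF addn0.
  - move=> u uV; have [h1 h2 h3] := xi_bnd H uV; rewrite netD /lam' /eta'.
    case: (eqVneq u r) => [ur|ur]; last first.
      by move: h1 h2 h3 (shE u); rewrite (negPf ur); case: (u == a) => /=; clear; case=> ? ? ? [] ->; split; lia.
    by move: h1 h2 h3 shr; rewrite ur [r == a]eq_sym (negPf ar) /=; clear; split; lia.
  by move=> x; rewrite inE.
exists (addp p s t); split.
  move=> u w uV wV uw; rewrite !hD addpE // hp // addp_sym; congr (_ + _).
  by case: hst => [[-> -> _]|[-> -> _]] //; rewrite /eps addnC.
move=> u uV; have [[q h1] h2 h3] := hpt u uV; rewrite net_addp //.
rewrite /b' /lam' /eta' /sh in h1 h2 h3.
by split; [exists q | |]; move: h1 h2 h3; clear; lia.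
Qed.

(** By parity a bound without room two is attained; both attained would give
    [lam r = - net > net = eta r]. *)
Lemma root_step V r D b lam eta : rooted_inst V r D b lam eta set0 -> reorients_fewer_arcs V D ->
  (net V D r < 0)%R -> rooted_sol V D b lam eta.
Proof.
move=> H IH neg; have rV := xi_r H.
have [a aV [ar Dar]] : exists2 a, a \in V & a != r /\ 0 < D a r.
  case: (boolP [exists a in V, (a != r) && (0 < D a r)]) => [/exists_inP[a aV /andP[]]|].
    by exists a.
  rewrite negb_exists_in => /forall_inP h; move: neg; rewrite /net ltNge sumr_ge0 //.
  move=> w wV; have := h w wV; case: (eqVneq w r) => [-> _|wr] /=; first by clear; lia.
  by rewrite lt0n negbK => /eqP ->; clear; lia.
have [l1 e1 le1] := xi_bnd H rV; have [_ [q2 h2] [q3 h3]] := xi_par H rV.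
have [h|h] : (lam r + 2 <= - net V D r \/ net V D r + 2 <= eta r)%R.
- move: l1 e1 le1 h2 h3 neg; clear; lia.
- by apply: (root_arc (s := a) (t := r) H IH aV ar Dar); left.
by apply: (root_arc (s := r) (t := a) H IH aV ar Dar); right.
Qed.

End Reorient.

(** * Reduction of re-orientation to the boundary theorem *)

Section ReorientMain.
Variables (I : finType) (k : nat).
Implicit Types (V A B S X ex : {set I}) (D p : I -> I -> nat) (r u v w x y : I).
Implicit Types (b lam eta : I -> int).

Lemma even_bsum b (c : I -> int) S : (forall v, v \in S -> even_diff (b v) (c v)) ->
  even_diff (bsum b S) (bsum c S).
Proof.
move=> h; rewrite /bsum; elim/big_rec2: _ => [|x y1 y2 /h [q ->] [q' ->]]; first by exists 0%R.
by exists (q + q')%R; lia.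
Qed.

Lemma arcs0 S : arcs (fun=> 0) S = 0 :> nat.
Proof. by rewrite /arcs big1. Qed.

Lemma cut0 V (m : I -> I -> nat) S : cut V m (fun=> 0) (fun=> 0) S = cutm V m S.
Proof. by rewrite /cut !arcs0. Qed.

Hypothesis k_gt0 : 0 < k.

Section Final.
Variables (V : {set I}) (r : I) (D : I -> I -> nat) (b lam eta : I -> int).
Hypotheses (H : rooted_inst k V r D b lam eta set0) (IH : reorients_fewer_vertices k V).
Hypothesis root_out : (0 <= net V D r)%R.
Hypothesis excess : forall v, v \in V -> v != r -> (- net V D v < (dist2k k (b v))%:Z)%R.

Let m u w := D u w + D w u.

Lemma final_parity S : S \subset V -> exists q : int, ((cutm V m S)%:Z + bsum b S = 2 * q)%R.
Proof.
move=> SV; have [q hq] : even_diff (bsum b S) (bsum (net V D) S).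
  by apply: even_bsum => v vS; have [] := xi_par H (subsetP SV v vS).
exists ((dout V D S)%:Z + q)%R; rewrite hq bsum_net // cutm_sym //; clear; lia.
Qed.

(** The degree is [2 * in + net], with [in] at least 2k - 2 and, by parity, [net] at least 2 minus
    the distance; the distance is at most k. *)
Lemma final_single v : v \in V -> v != r ->
  k + k + dist2k k (b v) <= cutm V m [set v] + 2.
Proof.
move=> vV vr; have vs : [set v] \subset V by rewrite sub1set.
have v0 : [set v] != set0 by apply/set0Pn; exists v; rewrite inE.
have rv : r \notin [set v] by rewrite inE eq_sym.
have := xi_cut H vs v0 rv v0; have := excess vV vr; have [[q hq] _ _] := xi_par H vV.
have [q' hq'] := dist2k_par k_gt0 (b v); have := dist2k_lek k_gt0 (b v).
by move: hq; rewrite cutm_sym // net_deg //; move: hq'; clear; lia.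
Qed.

Lemma final_window v (t : int) : v \in V -> cong2k k t (b v) -> `|t| < k + k ->
  (lam v <= t + (k + k)%:Z - 2 /\ t <= eta v + (k + k)%:Z - 2)%R.
Proof.
move=> vV tb tk; have [l1 e1 _] := xi_bnd H vV; have [[q hq] _ _] := xi_par H vV.
have ev : even_diff (b v) (- net V D v)%R by exists (q + net V D v)%R; move: hq; clear; lia.
have : ((- net V D v < (dist2k k (b v))%:Z) \/ (- net V D v <= 0))%R.
  case: (eqVneq v r) => [->|vr]; last by left; apply: excess.
  by right; move: root_out; clear; lia.
move/(small_window k_gt0 tb tk ev); move: l1 e1; clear; lia.
Qed.

(** There is no additional vertex here. Sets containing the root inherit their bound from the
    complement, since the total boundary is 0 modulo 2k. *)
Lemma final_flat :
  (forall S, S \subset V -> r \notin S -> S != set0 -> k + k + dist2k k (bsum b S) <= cutm V m S + 2) ->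
  rooted_sol k V D b lam eta.
Proof.
move=> hS; have rV := xi_r H.
have [p [pm pt]] : boundary_sol k V m (fun=> 0) (fun=> 0) b.
  apply: (@boundary_orientation _ _ k_gt0 V m _ _ b set0); first by apply/set0Pn; exists r.
  split.
  - by move=> u w; rewrite /m addnC.
  - by move=> S SV; rewrite cut0; exact: final_parity.
  - by rewrite !arcs0 addr0; exact: (xi_tot H).
  - by rewrite !arcs0; move: k_gt0; clear; lia.
  - move=> S SV S0 SV' _; rewrite cut0.
    case: (boolP (r \in S)) => rS; last exact: hS.
    have QV : V :\: S \subset V by exact: subsetDl.
    have rQ : r \notin V :\: S by rewrite inE rS.
    have Q0 : V :\: S != set0.
      by apply: contraNneq SV' => e; rewrite eqEsubset SV /= -setD_eq0 e.
    have := hS _ QV rQ Q0.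
    have -> : dist2k k (bsum b (V :\: S)) = dist2k k (bsum b S).
      rewrite -(dist2kN k_gt0 (bsum b S)); apply: (dist2k_cg k_gt0).
      by have := xi_tot H; rewrite (bsumC _ SV) => -[q hq]; exists q; move: hq; clear; lia.
    suff -> : cutm V m (V :\: S) = cutm V m S by [].
    rewrite /cutm setDDr setDv set0U (setIidPr SV) exchange_big /=.
    by apply: eq_bigr => u _; apply: eq_bigr => w _; rewrite /m addnC.
  by move=> x; rewrite inE.
exists p; split => // v vV; have [h1 h2] := pt v vV.
rewrite /excess_at addr0 subr0 in h1 h2; have [h3 h4] := final_window vV h1 h2.
by [].
Qed.

(** For a minimal deficient [S], deficiency supplies [inst_ii] and minimality supplies [inst_iii],
    so the boundary theorem solves the inside once the contracted digraph is solved by induction. *)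
Lemma final_contract S : S \subset V -> r \notin S -> S != set0 ->
  cutm V m S + 2 < k + k + dist2k k (bsum b S) ->
  (forall B, B \subset S -> B != set0 -> B != S -> k + k + dist2k k (bsum b B) <= cutm V m B + 2) ->
  rooted_sol k V D b lam eta.
Proof.
move=> SV rS S0 defS minS; have rV := xi_r H.
have memr v : v \in S -> v \in V /\ v != r.
  by move=> vS; split; [exact: (subsetP SV) | apply: contraNneq rS => <-].
have S1 : 1 < #|S|.
  case: (set_cases S0) => // -[z Sz]; have [zV zr] : z \in V /\ z != r by apply: memr; rewrite Sz inE.
  by have := final_single zV zr; move: defS; rewrite Sz bsum1; clear; lia.
have [a aS] := set0Pn _ S0.
pose h := crep S a; pose V1 := h @: V; pose D1 := cmat h V D.
have sm u w : m u w = m w u by rewrite /m addnC.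
have mE u w : cmat h V m u w = D1 u w + D1 w u.
  rewrite /D1 -(cmat_tr h V D u w) /cmat -big_split /=; apply: eq_bigr => x _.
  by rewrite -big_split.
have V1P u : u \in V1 -> u = a \/ u \in V :\: S.
  by rewrite /V1 (crep_img SV aS) in_setU1 => /orP[/eqP|]; [left | right].
have netD1 u : u \in V :\: S -> net V1 D1 u = net V D u.
  move=> uV; rewrite net_cmat; first by rewrite (expand_out aS uV) bsum1.
  by rewrite (crep_img SV aS) in_setU1 uV orbT.
have aV1 : a \in V1 by rewrite /V1 (crep_img SV aS) in_setU1 eqxx.
have neta : net V1 D1 a = bsum (net V D) S by rewrite net_cmat // (expand_a SV aS).
have cbo u : u \in V :\: S -> cb h V b u = b u.
  by move=> uV; rewrite /cb (expand_out aS uV) bsum1.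
have rVS : r \in V :\: S by rewrite inE rS.
(* Any bounds satisfying [xi_bnd] will do at the contracted vertex: only its residue matters for the
   inner instance. *)
pose lam1 u := if u == a then (- `|net V1 D1 a|%N%:Z)%R else lam u.
pose eta1 u := if u == a then (`|net V1 D1 a|%N%:Z)%R else eta u.
have [p1 [p1m p1t]] : rooted_sol k V1 D1 (cb h V b) lam1 eta1.
  apply: (IH (r := r) (ex := set0)); first exact: card_crep.
  split.
  - by rewrite /V1 (crep_img SV aS) in_setU1 rVS orbT.
  - move=> u /V1P[->|uV]; last first.
      rewrite netD1 // cbo // /lam1 /eta1 (negPf (crep_out aS uV)); apply: (xi_par H).
      by move: uV; rewrite inE => /andP[].
    rewrite /lam1 /eta1 eqxx; split.
    + rewrite neta /cb (expand_a SV aS); apply: even_bsum => v vS.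
      by have [] := xi_par H (subsetP SV v vS).
    + set z := net V1 D1 a; have [h0|h0] := leP 0%R z.
        by exists (- z)%R; move: h0; clear; lia.
      by exists 0%R; move: h0; clear; lia.
    set z := net V1 D1 a; have [h0|h0] := leP 0%R z.
      by exists 0%R; move: h0; clear; lia.
    by exists (- z)%R; move: h0; clear; lia.
  - by rewrite bsum_cb expand_img; exact: (xi_tot H).
  - move=> X XV X0 rX _; rewrite din_cmat //.
    have E0 : expand h V X != set0.
      apply: contraNneq X0 => e; apply/eqP; apply: (@expand_inj _ h V) => //; first exact: sub0set.
      by rewrite e; apply/setP => x; rewrite !inE andbF.
    apply: (xi_cut H) => //; first exact: expand_sub.
    by rewrite inE /h /crep (negPf rS) (negPf rX) andbF.
  - move=> u /V1P[->|uV]; last first.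
      rewrite netD1 // /lam1 /eta1 (negPf (crep_out aS uV)); apply: (xi_bnd H).
      by move: uV; rewrite inE => /andP[].
    by rewrite /lam1 /eta1 eqxx; clear; split; lia.
  by move=> x; rewrite inE.
have p1m' u w : u \in h @: V -> w \in h @: V -> u != w -> p1 u w + p1 w u = cmat h V m u w.
  by move=> uV wV uw; rewrite mE; exact: p1m.
have [o2 [i2 [h1 h2 h3]]] := split_contraction SV aS sm p1m'.
have cutB B : B \subset S -> cut S m o2 i2 B = cutm V m B.
  move=> BS; have := cut_inner SV (fun=> 0) (fun=> 0) BS h1; rewrite cut0 => <-.
  by [].
have [p2 [p2m p2t]] : boundary_sol k S m o2 i2 b.
  apply: (@boundary_orientation _ _ k_gt0 S m _ _ b set0) => //; split => //.
  - by move=> B BS; rewrite cutB //; apply: final_parity; exact: subset_trans BS SV.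
  - have [[q hq] _ _] := p1t a aV1; move: hq.
    rewrite -[net V1 p1 a]h2 /cb (expand_a SV aS) => hq.
    by exists (- q)%R; move: hq; clear; lia.
  - have := cutB S (subxx S); rewrite /cut {1}/cutm setDv big1 ?addn0; last first.
      by move=> u _; rewrite big_set0.
    by move=> ->; move: defS; clear; lia.
  - by move=> B BS B0 BS' _; rewrite cutB //; exact: minS.
  by move=> x; rewrite inE.
have [p [pm pS pV]] := h3 p2 p2m.
exists p; split => // v vV; case: (boolP (v \in S)) => vS.
  have [t1 t2] := p2t v vS; rewrite pS //.
  by rewrite /excess_at in t1 t2; have [w1 w2] := final_window vV t1 t2.
have vVS : v \in V :\: S by rewrite inE vS.
have vV1 : v \in V1 by rewrite /V1 (crep_img SV aS) in_setU1 vVS orbT.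
have := p1t v vV1; rewrite cbo // /lam1 /eta1 (negPf (crep_out aS vVS)) pV //.
Qed.

Lemma final_step : rooted_sol k V D b lam eta.
Proof.
pose df := [pred S : {set I} | [&& S \subset V, r \notin S, S != set0 &
  cutm V m S + 2 < k + k + dist2k k (bsum b S)]].
case: (boolP [exists S, df S]) => [/existsP[S1 hS1]|].
  have [S /minsetP[/and4P[SV rS S0 defS] minS] _] := minset_exists hS1.
  apply: (final_contract SV rS S0 defS) => B BS B0 BN; rewrite leqNgt; apply/negP => hB.
  case/negP: BN; apply/eqP; apply: minS => //; rewrite /= B0 hB (subset_trans BS SV) /= andbT.
  by apply: contra rS; exact: subsetP.
rewrite negb_exists => /forallP h; apply: final_flat => S SV rS S0.
by have := h S; rewrite /= SV rS S0 /= -leqNgt.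
Qed.

End Final.

(** Induction on vertices, then arcs: lifting and deletion at the root lower the number of arcs,
    deleting a vertex and contraction the number of vertices. *)
Theorem reorient V r D b lam eta ex :
  rooted_inst k V r D b lam eta ex -> rooted_sol k V D b lam eta.
Proof.
suff L n : forall V, #|V| < n -> forall M D, mass V D < M ->
    forall r b lam eta ex, rooted_inst k V r D b lam eta ex -> rooted_sol k V D b lam eta.
  by move=> H; apply: (L _ V (ltnSn _) _ D (ltnSn _) _ _ _ _ _ H).
elim: n => // n IHn {}V Vn; elim=> // M IHM0 {}D DM {}r {}b {}lam {}eta {}ex H.
have IV : reorients_fewer_vertices k V.
  move=> V' r' D' b' lam' eta' ex' hV' H'.
  by apply: (IHn V' _ _ D' (ltnSn _) _ _ _ _ _ H'); exact: leq_trans hV' _.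
have IM : reorients_fewer_arcs k V D.
  move=> r' D' b' lam' eta' ex' hD' H'.
  by apply: (IHM0 D' _ _ _ _ _ _ H'); exact: leq_trans hD' _.
have split v : rooted_inst k V r D b lam eta [set v] -> rooted_sol k V D b lam eta.
  move=> Hv; case: (boolP [exists y in V, (y != v) && (0 < D v y)]).
    by case/exists_inP => y yV /andP[yv Dy]; apply: (xlift_step k_gt0 Hv IM yV yv Dy).
  rewrite negb_exists_in => /forall_inP h; apply: (xdel_step k_gt0 Hv IV) => y yV yv.
  by have := h y yV; rewrite yv /= lt0n negbK => /eqP.
case: (set_0Vmem ex) => [e|[v vex]]; last first.
  by have [e _ _ _] := xi_ex H vex; apply: (split v); rewrite -e.
rewrite e in H.
have [ro|ro] := leP 0%R (net V D r); last exact: (root_step H IM ro).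
case: (boolP [exists v in V, (v != r) && ((dist2k k (b v))%:Z <= - net V D v)%R]).
  case/exists_inP => v vV /andP[vr hv]; apply: (split v).
  case: H => h1 h2 h3 h4 h5 h6; split => //.
    by move=> S SV S0 rS _; apply: h4.
  by move=> x; rewrite inE => /eqP ->.
rewrite negb_exists_in => /forall_inP h; apply: (final_step H IV ro) => v vV vr.
by have := h v vV; rewrite vr /= -ltNge.
Qed.

End ReorientMain.

(** * Balanced rooted orientations *)

Section EdgeCounts.
Variable G : mgraph.
Implicit Types (F B : {set edge G}) (S A U : {set vert G}) (v x y r : vert G) (e : edge G).
Implicit Types (s : edge G -> bool).

Definition edges_within F S : nat := \sum_(e in F) (((ends e).1 \in S) && ((ends e).2 \in S)).
Definition edges_across F S : nat := \sum_(e in F) (((ends e).1 \in S) != ((ends e).2 \in S)).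
Definition head s e := if s e then (ends e).1 else (ends e).2.
Definition tail s e := if s e then (ends e).2 else (ends e).1.
Definition indeg s F v : nat := \sum_(e in F) (head s e == v).
Definition outdeg s F v : nat := \sum_(e in F) (tail s e == v).
Definition entering s F S : nat := \sum_(e in F) ((head s e \in S) && (tail s e \notin S)).

Lemma sum_eq S x : \sum_(v in S) (x == v : nat) = (x \in S).
Proof. by rewrite -sum_ind; apply: eq_bigr => v _; rewrite eq_sym. Qed.

Lemma sum_deg F S : \sum_(v in S) deg F v = 2 * edges_within F S + edges_across F S.
Proof.
rewrite /deg exchange_big /= /edges_within /edges_across big_distrr -big_split /=; apply: eq_bigr => e _.
rewrite big_split /= !sum_eq.
by case: (_ \in S); case: (_ \in S).
Qed.

Lemma sum_indeg s F S : \sum_(v in S) indeg s F v = edges_within F S + entering s F S.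
Proof.
rewrite /indeg exchange_big /= /edges_within /entering -big_split /=; apply: eq_bigr => e _.
rewrite sum_eq /head /tail.
by case: (s e); case: ((ends e).1 \in S); case: ((ends e).2 \in S).
Qed.

Lemma deg_in_out s F v : deg F v = indeg s F v + outdeg s F v.
Proof.
rewrite /deg /indeg /outdeg -big_split /=; apply: eq_bigr => e _.
by rewrite /head /tail; case: (s e) => //; rewrite addnC.
Qed.

Lemma edges_within_supmod F S U : edges_within F S + edges_within F U <= edges_within F (S :&: U) + edges_within F (S :|: U).
Proof.
rewrite /edges_within -!big_split /=; apply: leq_sum => e _; rewrite !inE.
by case: (_ \in S); case: (_ \in U); case: (_ \in S); case: (_ \in U).
Qed.

Lemma sum_mod (q : vert G -> nat) S U :
  \sum_(v in S) q v + \sum_(v in U) q v = \sum_(v in S :&: U) q v + \sum_(v in S :|: U) q v.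
Proof.
rewrite (big_setID U) /= -addnA addnC [X in _ = _ + X](big_setID U) /=.
rewrite [in RHS]setIUl [U :&: U]setIid (setUidPr (subsetIr S U)) setDUl setDv setU0.
by lia.
Qed.

(** Hakimi's criterion. An edge can be given a head unless a saturated set contains that end; if
    both ends are blocked, supermodularity makes the union, which contains the whole edge, violate
    the hypothesis. *)
Lemma orient_le F (q : vert G -> nat) :
  (forall S, edges_within F S <= \sum_(v in S) q v) -> exists s, forall v, indeg s F v <= q v.
Proof.
move: {2}#|F| (erefl #|F|) => n; elim: n F q => [|n IHn] F q Fn hq.
  by exists xpredT => v; rewrite /indeg (cards0_eq Fn) big_set0.
have [e eF] : exists e, e \in F by apply/set0Pn; rewrite -card_gt0 Fn.
have F'n : #|F :\ e| = n by have := cardsD1 e F; rewrite eF Fn => -[].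
have einD S : edges_within F S = (((ends e).1 \in S) && ((ends e).2 \in S)) + edges_within (F :\ e) S.
  by rewrite /edges_within (big_setD1 e).
have step (c : bool) : let x := if c then (ends e).1 else (ends e).2 in
    (forall S, x \in S -> edges_within (F :\ e) S < \sum_(v in S) q v) ->
    exists s, forall v, indeg s F v <= q v.
  move=> x hx.
  have qx : 0 < q x by have := hx [set x]; rewrite inE big_set1 eqxx => /(_ isT); lia.
  have qE v : q v = q v - (v == x) + (v == x) by rewrite subnK //; case: eqP => [->|].
  have qS S : \sum_(v in S) q v = \sum_(v in S) (q v - (v == x)) + (x \in S).
    by rewrite -sum_ind -big_split /=; apply: eq_bigr => v _; rewrite -qE.
  have [s hs] : exists s, forall v, indeg s (F :\ e) v <= q v - (v == x).
    apply: IHn => // S; have := qS S; case: (boolP (x \in S)) => xS.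
      by have := hx S xS; clear; lia.
    by have := einD S; have := hq S; clear; lia.
  exists (fun e' => if e' == e then c else s e') => v.
  rewrite /indeg (big_setD1 e) //= {1}/head eqxx qE addnC; apply: leq_add.
    apply: leq_trans (hs v); apply: leq_sum => e'; rewrite !inE => /andP[/negPf ee _].
    by rewrite /head ee.
  by rewrite /x eq_sym; case: c {hx qx qE qS hs x}.
have [h1|] := boolP [forall S : {set vert G}, ((ends e).1 \in S) ==> (edges_within (F :\ e) S < \sum_(v in S) q v)].
  by apply: (step true) => S xS; have := forallP h1 S; rewrite xS.
have [h2|] := boolP [forall S : {set vert G}, ((ends e).2 \in S) ==> (edges_within (F :\ e) S < \sum_(v in S) q v)].
  by move=> _; apply: (step false) => S xS; have := forallP h2 S; rewrite xS.
rewrite !negb_forall => /existsP[S2]; rewrite negb_imply -leqNgt => /andP[yS2 t2].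
case/existsP => S1; rewrite negb_imply -leqNgt => /andP[xS1 t1].
have := einD (S1 :|: S2); rewrite !inE xS1 yS2 orbT /= => e3.
have := hq (S1 :|: S2); have := hq (S1 :&: S2); have := edges_within_supmod (F :\ e) S1 S2.
have := sum_mod q S1 S2; have := einD (S1 :&: S2); move: t1 t2 e3; clear; lia.
Qed.

(** The prescription rounds half the degree, upwards on a set [Z] of odd vertices chosen minimal.
    Minimality puts each vertex of [Z] in a tight set, and tight sets that meet have tight union, so
    maximal ones are disjoint. *)
Lemma balanced_indeg N r :
  (forall S, S != set0 -> S != setT -> 2 * N <= edges_across setT S) ->
  exists q : vert G -> nat, [/\ forall v, (deg setT v)./2 <= q v,
    \sum_v q v = edges_within setT setT &
    forall S, S != set0 -> edges_within setT S + N * (r \notin S) <= \sum_(v in S) q v].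
Proof.
move=> hcut; pose d := deg [set: edge G].
pose q (Z : {set vert G}) v := (d v)./2 + (v \in Z).
pose ok (Z : {set vert G}) := [forall S : {set vert G}, (S != set0) ==>
  (edges_within setT S + N * (r \notin S) <= \sum_(v in S) q Z v)].
pose O := [set v | odd (d v)].
have cutT : edges_across [set: edge G] setT = 0 by rewrite /edges_across big1 // => e _; rewrite !inE.
have half S : S != set0 -> 2 * (edges_within setT S + N * (r \notin S)) <= \sum_(v in S) d v.
  move=> S0; rewrite /d sum_deg; have [->|SN] := eqVneq S setT.
    by rewrite inE /= muln0 addn0 leq_addr.
  by have := hcut S S0 SN; case: (r \notin S); rewrite ?muln1 ?muln0; clear; lia.
have okO : ok O.
  apply/forallP => S; apply/implyP => S0; have := half S S0.
  have : \sum_(v in S) d v <= 2 * \sum_(v in S) q O v.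
    rewrite big_distrr /=; apply: leq_sum => v _; rewrite /q inE.
    by have := odd_double_half (d v); clear; lia.
  by clear; lia.
pose P := [pred Z : {set vert G} | ok Z && (Z \subset O)].
have PO : P O by rewrite /= okO subxx.
have [Z /minsetP[/andP[okZ ZO] minZ] _] := minset_exists PO.
have hZ S : S != set0 -> edges_within setT S + N * (r \notin S) <= \sum_(v in S) q Z v.
  by move=> S0; have := forallP okZ S; rewrite S0.
pose tight (S : {set vert G}) := (S != set0) && (\sum_(v in S) q Z v <= edges_within setT S + N * (r \notin S)).
have tightZ v : v \in Z -> exists2 S, tight S & v \in S.
  move=> vZ; case: (boolP [exists S, tight S && (v \in S)]) => [/existsP[S /andP[]]|no].
    by exists S.
  suff ZvZ : Z :\ v = Z by have := setD11 v Z; rewrite ZvZ vZ.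
  apply: minZ; last exact: subD1set.
  rewrite /= (subset_trans (subD1set _ _) ZO) andbT; apply/forallP => S; apply/implyP => S0.
  have qS : \sum_(u in S) q Z u = \sum_(u in S) q (Z :\ v) u + (v \in S).
    rewrite -sum_ind -big_split /=; apply: eq_bigr => u _; rewrite /q !inE -addnA; congr (_ + _).
    by case: eqP => [->|_]; rewrite ?vZ //= addn0.
  have := hZ S S0; rewrite qS; case: (boolP (v \in S)) => vS /=; last by rewrite addn0.
  have := no; rewrite negb_exists => /forallP/(_ S); rewrite vS andbT /tight S0 /= -ltnNge qS vS.
  by clear; lia.
have tightU A (B : {set vert G}) : tight A -> tight B -> A :&: B != set0 -> tight (A :|: B).
  move=> /andP[A0 tA] /andP[B0 tB] AB0; rewrite /tight.
  have AB : A :|: B != set0.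
    by apply: contraNneq A0 => e; rewrite -subset0 -e subsetUl.
  rewrite AB /=; have := hZ _ AB0; have := edges_within_supmod setT A B; have := sum_mod (q Z) A B.
  have : N * (r \notin A) + N * (r \notin B) = N * (r \notin A :&: B) + N * (r \notin A :|: B).
    by rewrite !inE; case: (r \in A); case: (r \in B) => /=; clear; lia.
  by move: tA tB; clear; lia.
have tight_half A : tight A -> 2 * \sum_(v in A) q Z v <= \sum_(v in A) d v.
  by move=> /andP[A0 tA]; have := half A A0; move: tA; clear; lia.
(* On a tight set the prescription is at most half the degree sum because the cut has at least 2N
   edges; elsewhere it is rounded down. The disjoint maximal tight sets thus bound the total by the
   number of edges. *)
have cover n : forall U, #|U| <= n -> (forall A, maxset tight A -> A :&: U != set0 -> A \subset U) ->
    2 * \sum_(v in U) q Z v <= \sum_(v in U) d v.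
  elim: n => [|n IHn] U Un hU.
    by move: Un; rewrite leqn0 cards_eq0 => /eqP ->; rewrite !big_set0.
  case: (boolP [exists v in U, v \in Z]) => [/exists_inP[v vU vZ]|no].
    have [A1 tA1 vA1] := tightZ v vZ.
    have [A mA sA] := maxset_exists tA1.
    have tA := maxsetp mA; have vA : v \in A by apply: (subsetP sA).
    have AU : A \subset U by apply: hU => //; apply/set0Pn; exists v; rewrite inE vA.
    rewrite (big_setID A) [X in _ <= X](big_setID A) /= (setIidPr AU) mulnDr.
    apply: leq_add; first exact: tight_half.
    apply: IHn.
      rewrite -ltnS; apply: leq_trans Un; apply: proper_card; rewrite properEneq subsetDl andbT.
      by apply/eqP => e; have := vU; rewrite -e inE vA.
    move=> B mB BU; have tB := maxsetp mB.
    have BU' : B \subset U.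
      apply: hU => //; case/set0Pn: BU => x; rewrite !inE => /and3P[xB _ xU].
      by apply/set0Pn; exists x; rewrite inE xB.
    rewrite subsetD BU' /= -setI_eq0; apply: contraT => BA0.
    have tBA := tightU B A tB tA BA0.
    have e1 : B :|: A = B by have [_ h] := maxsetP mB; apply: h => //; exact: subsetUl.
    have e2 : B :|: A = A by have [_ h] := maxsetP mA; apply: h => //; exact: subsetUr.
    by case/set0Pn: BU => x; rewrite -{1}e1 e2 !inE => /and3P[-> /negP].
  rewrite big_distrr /=; apply: leq_sum => v vU; rewrite /q.
  have -> : (v \in Z) = false by apply: contraNF no => vZ; apply/exists_inP; exists v.
  by have := odd_double_half (d v); clear; lia.
exists (q Z); split => //; first by move=> v; exact: leq_addr.
have V0 : [set: vert G] != set0 by apply/set0Pn; exists r.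
have := cover _ setT (leqnn _) (fun A _ _ => subsetT A).
have := hZ _ V0; rewrite /d sum_deg cutT in_setT /=.
have -> : \sum_(v in [set: vert G]) q Z v = \sum_v q Z v by apply: eq_bigl => v; rewrite inE.
by clear; lia.
Qed.

Lemma balanced_orientation N r :
  (forall S, S != set0 -> S != setT -> 2 * N <= edges_across setT S) ->
  exists s, (forall v, (deg setT v)./2 <= indeg s setT v) /\
    forall S, S != set0 -> r \notin S -> N <= entering s setT S.
Proof.
move=> hcut; have [q [q1 q2 q3]] := balanced_indeg r hcut.
have q4 S : edges_within setT S <= \sum_(v in S) q v.
  have [->|S0] := eqVneq S set0; last by have := q3 S S0; clear; lia.
  by rewrite /edges_within big1 // => e _; rewrite inE.
have [s hs] := orient_le q4.
(* Both totals equal the number of edges, which turns the upper bounds from [orient_le] into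
   equalities. *)
have tot : \sum_v indeg s setT v = \sum_v q v.
  rewrite q2; have := sum_indeg s setT setT.
  rewrite [X in _ + X]big1 ?addn0; last by move=> e _; rewrite !inE andbF.
  by move=> <-; apply: eq_bigl => v; rewrite inE.
have eqi v : indeg s setT v = q v.
  apply/eqP; rewrite eqn_leq hs /=; move: tot.
  rewrite (bigD1 v) //= [RHS](bigD1 v) //=.
  have : \sum_(i | i != v) indeg s setT i <= \sum_(i | i != v) q i by apply: leq_sum => i _.
  by clear; lia.
exists s; split; first by move=> v; rewrite eqi.
move=> S S0 rS; have := q3 S S0; have := sum_indeg s setT S.
rewrite (eq_bigr q) // rS /=; clear; lia.
Qed.

Lemma connect_closed F S x y : (forall u w, adj F u w -> u \in S -> w \in S) ->
  connect (adj F) x y -> x \in S -> y \in S.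
Proof.
move=> h /connectP[p]; elim: p x => [|z p IHp] x /=; first by move=> _ ->.
by move=> /andP[xz pz] yl xS; apply: (IHp z) => //; apply: h xz xS.
Qed.

Lemma ecut_edge_connected n S : edge_connected G n -> S != set0 -> S != setT ->
  n <= edges_across setT S.
Proof.
move=> hG S0 SN; rewrite leqNgt; apply/negP => lt.
pose C := [set e : edge G | ((ends e).1 \in S) != ((ends e).2 \in S)].
have Cn : #|C| < n.
  apply: leq_ltn_trans lt; rewrite /edges_across -sum1_card big_mkcond [X in _ <= X]big_mkcond /=.
  by apply: leq_sum => e _; rewrite !inE; case: ifP.
case/set0Pn: S0 => x xS; have [y yS] : exists y, y \notin S.
  apply/existsP; rewrite -negb_forall; apply: contra SN => /forallP h.
  by apply/eqP/setP => z; rewrite inE h.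
case/negP: yS; apply: (connect_closed _ (hG C Cn x y) xS) => u w.
case/exists_inP => e; rewrite !inE negbK => /eqP ee /orP[]/eqP eq; rewrite eq /= in ee; by rewrite ee.
Qed.

End EdgeCounts.

(** * Edge-disjoint branchings *)

Section Branchings.
Variable G : mgraph.
Implicit Types (F B T : {set edge G}) (S A X : {set vert G}) (v x y r : vert G) (e : edge G).
Implicit Types (s : edge G -> bool).

Lemma adj_sym F : symmetric (adj F).
Proof.
by move=> x y; apply/exists_inP/exists_inP => -[e eF h]; exists e => //; rewrite /joins orbC.
Qed.

Lemma adj_connect_sym F : connect_sym (adj F).
Proof. exact/sym_connect_sym/adj_sym. Qed.

Lemma adj_connectS F T x y : F \subset T -> connect (adj F) x y -> connect (adj T) x y.
Proof.
move=> FT; apply: connect_sub => u w /exists_inP[e eF h]; apply: connect1.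
by apply/exists_inP; exists e => //; apply: (subsetP FT).
Qed.

Lemma sum_lt_ex F (P Q : pred (edge G)) :
  \sum_(e in F) P e < \sum_(e in F) Q e -> exists e, [/\ e \in F, Q e & ~~ P e].
Proof.
move=> h; case: (boolP [exists e in F, Q e && ~~ P e]) => [/exists_inP[e eF /andP[]]|].
  by exists e.
rewrite negb_exists_in => /forall_inP h2; move: h; rewrite ltnNge leq_sum // => e /h2.
by case: (Q e); case: (P e).
Qed.

Lemma entering_submod s F S A :
  entering s F (S :&: A) + entering s F (S :|: A) <= entering s F S + entering s F A.
Proof.
rewrite /entering -!big_split /=; apply: leq_sum => e _; rewrite !inE.
by case: (_ \in S); case: (_ \in A); case: (_ \in S); case: (_ \in A).
Qed.

Lemma entering_avoid s F B S : (forall e, e \in B -> head s e \notin S) ->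
  entering s (F :\: B) S = entering s F S.
Proof.
move=> h; rewrite /entering [RHS](big_setID B) /= [X in _ = X + _]big1 // => e.
by rewrite inE => /andP[_ /h /negPf ->].
Qed.

Lemma entering_D1 s F e S : e \in F ->
  entering s F S = ((head s e \in S) && (tail s e \notin S)) + entering s (F :\ e) S.
Proof. by move=> eF; rewrite /entering (big_setD1 e). Qed.

(** One step of Lovasz's proof of Edmonds' theorem: [X] is the part already reached by the branching
    [B]. Arcs of [B] have heads in [X], so the part of a set outside [X] is still entered by more
    than [n] arcs. *)
Lemma next_arc s r F B X n : r \in X -> X != setT ->
  (forall S, S != set0 -> r \notin S -> n < entering s F S) ->
  (forall e, e \in B -> head s e \in X) ->
  (forall S, S != set0 -> r \notin S -> n <= entering s (F :\: B) S) ->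
  exists e, [/\ e \in F :\: B, head s e \notin X, tail s e \in X &
    forall S, r \notin S -> head s e \in S -> tail s e \notin S -> n < entering s (F :\: B) S].
Proof.
move=> rX XT hF hB hFB.
have out S : r \notin S -> S :\: X != set0 -> n < entering s (F :\: B) (S :\: X).
  move=> rS SX; rewrite entering_avoid; first by apply: hF => //; rewrite !inE negb_and rS orbT.
  by move=> e /hB eX; rewrite !inE eX.
pose crit := [pred S : {set vert G} | [&& r \notin S, S :\: X != set0 & entering s (F :\: B) S <= n]].
case: (boolP [exists S, crit S]) => [/existsP[A1 cA1]|no].
  (* More arcs enter the part of the critical set [A] outside [X] than enter [A], so one runs inside
     [A] from [X] to the rest. A set with at most [n] entering arcs that it enters would meet [A] in
     a smaller critical set. *)
  have [A /minsetP[/and3P[rA AX dA] minA] _] := minset_exists cA1.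
  have /sum_lt_ex[e [eFB]] := leq_ltn_trans dA (out A rA AX).
  rewrite !inE => /andP[/andP[hX hA]]; rewrite negb_and negbK => tAX; rewrite hA /= negbK => tA.
  have tX : tail s e \in X by move: tAX; rewrite tA orbF.
  exists e; split => // S rS hS tS; rewrite ltnNge; apply/negP => dS.
  have I0 : S :&: A :\: X != set0 by apply/set0Pn; exists (head s e); rewrite !inE hX hS.
  have I0' : S :&: A != set0 by apply/set0Pn; exists (head s e); rewrite !inE hS.
  have U0 : S :|: A != set0 by apply/set0Pn; exists (head s e); rewrite !inE hS.
  have rU : r \notin S :|: A by rewrite inE negb_or rS.
  have rI : r \notin S :&: A by rewrite inE negb_and rS.
  have SA : S :&: A = A.
    apply: minA; last exact: subsetIr.
    rewrite /= rI I0 /=; have := entering_submod s (F :\: B) S A; have := hFB _ U0 rU.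
    by move: dS dA; clear; lia.
  by have := tA; rewrite -SA inE (negPf tS).
have X0 : ~: X :\: X != set0.
  apply: contraNneq XT => e; apply/eqP/setP => x; rewrite inE.
  by have := in_set0 x; rewrite -e !inE andbb => /negbFE.
have rX' : r \notin ~: X by rewrite inE negbK.
have := out _ rX' X0; rewrite -[n]add0n => lt.
have /sum_lt_ex[e [eFB h _]] : \sum_(e in F :\: B) pred0 e < \sum_(e in F :\: B)
    ((head s e \in ~: X :\: X) && (tail s e \notin ~: X :\: X)).
  by rewrite big1 //; move: lt; rewrite /entering; clear; lia.
move: h; rewrite !inE !andbb negbK => /andP[hX tX].
exists e; split => // S rS hS tS; rewrite ltnNge; apply/negP => dS.
case/negP: no; apply/existsP; exists S; rewrite /= rS dS andbT /=.
by apply/set0Pn; exists (head s e); rewrite !inE hX.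
Qed.

Lemma joins_tail_head s e : joins e (tail s e) (head s e).
Proof. by rewrite /joins /head /tail; case: (s e); rewrite -surjective_pairing eqxx ?orbT. Qed.

Lemma branching s r F n :
  (forall S, S != set0 -> r \notin S -> n < entering s F S) ->
  exists B, [/\ B \subset F, connected B, forall v, indeg s B v <= 1 &
    forall S, S != set0 -> r \notin S -> n <= entering s (F :\: B) S].
Proof.
move=> hF.
(* Induction on the number of unreached vertices, maintaining that the arcs left over still enter
   each set avoiding [r] at least [n] times. *)
suff grow j X B : #|~: X| <= j -> r \in X -> B \subset F ->
    (forall e, e \in B -> head s e \in X) -> (forall v, v \in X -> connect (adj B) r v) ->
    (forall v, indeg s B v <= (v \in X)) ->
    (forall S, S != set0 -> r \notin S -> n <= entering s (F :\: B) S) ->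
    exists B, [/\ B \subset F, connected B, forall v, indeg s B v <= 1 &
      forall S, S != set0 -> r \notin S -> n <= entering s (F :\: B) S].
  apply: (grow _ [set r] set0 (leqnn _)).
  - by rewrite inE.
  - exact: sub0set.
  - by move=> e; rewrite in_set0.
  - by move=> v; rewrite inE => /eqP ->.
  - by move=> v; rewrite /indeg big_set0.
  by move=> S S0 rS; rewrite setD0; exact/ltnW/hF.
have fin : forall X B, X = setT -> B \subset F -> (forall v, v \in X -> connect (adj B) r v) ->
    (forall v, indeg s B v <= (v \in X)) ->
    (forall S, S != set0 -> r \notin S -> n <= entering s (F :\: B) S) ->
    exists B, [/\ B \subset F, connected B, forall v, indeg s B v <= 1 &
      forall S, S != set0 -> r \notin S -> n <= entering s (F :\: B) S].
  move=> {}X {}B XT BF cB iB dB; exists B; split => //; last by move=> v; apply: leq_trans (iB v) (leq_b1 _).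
  move=> x y; apply: (connect_trans (y := r)); last by apply: cB; rewrite XT inE.
  by rewrite adj_connect_sym; apply: cB; rewrite XT inE.
elim: j X B => [|j IHj] X B Xj rX BF hB cB iB dB.
  by apply: (fin X B) => //; apply/setP => x; move: Xj; rewrite leqn0 cards_eq0 => /eqP/setP/(_ x); rewrite !inE => /negbFE.
have [XT|XN] := eqVneq X setT; first exact: (fin X B).
have [e [eFB hX tX he]] := next_arc rX XN hF hB dB.
have [eB eF] : e \notin B /\ e \in F by apply/andP; move: eFB; rewrite inE.
apply: (IHj (head s e |: X) (e |: B)).
- rewrite -ltnS; apply: leq_trans Xj; apply: proper_card; apply/properP; split.
    by apply/subsetP => x; rewrite !inE negb_or => /andP[].
  by exists (head s e); rewrite !inE ?eqxx.
- by rewrite !inE rX orbT.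
- by rewrite subUset sub1set eF.
- by move=> e'; rewrite !inE => /orP[/eqP ->|/hB ->]; rewrite ?eqxx ?orbT.
- have BB : B \subset e |: B by exact: subsetUr.
  move=> v; rewrite !inE => /orP[/eqP ->|/cB /(adj_connectS BB) //].
  apply: connect_trans (adj_connectS BB (cB _ tX)) _; apply: connect1.
  by apply/exists_inP; exists e; rewrite ?inE ?eqxx ?joins_tail_head.
- move=> v; rewrite /indeg (big_setU1 _ eB) /= !inE; have := iB v; rewrite /indeg.
  by case: (eqVneq v (head s e)) => [->|vh]; rewrite ?eqxx ?(negPf hX) /= ?[head s e == v]eq_sym ?(negPf vh) ?orbF //; clear; lia.
move=> S S0 rS; have -> : F :\: (e |: B) = (F :\: B) :\ e by rewrite setUC setDDl.
have := dB S S0 rS; rewrite (entering_D1 _ _ eFB).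
have := he S rS; rewrite (entering_D1 _ _ eFB).
case: (head s e \in S); case: (tail s e \in S) => //= h _.
by have := h isT isT.
Qed.

Lemma branchings s r m l : forall F,
  (forall S, S != set0 -> r \notin S -> m + l <= entering s F S) ->
  exists (U : {set edge G}) (T : nat -> {set edge G}),
    [/\ U \subset F, forall i, i < m -> T i \subset U /\ connected (T i),
        forall i j, i < m -> j < m -> i != j -> [disjoint T i & T j],
        forall v, indeg s U v <= m &
        forall S, S != set0 -> r \notin S -> l <= entering s (F :\: U) S].
Proof.
elim: m => [|m IHm] F hF.
  exists set0, (fun=> set0); split => //; first exact: sub0set.
    by move=> v; rewrite /indeg big_set0.
  by move=> S S0 rS; rewrite setD0; apply: hF.
have [|B [BF cB iB dB]] := @branching s r F (m + l).
  by move=> S S0 rS; rewrite -addSn; exact: hF.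
have [U [T [UF hT dT iU dU]]] := IHm _ dB.
have BU : [disjoint B & U].
  by rewrite disjoint_sym; apply: disjointWl UF _; rewrite disjoints_subset; apply/subsetP => x; rewrite !inE => /andP[].
exists (B :|: U), (fun i => if i == m then B else T i); split.
- by rewrite subUset BF (subset_trans UF) // subsetDl.
- move=> i im; case: eqP => [_|/eqP ni]; first by split => //; exact: subsetUl.
  have [|h1 h2] := hT i; first by rewrite ltn_neqAle ni.
  by split => //; exact: subset_trans h1 (subsetUr _ _).
- move=> i j im jm ij; case: (eqVneq i m) => [ei|ni]; case: (eqVneq j m) => [ej|nj].
  + by rewrite ei ej eqxx in ij.
  + have [|h1 _] := hT j; first by rewrite ltn_neqAle nj.
    exact: disjointWr h1 BU.
  + have [|h1 _] := hT i; first by rewrite ltn_neqAle ni.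
    by rewrite disjoint_sym; exact: disjointWr h1 BU.
  by apply: dT => //; rewrite ltn_neqAle ?ni ?nj.
- move=> v; have -> : indeg s (B :|: U) v = indeg s B v + indeg s U v.
    by rewrite /indeg -bigU //=; apply: eq_bigl => e; rewrite !inE.
  by rewrite -addn1 addnC leq_add.
by move=> S S0 rS; rewrite -setDDl; exact: dU.
Qed.

Definition connectedb F := [forall x, forall y, connect (adj F) x y].

Lemma connectedP F : reflect (connected F) (connectedb F).
Proof.
apply: (iffP forallP) => [h x y|h x]; first exact: (forallP (h x)).
by apply/forallP => y; exact: h.
Qed.

(* Deleting an edge of a cycle keeps its ends joined by the rest of the cycle. *)
Lemma cycle_connected T c : connected T -> is_cycle c -> {subset unzip2 c <= T} ->
  exists2 e, e \in T & connected (T :\ e).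
Proof.
case: c => [|[v e] c] cT; first by case/and4P.
case/and4P => _ _ /= /andP[ec _] hc sT.
have eT : e \in T by apply: sT; rewrite /= inE eqxx.
exists e => //.
have hpath : forall c' v' e', {subset e' :: unzip2 c' <= T :\ e} ->
    path [rel p q | joins p.2 p.1 q.1] (v', e') (rcons c' (v, e)) ->
    connect (adj (T :\ e)) v' v.
  elim=> [|[v1 e1] c' IHc] v' e' sub /=.
    rewrite andbT => h; apply: connect1; apply/exists_inP; exists e' => //.
    by apply: sub; rewrite inE eqxx.
  move=> /andP[h1 h2]; apply: (connect_trans (y := v1)).
    by apply: connect1; apply/exists_inP; exists e' => //; apply: sub; rewrite inE eqxx.
  by apply: IHc h2 => x xe; apply: sub; rewrite inE /= xe orbT.
have [w jw cw] : exists2 w, joins e v w & connect (adj (T :\ e)) w v.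
  case: c ec hc sT => [|[v1 e1] c] ec /= hc sT; first by exists v => //; move: hc; rewrite andbT.
  case/andP: hc => h1 h2; exists v1 => //; apply: (hpath c v1 e1) => // x xe.
  rewrite !inE; apply/andP; split; last by apply: sT; rewrite /= inE xe orbT.
  by apply: contraNneq ec => <-.
move=> x y; apply: (connect_sub _ (cT x y)) => a b /exists_inP[f fT jf].
have [fe|fe] := eqVneq f e; last first.
  by apply: connect1; apply/exists_inP; exists f; rewrite ?inE ?fe.
move: jf jw; rewrite fe /joins => /orP[]/eqP -> /orP[]/eqP[-> ->] //.
- by rewrite adj_connect_sym.
- by rewrite adj_connect_sym.
Qed.

(** An inclusion-minimal connected edge set is acyclic, since an edge on a cycle could be
    deleted. *)
Lemma spanning_subtree F : connected F -> exists2 T : {set edge G}, T \subset F & spanning_tree T.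
Proof.
move=> /connectedP cF.
have [T /minsetP[/connectedP cT minT] TF] := minset_exists cF.
exists T => //; split => // c hc sc.
have [e eT /connectedP cTe] := cycle_connected cT hc sc.
by have := setD11 e T; rewrite (minT _ cTe (subD1set _ _)) eT.
Qed.

End Branchings.

(** * From orientations to factors *)

Section Bipartite.
Variables (G : mgraph) (A : {set vert G}).
Hypothesis hA : forall e : edge G, ((ends e).1 \in A) != ((ends e).2 \in A).
Implicit Types (F H : {set edge G}) (u v w : vert G) (e : edge G) (S : {set vert G}).
Implicit Types (s : edge G -> bool).

Definition arc_count s F u w : nat := \sum_(e in F) ((tail s e == u) && (head s e == w)).
Definition aend e := if (ends e).1 \in A then (ends e).1 else (ends e).2.
Definition bend e := if (ends e).1 \in A then (ends e).2 else (ends e).1.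

Lemma aendP e : aend e \in A.
Proof. by have := hA e; rewrite /aend; case: ifP => // _; case: (_ \in A). Qed.

Lemma bendP e : bend e \notin A.
Proof. by have := hA e; rewrite /bend; case: ifP => [_|/negbT //]; case: (_ \in A). Qed.

Lemma deg_ab F v : deg F v = \sum_(e in F) ((aend e == v) + (bend e == v)).
Proof. by apply: eq_bigr => e _; rewrite /aend /bend; case: ifP => // _; rewrite addnC. Qed.

Lemma deg_A F v : v \in A -> deg F v = \sum_(e in F) (aend e == v).
Proof.
move=> vA; rewrite deg_ab; apply: eq_bigr => e _.
by rewrite [bend e == v](negPf _) ?addn0 //; apply: contraNneq (bendP e) => ->.
Qed.

Lemma deg_B F v : v \notin A -> deg F v = \sum_(e in F) (bend e == v).
Proof.
move=> vA; rewrite deg_ab; apply: eq_bigr => e _.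
by rewrite [aend e == v](negPf _) ?addn0 //; apply: contraNneq vA => <-; exact: aendP.
Qed.

Lemma sum_deg_sides F : \sum_(v in A) deg F v = \sum_(v in ~: A) deg F v.
Proof.
rewrite (eq_bigr _ (fun v vA => deg_A F vA)).
rewrite [RHS](eq_bigr (fun v => \sum_(e in F) (bend e == v : nat))); last first.
  by move=> v; rewrite inE; exact: deg_B.
rewrite exchange_big [RHS]exchange_big /=; apply: eq_bigr => e _.
by rewrite !sum_eq inE aendP bendP.
Qed.

Lemma arc_count_out s F u : \sum_(w in [set: vert G]) arc_count s F u w = outdeg s F u.
Proof.
rewrite /arc_count exchange_big /=; apply: eq_bigr => e _.
by case: (tail s e == u) => /=; rewrite ?sum_eq ?inE // big1.
Qed.

Lemma arc_count_in s F u : \sum_(w in [set: vert G]) arc_count s F w u = indeg s F u.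
Proof.
rewrite /arc_count exchange_big /=; apply: eq_bigr => e _.
case: (head s e == u) => /=; last by rewrite big1 // => w _; rewrite andbF.
by under eq_bigr do rewrite andbT; rewrite sum_eq inE.
Qed.

Lemma net_arc_count s F u :
  (net setT (arc_count s F) u = (outdeg s F u)%:Z - (indeg s F u)%:Z)%R.
Proof. by rewrite -arc_count_out -arc_count_in /net !sumZ -sumrB. Qed.

Lemma din_arc_count s F S : din setT (arc_count s F) S = entering s F S.
Proof.
rewrite din_cutm ?subsetT // /cutm /arc_count /entering.
under eq_bigr do rewrite exchange_big /=.
rewrite exchange_big /=; apply: eq_bigr => e _.
have -> : \sum_(u in S) \sum_(w in setT :\: S) ((tail s e == w) && (head s e == u) : nat) =
          \sum_(u in S) (head s e == u : nat) * (tail s e \in setT :\: S).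
  apply: eq_bigr => u _; rewrite -sum_eq big_distrr /=.
  by apply: eq_bigr => w _; rewrite mulnb andbC.
by rewrite -big_distrl /= sum_eq mulnb !inE andbT.
Qed.

Lemma arc_count_ab s F u w : u \in A -> w \notin A ->
  arc_count s F u w + arc_count s F w u = \sum_(e in F) ((aend e == u) && (bend e == w)).
Proof.
move=> uA wA; rewrite /arc_count -big_split /=; apply: eq_bigr => e _.
have eA v : v \notin A -> (aend e == v) = false.
  by move=> vA; apply: contraNF vA => /eqP <-; exact: aendP.
have eB v : v \in A -> (bend e == v) = false.
  by move=> vA; apply: contraTF vA => /eqP <-; exact: bendP.
have [[-> ->]|[-> ->]] : (tail s e = aend e /\ head s e = bend e) \/ (tail s e = bend e /\ head s e = aend e).
- by rewrite /tail /head /aend /bend; case: (s e); case: (_ \in A); [right|left|left|right].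
- by rewrite (eA w wA) (eB u uA) addn0.
by rewrite (eA w wA) (eB u uA) andbF andbC.
Qed.

Lemma arc_count_side s F u w : (u \in A) = (w \in A) -> arc_count s F u w = 0.
Proof.
move=> h; rewrite /arc_count big1 // => e _; apply/eqP; rewrite eqb0; apply/negP => /andP[/eqP eu /eqP ew].
by have := hA e; move: h; rewrite -eu -ew /tail /head; case: (s e) => ->; rewrite eqxx.
Qed.

(** Among the parallel edges between [u] in [A] and [w] outside, as many are put into [H] as [p]
    directs from [u] to [w]. So degrees in [H] are outdegrees on [A] and indegrees on the other
    side. *)
Lemma realize_factor s F p :
  pairs setT p (fun u w => arc_count s F u w + arc_count s F w u) ->
  exists2 H : {set edge G}, H \subset F &
    forall v, (net setT p v = if v \in A then 2 * (deg H v)%:Z - (deg F v)%:Z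
                               else (deg F v)%:Z - 2 * (deg H v)%:Z)%R.
Proof.
move=> hp.
have pAB u w : u \in A -> w \notin A ->
    p u w + p w u = \sum_(e in F) ((aend e == u) && (bend e == w)).
  move=> uA wA; rewrite -(arc_count_ab s) // hp ?inE //.
  by apply: contraNneq wA => <-.
have pside u w : u != w -> (u \in A) = (w \in A) -> p u w = 0.
  by move=> uw h; have := hp u w; rewrite !inE !arc_count_side // => /(_ isT isT uw); lia.
have /fin_all_exists[c hc] (z : vert G * vert G) : exists c : edge G -> nat,
    (forall e, c e <= ((aend e == z.1) && (bend e == z.2))) /\
    (z.1 \in A -> z.2 \notin A -> \sum_(e in F) c e = p z.1 z.2).
  case: z => u w /=; case: (boolP ((u \in A) && (w \notin A))) => [/andP[uA wA]|h].
    have [|c c1 c2] := @distribute _ F (fun e => ((aend e == u) && (bend e == w) : nat)) (p u w).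
      by rewrite -pAB // leq_addr.
    by exists c.
  by exists (fun=> 0); split => // uA wA; rewrite uA wA in h.
have c1 u w e : c (u, w) e <= ((aend e == u) && (bend e == w)) by have [] := hc (u, w).
have c2 u w : u \in A -> w \notin A -> \sum_(e in F) c (u, w) e = p u w by have [_] := hc (u, w).
pose sel e := c (aend e, bend e) e.
have cE u w e : c (u, w) e = ((aend e == u) && (bend e == w)) * sel e.
  have := c1 u w e; case: (eqVneq (aend e) u) => [<-|_] /=; last by rewrite leqn0 => /eqP.
  by case: (eqVneq (bend e) w) => [<-|_] /=; rewrite ?mul1n // leqn0 => /eqP.
have sel1 e : sel e <= 1 by apply: leq_trans (c1 _ _ _) (leq_b1 _).
pose H := [set e in F | sel e == 1].
have sumH (Q : edge G -> nat) : \sum_(e in H) Q e = \sum_(e in F) Q e * sel e.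
  rewrite [RHS](big_setID H) /= [X in _ = _ + X]big1 ?addn0.
    have -> : F :&: H = H by apply/setIidPr/subsetP => e; rewrite inE => /andP[].
    by apply: eq_bigr => e; rewrite inE => /andP[_ /eqP ->]; rewrite muln1.
  move=> e; rewrite !inE => /andP[h eF]; move: h; rewrite eF /= => h.
  by move: (sel1 e) h; case: (sel e) => [|[|n]] //; rewrite muln0.
exists H; first by apply/subsetP => e; rewrite inE => /andP[].
move=> v; rewrite /net (big_setID A) setTI setTD /=.
case: (boolP (v \in A)) => vA.
  rewrite big1 ?add0r; last first.
    move=> w wA; case: (eqVneq v w) => [->|vw]; first by rewrite subrr.
    by rewrite !pside ?subrr // ?wA ?vA // eq_sym.
  have dH : deg H v = \sum_(w in ~: A) p v w.
    rewrite deg_A // sumH.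
    rewrite (eq_bigr (fun w => \sum_(e in F) c (v, w) e)); last first.
      by move=> w; rewrite inE => wA; rewrite c2.
    rewrite exchange_big /=; apply: eq_bigr => e _.
    rewrite (eq_bigr (fun w => (bend e == w) * ((aend e == v) * sel e))); last first.
      by move=> w _; rewrite cE -mulnb mulnAC mulnC mulnA.
    by rewrite -big_distrl /= sum_eq inE bendP mul1n.
  have dF : deg F v = \sum_(w in ~: A) (p v w + p w v).
    rewrite deg_A // [RHS](eq_bigr (fun w => \sum_(e in F) ((aend e == v) && (bend e == w) : nat))); last first.
      by move=> w; rewrite inE => wA; rewrite pAB.
    rewrite exchange_big /=; apply: eq_bigr => e _.
    by case: (aend e == v); rewrite /= ?sum_eq ?inE ?bendP // big1.
  rewrite sumrB -!sumZ dF dH big_split /=; clear; lia.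
rewrite [X in (_ + X)%R]big1 ?addr0; last first.
  move=> w; rewrite inE => wA; case: (eqVneq v w) => [->|vw]; first by rewrite subrr.
  by rewrite !pside ?subrr // ?(negPf wA) ?(negPf vA) // eq_sym.
have dH : deg H v = \sum_(w in A) p w v.
  rewrite deg_B // sumH.
  rewrite (eq_bigr (fun w => \sum_(e in F) c (w, v) e)); last first.
    by move=> w wA; rewrite c2.
  rewrite exchange_big /=; apply: eq_bigr => e _.
  rewrite (eq_bigr (fun w => (aend e == w) * ((bend e == v) * sel e))); last first.
    by move=> w _; rewrite cE -mulnb mulnA.
  by rewrite -big_distrl /= sum_eq aendP mul1n.
have dF : deg F v = \sum_(w in A) (p w v + p v w).
  rewrite deg_B // [RHS](eq_bigr (fun w => \sum_(e in F) ((aend e == w) && (bend e == v) : nat))); last first.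
    by move=> w wA; rewrite pAB.
  rewrite exchange_big /=; apply: eq_bigr => e _.
  case: (bend e == v); last by rewrite big1 // => w _; rewrite andbF.
  by under eq_bigr do rewrite andbT; rewrite sum_eq aendP.
rewrite sumrB -!sumZ dF dH big_split /=; clear; lia.
Qed.

(** The two sides of a bipartition span no edges, which forces the integer in the compatibility
    condition to be 0. *)
Lemma compatible_sides k (f : vert G -> 'I_k) : compatible f ->
  exists q : int, (\sum_(v in A) (f v)%:Z = \sum_(v in ~: A) (f v)%:Z + q * k%:Z)%R.
Proof.
have e0 (B : {set vert G}) : B = A \/ B = ~: A -> edges_in B = 0.
  move=> hB; apply/eqP; rewrite cards_eq0; apply/eqP/setP => e; rewrite !inE.
  by have := hA e; case: hB => ->; rewrite ?inE; case: (_ \in A); case: (_ \in A).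
move=> /(_ A (~: A) (setUCr A) (setICr A)).
case=> -[x []]; rewrite e0 ?leqn0; [|by left| |by right] => /eqP ->; rewrite mulr0 subr0;
  by move=> /eqP; rewrite eqz_mod_dvd => /dvdzP[q hq]; exists q; rewrite -hq; lia.
Qed.

End Bipartite.

Lemma mod_of_cong (k d x : nat) (q : int) : (d%:Z = x%:Z + q * k%:Z)%R -> d = x %[mod k].
Proof.
move=> h; have [q0|q0] := leP 0%R q.
  have -> : d = `|q|%N * k + x by nia.
  by rewrite modnMDl.
have -> : x = `|q|%N * k + d by nia.
by rewrite modnMDl.
Qed.

Lemma deg_disjointU (G : mgraph) (F H : {set edge G}) v : [disjoint F & H] ->
  deg (F :|: H) v = deg F v + deg H v.
Proof. by move=> FH; rewrite /deg -bigU //=; apply: eq_bigl => e; rewrite !inE. Qed.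

Lemma tree_connected_branchings (G : mgraph) m (H : {set edge G}) (T : nat -> {set edge G}) :
  (forall i, i < m -> T i \subset H /\ connected (T i)) ->
  (forall i j, i < m -> j < m -> i != j -> [disjoint T i & T j]) ->
  tree_connected m H.
Proof.
move=> hT dT; have /fin_all_exists[T' hT'] (i : 'I_m) : exists T' : {set edge G},
    T' \subset T i /\ spanning_tree T'.
  have [_ /spanning_subtree[T' h1 h2]] := hT i (ltn_ord i).
  by exists T'.
exists T'; split=> [i|i j ij].
  have [h1 h2] := hT' i; split => //.
  by apply: subset_trans h1 _; have [] := hT i (ltn_ord i).
have [h1 _] := hT' i; have [h2 _] := hT' j.
by apply: disjointWl h1 (disjointWr h2 _); apply: dT.
Qed.

(** * The factor obtained from branchings and re-orientation *)

Section Parity.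
Variables (G : mgraph) (k m : nat) (f : vert G -> 'I_k) (A : {set vert G}) (r : vert G).
Variables (s : edge G -> bool) (U F : {set edge G}).
Hypotheses (k_gt0 : 0 < k) (hA : forall e : edge G, ((ends e).1 \in A) != ((ends e).2 \in A)).
Hypotheses (hf : compatible f) (degUF : forall v, deg setT v = deg U v + deg F v).
Hypotheses (indegUF : forall v, indeg s setT v = indeg s U v + indeg s F v).
Hypotheses (half_in : forall v, (deg setT v)./2 <= indeg s setT v).
Hypotheses (inU : forall v, indeg s U v <= m).
Hypotheses (rootF : forall S, S != set0 -> r \notin S -> k + k - 2 <= entering s F S).

Lemma parity_factor : exists2 H : {set edge G}, H \subset F & forall v,
  deg U v + deg H v = f v %[mod k] /\
  (deg setT v)./2 - (k - 1) <= deg U v + deg H v <= uphalf (deg setT v) + (k - 1) + m.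
Proof.
pose D := arc_count s F.
pose sg (v : vert G) (z : int) := (if v \in A then z else - z)%R.
(* The net value is [2 * deg H - deg F], with sign, so doubling the wanted degree of [H], namely
   [f v - deg U v], turns a congruence modulo k into one modulo 2k. The bounds omit k - 1, which the
   slack 2k - 2 of [reorient] supplies after halving. *)
pose b v := sg v (2 * ((f v)%:Z - (deg U v)%:Z) - (deg F v)%:Z)%R.
pose Pl v := (2 * ((deg setT v)./2%:Z - (deg U v)%:Z) - (deg F v)%:Z)%R.
pose Pu v := (2 * ((uphalf (deg setT v))%:Z + m%:Z - (deg U v)%:Z) - (deg F v)%:Z)%R.
pose lam v := if v \in A then Pl v else (- Pu v)%R.
pose eta v := if v \in A then Pu v else (- Pl v)%R.
have half v : ((deg setT v)./2 <= indeg s setT v /\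
    (deg setT v)./2 + uphalf (deg setT v) = deg setT v).
  by split => //; rewrite uphalf_half addnCA addnn odd_double_half.
have [p [hp hpt]] : rooted_sol k setT D b lam eta.
  apply: (@reorient _ _ k_gt0 setT r D b lam eta set0); split.
  - by rewrite inE.
  - move=> v _; rewrite net_arc_count /b /lam /eta /sg /Pl /Pu (deg_in_out s F v).
    case: (v \in A); split.
    + by exists ((f v)%:Z - (deg U v)%:Z - (outdeg s F v)%:Z)%R; clear; lia.
    + by exists ((deg setT v)./2%:Z - (deg U v)%:Z - (outdeg s F v)%:Z)%R; clear; lia.
    + by exists ((uphalf (deg setT v))%:Z + m%:Z - (deg U v)%:Z - (outdeg s F v)%:Z)%R; clear; lia.
    + by exists (- (f v)%:Z + (deg U v)%:Z + (indeg s F v)%:Z)%R; clear; lia.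
    + by exists (- (uphalf (deg setT v))%:Z - m%:Z + (deg U v)%:Z + (indeg s F v)%:Z)%R; clear; lia.
    by exists (- (deg setT v)./2%:Z + (deg U v)%:Z + (indeg s F v)%:Z)%R; clear; lia.
  - have [q hq] := compatible_sides hA hf; exists q.
    rewrite (bsumC _ (subsetT A)) setTD /bsum.
    rewrite (eq_bigr (fun v => 2 * ((f v)%:Z - (deg U v)%:Z) - (deg F v)%:Z)%R); last first.
      by move=> v vA; rewrite /b /sg vA.
    rewrite [X in (_ + X)%R](eq_bigr (fun v => - (2 * ((f v)%:Z - (deg U v)%:Z) - (deg F v)%:Z))%R); last first.
      by move=> v; rewrite inE => /negPf vA; rewrite /b /sg vA.
    rewrite sumrN !sumrB -!mulr_sumr !sumrB hq -!sumZ (sum_deg_sides hA U) (sum_deg_sides hA F).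
    by clear; lia.
  - move=> S _ S0 rS _; rewrite din_arc_count; have := rootF S0 rS; clear; lia.
  (* Lower bound: half the degree, rounded down, is at most the indegree, hence at most [deg U] plus
     the indegree in [F]. Upper bound: the outdegree is at most half the degree rounded up, and [U]
     adds at most [m] entering edges. *)
  - move=> v _; have [h1 h2] := half v; have h3 := degUF v; have h4 := indegUF v; have h5 := inU v.
    have h6 := deg_in_out s U v; have h7 := deg_in_out s F v.
    rewrite net_arc_count /lam /eta /Pl /Pu; case: (v \in A); clear -h1 h2 h3 h4 h5 h6 h7; split; lia.
  by move=> x; rewrite inE.
have [H HF hH] := realize_factor hA hp.
exists H => // v; have [[q hq] h1 h2] := hpt v (in_setT v).
have [_ h3] := half v; have h4 := degUF v.
move: hq h1 h2; rewrite hH /b /lam /eta /sg /Pl /Pu; case: (v \in A) => hq h1 h2; split.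
- by apply: (@mod_of_cong k _ _ q); move: hq; clear; lia.
- by move: h1 h2 h3 h4 k_gt0; clear; lia.
- by apply: (@mod_of_cong k _ _ (- q)%R); move: hq; clear; lia.
by move: h1 h2 h3 h4 k_gt0; clear; lia.
Qed.

End Parity.

Theorem theorem1p3 (G : mgraph) (k m : nat) (f : vert G -> 'I_k) :
  0 < k ->
  bipartite G ->
  compatible f ->
  edge_connected G (2 * m + 4 * k - 4) ->
  exists H : {set edge G},
    tree_connected m H /\
    (forall v : vert G, deg H v = f v %[mod k]) /\
    (forall v : vert G,
       (deg [set: edge G] v)./2 - (k - 1) <= deg H v
         <= uphalf (deg [set: edge G] v) + (k - 1) + m).
Proof.
move=> k_gt0 [A hA] hf hG.
(* A graph without vertices has no root; the empty factor serves there. *)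
case: (pickP (@predT (vert G))) => [r _|no]; last first.
  have nov (v : vert G) : False by have := no v.
  exists set0; split; last by split=> v; case: (nov v).
  exists (fun=> set0); split=> [i|i j _]; last by rewrite -setI_eq0 setI0.
  split; first exact: sub0set.
  by split=> [x|[|[v e] c]]; [case: (nov x) | | case: (nov v)].
pose N := m + (k + k - 2).
have cutN (S : {set vert G}) : S != set0 -> S != setT -> 2 * N <= edges_across setT S.
  move=> S0 SN; have := ecut_edge_connected hG S0 SN.
  by rewrite /N; move: k_gt0; clear; lia.
have [s [half_in rootG]] := balanced_orientation r cutN.
have [U [T [_ hT dT inU rootF]]] := branchings (m := m) (l := k + k - 2) rootG.
rewrite setTD in rootF.
have UF : [disjoint U & ~: U] by rewrite -setI_eq0 setICr.
have degUF v : deg setT v = deg U v + deg (~: U) v by rewrite -deg_disjointU // setUCr.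
have indegUF v : indeg s setT v = indeg s U v + indeg s (~: U) v.
  by rewrite /indeg -bigU //=; apply: eq_bigl => e; rewrite !inE orbN.
have [H HF hH] := parity_factor k_gt0 hA hf degUF indegUF half_in inU rootF.
have UH : [disjoint U & H] by apply: disjointWr HF UF.
exists (U :|: H); split.
  apply: (tree_connected_branchings (T := T)) => // i im; have [h1 h2] := hT i im.
  by split => //; apply: subset_trans h1 (subsetUl _ _).
by split=> v; rewrite deg_disjointU //; have [] := hH v.
Qed.
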